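(* Let $\alpha\in(0,\infty)^{\mathbb N}$ with $\sum_{i\ge1}\alpha_i<\infty$ and $\alpha_\infty>0$. For any $x\in\Delta^{(\infty)}$ and $T>0$, the laws $P^{(n)}_{x,T}$ (defined in the context) converge weakly, as $n\to\infty$, to a probability measure $P^{(\infty)}_{x,T}$ on $\Omega_T$. Moreover, $P^{(\infty)}_{x,T}$ solves the martingale problem of $L^{(\infty)}_{\alpha,\alpha_\infty}$: for every $f\in\mathscr FC^2$, with $X(t)(\omega)=\omega(t)$ the coordinate process and $\mathcal F_t=\sigma(\omega_s:s\in[0,t])$, $$f(X(t))-\int_0^tL^{(\infty)}_{\alpha,\alpha_\infty}f(X(s))\,ds,\qquad t\in[0,T],$$ is an $(\mathcal F_t)$-martingale under $P^{(\infty)}_{x,T}$.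
   Context: $\Delta^{(\infty)}=\{x\in[0,1]^{\mathbb N}:\sum_{i\ge1}x_i\le1\}$, $|x|_1=\sum_i |x_i|$; $\Delta^{(n)}=\{z\in[0,1]^n:\sum_{i\le n}z_i\le1\}$ is embedded in $\Delta^{(\infty)}$ by setting $z_i=0$ for $i>n$. $\Omega_T=C([0,T];\Delta^{(\infty)})$ with the norm $\|\xi\|_{1,\infty}=\sup_{t\in[0,T]}|\xi(t)|_1$. For $n\ge1$ let $\alpha^{(n)}_i=\alpha_i$ for $i<n$ and $\alpha^{(n)}_n=\sum_{j\ge n}\alpha_j$, and let $$L^{(n)}_{\alpha,\alpha_\infty}=\sum_{i=1}^n\Big\{\Big[\alpha^{(n)}_i\Big(1-\sum_{j=1}^nx_j\Big)-\alpha_\infty x_i\Big]\partial_i+\Big(1-\sum_{j=1}^nx_j\Big)x_i\partial_i^2\Big\},$$ the generator of the diffusion on $\Delta^{(n)}$ solving $dX_i=[\alpha^{(n)}_i(1-|X|_1)-\alpha_\infty X_i]dt+\sqrt{2(1-|X|_1)X_i}\,dB_i$, $1\le i\le n$, with independent Brownian motions $B_i$. $P^{(n)}_{x,T}$ is the law on $\Omega_T$ of this diffusion on $[0,T]$ started at $x^{(n)}=(x_1,\dots,x_{n-1},\sum_{j\ge n}x_j)$. $\mathscr FC^2$ is the class of functions $f(x)=g(x_1,\dots,x_m)$, $m\in\mathbb N$, $g\in C^2(\mathbb R^m)$, and $L^{(\infty)}_{\alpha,\alpha_\infty}f(x)=\sum_{n\ge1}\big(x_n(1-|x|_1)\partial_n^2f(x)+\{\alpha_n(1-|x|_1)-\alpha_\infty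 x_n\}\partial_nf(x)\big)$. *)

(* Defs.v *)
From HB Require Import structures.
From mathcomp Require Import all_boot all_order all_algebra.
From mathcomp Require Import all_classical all_reals all_analysis.
Set Implicit Arguments. Unset Strict Implicit. Unset Printing Implicit Defensive.
Import Order.TTheory GRing.Theory Num.Theory.
Import numFieldNormedType.Exports.
Local Open Scope classical_set_scope.
Local Open Scope ring_scope.

(* Indexing convention: the paper's coordinates x_1, x_2, ... are stored
   0-based: x : nat -> R with x i = x_{i+1}.  Likewise alpha i = alpha_{i+1}. *)

Definition l1 (R : realType) (y : nat -> R) : R :=
  limn (fun n => \sum_(i < n) `|y i|).

Definition in_Delta (R : realType) (y : nat -> R) : Prop :=
  (forall i, 0 <= y i <= 1) /\ (forall n, \sum_(i < n) y i <= 1).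

(* A path omega in Omega_T = C([0,T]; Delta^(infty)) with the |.|_1 topology.
   Paths are represented as functions R -> (nat -> R); the values outside
   [0,T] are normalised to 0 so that each element of Omega_T has a unique
   representative. *)
Definition is_path (R : realType) (T : R) (w : R -> nat -> R) : Prop :=
  [/\ (forall t, 0 <= t <= T -> in_Delta (w t)),
      (forall t, ~ (0 <= t <= T) -> w t = (fun _ => 0)) &
      (forall t, 0 <= t <= T -> forall e : R, 0 < e -> exists2 d : R, 0 < d &
         forall s, 0 <= s <= T -> `|s - t| < d ->
           l1 (fun i => w s i - w t i) < e)].

Record Omega (R : realType) (T : R) := MkOmega {
  opath :> R -> nat -> R;
  pathP : is_path T opath }.

Lemma l1_0 (R : realType) : l1 (fun _ : nat => (0 : R)) = 0.
Proof.
rewrite /l1.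
under eq_fun do rewrite big1 ?normr0 //.
exact: lim_cst.
Qed.

Lemma is_path0 (R : realType) (T : R) : is_path T (fun _ _ => 0).
Proof.
split.
- move=> t _; split=> [i|n]; first by rewrite lexx ler01.
  by rewrite big1 // ler01.
- by [].
- move=> t _ e e0; exists 1 => // s _ _.
  by rewrite (_ : (fun i => _) = fun _ => 0) ?l1_0 //; apply: funext => i; rewrite subrr.
Qed.

HB.instance Definition _ (R : realType) (T : R) := gen_eqMixin (Omega T).
HB.instance Definition _ (R : realType) (T : R) := gen_choiceMixin (Omega T).
HB.instance Definition _ (R : realType) (T : R) :=
  isPointed.Build (Omega T) (MkOmega (is_path0 T)).

Definition dist_Omega (R : realType) (T : R) (w v : Omega T) : R :=
  sup [set l1 (fun i => w t i - v t i) | t in [set t | 0 <= t <= T]].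

Definition open_Omega (R : realType) (T : R) : set (set (Omega T)) :=
  fun U => forall w, U w -> exists2 e : R, 0 < e &
             forall v, dist_Omega w v < e -> U v.

Definition OmegaB (R : realType) (T : R) := g_sigma_algebraType (@open_Omega R T).

Definition filt_gen (R : realType) (T : R) (t : R) : set (set (OmegaB T)) :=
  fun A => exists s i (B : set R), [/\ 0 <= s <= t, measurable B &
             A = (fun w : OmegaB T => opath w s i) @^-1` B].

Definition filt (R : realType) (T : R) (t : R) : set (set (OmegaB T)) :=
  <<s @filt_gen R T t >>.

Definition is_martingale (R : realType) (T : R) (P : probability (OmegaB T) R)
  (M : R -> OmegaB T -> R) : Prop :=
  (forall t, 0 <= t <= T ->
     (forall B : set R, measurable B -> @filt _ T t (M t @^-1` B)) /\
     P.-integrable setT (fun w => (M t w)%:E)) /\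
  (forall s t, 0 <= s -> s <= t -> t <= T -> forall A, @filt _ T s A ->
     Rintegral P A (M t) = Rintegral P A (M s)).

Definition firstm (R : realType) (m : nat) (y : nat -> R) : 'rV[R]_m :=
  \row_(j < m) y j.

Definition partial (R : realType) (m : nat) (g : 'rV[R]_m -> R) (i : 'I_m) :
  'rV[R]_m -> R := fun v => derive g v (delta_mx 0 i).

Definition C2 (R : realType) (m : nat) (g : 'rV[R]_m -> R) : Prop :=
  [/\ continuous g,
      (forall i v, derivable g v (delta_mx 0 i)),
      (forall i, continuous (partial g i)),
      (forall i j v, derivable (partial g i) v (delta_mx 0 j)) &
      (forall i j, continuous (partial (partial g i) j))].

(* L^(infty)_{alpha,alpha_infty} f for f(x) = g(x_1,...,x_m) in FC^2 (the
   terms with n > m vanish since d_n f = 0 there) *)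
Definition Linf (R : realType) (alpha : nat -> R) (ainf : R) (m : nat)
  (g : 'rV[R]_m -> R) (x : nat -> R) : R :=
  \sum_(i < m)
    (x i * (1 - l1 x) * partial (partial g i) i (firstm m x)
     + (alpha i * (1 - l1 x) - ainf * x i) * partial g i (firstm m x)).

(* alpha^(n)_i (0-based index i < n) *)
Definition alphan (R : realType) (alpha : nat -> R) (n : nat) (i : nat) : R :=
  if (i.+1 < n)%N then alpha i else limn (fun N => \sum_(n.-1 <= j < N) alpha j).

Definition xn (R : realType) (x : nat -> R) (n : nat) (i : nat) : R :=
  if (i.+1 < n)%N then x i
  else if i == n.-1 then limn (fun N => \sum_(n.-1 <= j < N) x j) else 0.

Definition Ln (R : realType) (alpha : nat -> R) (ainf : R) (n : nat)
  (g : 'rV[R]_n -> R) (z : nat -> R) : R :=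
  \sum_(i < n)
    ((alphan alpha n i * (1 - \sum_(j < n) z j) - ainf * z i)
        * partial g i (firstm n z)
     + (1 - \sum_(j < n) z j) * z i * partial (partial g i) i (firstm n z)).

(* P is a law on Omega_T of the Delta^(n)-valued diffusion with generator
   L^(n) started at x^(n): its paths start at x^(n), live in Delta^(n)
   (coordinates >= n vanish), and it solves the martingale problem for L^(n). *)
Definition law_n (R : realType) (alpha : nat -> R) (ainf : R) (T : R)
  (x : nat -> R) (n : nat) (P : probability (OmegaB T) R) : Prop :=
  [/\ P [set w : OmegaB T | forall i, opath w 0 i = xn x n i] = 1%E,
      (forall t i, 0 <= t <= T -> (n <= i)%N ->
         P [set w : OmegaB T | opath w t i = 0] = 1%E) &
      (forall g : 'rV[R]_n -> R, C2 g ->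
         is_martingale P (fun t (w : OmegaB T) =>
           g (firstm n (opath w t)) -
           Rintegral lebesgue_measure [set u | 0 <= u <= t]
             (fun u => Ln alpha ainf g (opath w u))))].

Definition weak_cvg (R : realType) (T : R) (P : nat -> probability (OmegaB T) R)
  (Q : probability (OmegaB T) R) : Prop :=
  forall F : OmegaB T -> R,
    (exists M : R, forall w, `|F w| <= M) ->
    (forall w (e : R), 0 < e -> exists2 d : R, 0 < d &
       forall v, dist_Omega w v < d -> `|F v - F w| < e) ->
    (fun n => Rintegral (P n) setT F) @ \oo --> Rintegral Q setT F.

(* Main.v *)
Require Import Defs.
From HB Require Import structures.
From mathcomp Require Import all_boot all_order all_algebra.
From mathcomp Require Import all_classical all_reals all_analysis measurable_realfun.
From mathcomp Require Import ring lra zify.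
Set Implicit Arguments. Unset Strict Implicit. Unset Printing Implicit Defensive.
Import Order.TTheory GRing.Theory Num.Theory.
Import numFieldNormedType.Exports.
Local Open Scope classical_set_scope.
Local Open Scope ring_scope.

(* The limit law is built first, without any tightness argument.  For each N a
   Markov chain on the (N+1)-dimensional simplex with time step T / 2^N has the
   drift and covariance of the diffusion.  An ultrafilter limit of the expectations of
   the chains is a mean on uniformly continuous cylinder functions of the tail
   masses y_m = sum_(i >= m) x_i at dyadic times; reading off binary digits,
   it is realised by random variables on [0, 1] with Lebesgue measure.  Fourth
   moments bound the increments of y_m by C_m |t - s|^2 with C_m -> 0, which
   gives almost surely a path in l^1, and the generator estimates of the chains pass to
   the limit as the martingale problem of every finite lumping of coordinates.

   Lumping the coordinates >= n of the limit law yields a solution of the n-th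
   martingale problem.  That problem has a unique solution: its generator maps
   polynomials of degree <= D to polynomials of degree <= D, so mixed moments
   obey closed linear equations.  Hence any given P^(n) is the image
   of the limit law under lumping, and since lumped paths converge uniformly in l^1
   to the original path, weak convergence is bounded convergence. *)

(** * Expectations of bounded measurable functions *)

(** The state space is not compact for the l^1 norm: in a coordinatewise limit mass may escape to
    infinity, while the generator involves the total mass. Observing the tail masses [y_m], among
    them the total mass [y_0], makes every term of the martingale problem a continuous function of
    finitely many numbers in [[0, 1]]. Loss of mass is then excluded because [C_m] is linear in the
    tails of [x] and [alpha]. All dimensions fit together because lumping is exact: the [alpha_i]
    add up over a block and the variance [2 (1 - |x|) x_i] is linear in [x_i], so that a block sum
    is again a coordinate of a diffusion of the same family. One infinite-dimensional law thus
    contains all finite-dimensional ones. The square-root coefficient is not Lipschitz, so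
    uniqueness is not sought from the stochastic equation. The coefficients of the generator are
    polynomials and the coordinates stay in [[0, 1]], where moments determine laws. Uniqueness also
    makes the choice of the ultrafilter harmless. *)

Definition bmf d (T : measurableType d) (R : realType) (f : T -> R) : Prop :=
  measurable_fun setT f /\ exists M : R, forall x, `|f x| <= M.

Section bounded_measurable.
Context d (T : measurableType d) (R : realType).
Implicit Types f g : T -> R.

Lemma bmf_cst (c : R) : bmf (fun _ : T => c).
Proof. by split; [exact: measurable_cst | exists `|c|]. Qed.

Lemma bmfD f g : bmf f -> bmf g -> bmf (fun x => f x + g x).
Proof.
move=> [mf [M hM]] [mg [N hN]]; split; first exact: measurable_funD.
by exists (M + N) => x; rewrite (le_trans (ler_normD _ _))// lerD.
Qed.

Lemma bmfM f g : bmf f -> bmf g -> bmf (fun x => f x * g x).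
Proof.
move=> [mf [M hM]] [mg [N hN]]; split; first exact: measurable_funM.
by exists (M * N) => x; rewrite normrM ler_pM.
Qed.

Lemma bmfZ (c : R) f : bmf f -> bmf (fun x => c * f x).
Proof. by move=> hf; apply: bmfM => //; exact: bmf_cst. Qed.

Lemma bmfB f g : bmf f -> bmf g -> bmf (fun x => f x - g x).
Proof.
move=> [mf [M hM]] [mg [N hN]]; split; first exact: measurable_funB.
by exists (M + N) => x; rewrite (le_trans (ler_normB _ _))// lerD.
Qed.

Lemma bmf_norm f : bmf f -> bmf (fun x => `|f x|).
Proof.
move=> [mf [M hM]]; split; first exact: measurableT_comp.
by exists M => x; rewrite normr_id.
Qed.

Lemma bmfX f n : bmf f -> bmf (fun x => f x ^+ n).
Proof.
move=> hf; elim: n => [|n ih].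
  by under eq_fun do rewrite expr0; exact: bmf_cst.
by under eq_fun do rewrite exprS; exact: bmfM.
Qed.

Lemma bmf_sum (I : Type) (r : seq I) (p : pred I) (F : I -> T -> R) :
  (forall i, bmf (F i)) -> bmf (fun x => \sum_(i <- r | p i) F i x).
Proof.
move=> hF; elim: r => [|i r ih].
  by under eq_fun do rewrite big_nil; exact: bmf_cst.
under eq_fun do rewrite big_cons.
by case: (p i) => //; exact: bmfD.
Qed.

Lemma bmf_prod (I : Type) (r : seq I) (F : I -> T -> R) :
  (forall i, bmf (F i)) -> bmf (fun x => \prod_(i <- r) F i x).
Proof.
move=> hF; elim: r => [|i r ih].
  by under eq_fun do rewrite big_nil; exact: bmf_cst.
by under eq_fun do rewrite big_cons; exact: bmfM.
Qed.

Lemma bmf_indic (A : set T) : measurable A -> bmf (\1_A : T -> R).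
Proof.
move=> mA; split; first exact: measurable_indic.
by exists 1 => x; rewrite indicE; case: (_ \in _); rewrite ?normr1 ?normr0.
Qed.

Lemma bmf_lim (h : (T -> R)^nat) f (M : R) : (forall n, bmf (h n)) ->
  (forall n x, `|h n x| <= M) -> (forall x, h n x @[n --> \oo] --> f x) ->
  bmf f.
Proof.
move=> mh hM hc; split.
  by apply: (measurable_fun_cvg (h := h)) => [n|x _]; [exact: (mh n).1|exact: hc].
exists M => x; apply: (cvgr_to_le (cvg_norm (hc x))).
by apply: nearW => n; exact: hM.
Qed.

End bounded_measurable.

Section expectation.
Context d (T : measurableType d) (R : realType) (P : probability T R).
Implicit Types f g : T -> R.

Definition Ex (f : T -> R) : R := Rintegral P setT f.

Lemma bmf_integrable f : bmf f -> P.-integrable setT (EFin \o f).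
Proof.
move=> [mf [M hM]].
apply: (@le_integrable _ _ _ P setT measurableT _ (EFin \o (fun _ => M))).
- exact/measurable_EFinP.
- move=> x _ /=; rewrite lee_fin (le_trans (hM x))// ler_norm//.
- exact: finite_measure_integrable_cst.
Qed.

Lemma Ex_cst (c : R) : Ex (fun=> c) = c.
Proof. by rewrite /Ex Rintegral_cst//= probability_setT mulr1. Qed.

Lemma ExD f g : bmf f -> bmf g -> Ex (fun x => f x + g x) = Ex f + Ex g.
Proof. by move=> hf hg; apply: RintegralD => //; exact: bmf_integrable. Qed.

Lemma ExB f g : bmf f -> bmf g -> Ex (fun x => f x - g x) = Ex f - Ex g.
Proof. by move=> hf hg; apply: RintegralB => //; exact: bmf_integrable. Qed.

Lemma ExZ (c : R) f : bmf f -> Ex (fun x => c * f x) = c * Ex f.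
Proof. by move=> hf; apply: RintegralZl => //; exact: bmf_integrable. Qed.

Lemma eq_Ex f g : f =1 g -> Ex f = Ex g.
Proof. by move=> fg; apply: eq_Rintegral => x _; exact: fg. Qed.

Lemma Ex_sum (I : Type) (r : seq I) (p : pred I) (F : I -> T -> R) :
  (forall i, bmf (F i)) ->
  Ex (fun x => \sum_(i <- r | p i) F i x) = \sum_(i <- r | p i) Ex (F i).
Proof.
move=> hF; elim: r => [|i r ih].
  by rewrite big_nil -[RHS](Ex_cst 0); apply: eq_Ex => x; rewrite big_nil.
rewrite big_cons; case: ifPn => pi; last first.
  by rewrite -ih; apply: eq_Ex => x; rewrite big_cons (negbTE pi).
rewrite -ih -ExD//; last exact: bmf_sum.
by apply: eq_Ex => x; rewrite big_cons pi.
Qed.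

Lemma le_Ex f g : bmf f -> bmf g -> (forall x, f x <= g x) -> Ex f <= Ex g.
Proof.
by move=> hf hg fg; apply: le_Rintegral => //; exact: bmf_integrable.
Qed.

Lemma Ex_abs_le f (M : R) : bmf f -> (forall x, `|f x| <= M) -> `|Ex f| <= M.
Proof.
move=> hf hM; rewrite ler_norml; apply/andP; split.
  rewrite -[leLHS]Ex_cst; apply: le_Ex => //; first exact: bmf_cst.
  by move=> x; have := hM x; rewrite ler_norml => /andP[].
rewrite -[leRHS]Ex_cst; apply: le_Ex => //; first exact: bmf_cst.
by move=> x; have := hM x; rewrite ler_norml => /andP[].
Qed.

Lemma Ex_cvg (h : (T -> R)^nat) f (M : R) : (forall n, bmf (h n)) ->
  (forall n x, `|h n x| <= M) -> (forall x, h n x @[n --> \oo] --> f x) ->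
  Ex (h n) @[n --> \oo] --> Ex f.
Proof.
move=> mh hM hc; have hf := bmf_lim mh hM hc.
have [] := @dominated_convergence _ _ _ P setT measurableT
  (fun n => EFin \o h n) (EFin \o f) (fun=> M%:E).
- by move=> n; apply/measurable_EFinP; exact: (mh n).1.
- by apply/measurable_EFinP; exact: hf.1.
- by apply: aeW => x _ /=; apply/cvg_EFin; [exact: nearW|exact: hc].
- exact: finite_measure_integrable_cst.
- by apply: aeW => x n _ /=; rewrite lee_fin.
- move=> _ _ hh; rewrite /Ex /Rintegral.
  apply: fine_cvg => /=; rewrite fineK; first exact: hh.
  by apply: integrable_fin_num => //; exact: bmf_integrable.
Qed.

Lemma prob1_setC (A : set T) : measurable A -> P A = 1%E -> P (~` A) = 0%E.
Proof. by move=> mA PA; rewrite probability_setC// PA subee. Qed.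

Lemma prob0_setC (A : set T) : measurable A -> P (~` A) = 0%E -> P A = 1%E.
Proof.
move=> mA PA; rewrite -[A]setCK probability_setC ?PA ?sube0//.
exact: measurableC.
Qed.

Lemma Ex_as f g (A : set T) : measurable A -> P A = 1%E -> bmf f -> bmf g ->
  (forall x, A x -> f x = g x) -> Ex f = Ex g.
Proof.
move=> mA PA hf hg fg; congr fine.
apply: ae_eq_integral => //; try (apply/measurable_EFinP).
- exact: hf.1.
- exact: hg.1.
exists (~` A); split; first exact: measurableC.
  exact: prob1_setC.
by apply: subsetC => x Ax _; rewrite fg.
Qed.

Lemma Ex_indic (A : set T) : measurable A -> Ex \1_A = fine (P A).
Proof. by move=> mA; rewrite /Ex /Rintegral integral_indic// setIT. Qed.

Lemma Rintegral_Ex (A : set T) f : Rintegral P A f = Ex (fun x => \1_A x * f x).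
Proof.
rewrite /Ex Rintegral_mkcond; apply: eq_Rintegral => x _.
by rewrite patchE indicE; case: (_ \in _); rewrite ?mul1r ?mul0r.
Qed.

Lemma prob1_capn (F : (set T)^nat) : (forall n, measurable (F n)) ->
  (forall n, P (F n) = 1%E) -> P (\bigcap_n F n) = 1%E.
Proof.
move=> mF PF; have mC : measurable (\bigcap_n F n) by exact: bigcap_measurable.
apply: prob0_setC => //.
rewrite setC_bigcap; apply/eqP; rewrite eq_le measure_ge0 andbT.
apply: (le_trans (measure_sigma_subadditive P (F := fun n => ~` F n) _ _ _)) => //.
- by move=> n; exact: measurableC.
- by apply: bigcup_measurable => n _; exact: measurableC.
- by rewrite eseries0// => n _ _; exact: prob1_setC.
Qed.

Lemma prob1I (A B : set T) : measurable A -> measurable B ->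
  P A = 1%E -> P B = 1%E -> P (A `&` B) = 1%E.
Proof.
move=> mA mB PA PB.
rewrite -bigcap2E; apply: prob1_capn => [n|n]; rewrite /bigcap2.
  by case: ifP => // _; case: ifP.
by case: ifP => // _; case: ifP => // _; exact: probability_setT.
Qed.

Lemma prob1S (A B : set T) : measurable A -> measurable B ->
  A `<=` B -> P A = 1%E -> P B = 1%E.
Proof.
move=> mA mB AB PA; apply/eqP; rewrite eq_le probability_le1//= -PA.
by apply: le_measure; rewrite ?inE.
Qed.

(** Limits of means deliver only inequalities between expectations; this is how [E|f| <= 0] becomes
    an almost sure identity. *)
Lemma prob1_norm_eq0 f : bmf f -> Ex (fun x => `|f x|) <= 0 ->
  P [set x | f x = 0] = 1%E.
Proof.
move=> hf h0; have mS : measurable [set x | f x = 0].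
  rewrite (_ : [set x | f x = 0] = setT `&` f @^-1` [set 0]); last by rewrite setTI.
  exact: hf.1.
have hfi := bmf_integrable (bmf_norm hf).
have h0' : (\int[P]_x `|(f x)%:E| = 0)%E.
  have h1 : (\int[P]_x `|(f x)%:E| >= 0)%E by exact: integral_ge0.
  apply/eqP; rewrite eq_le h1 andbT.
  have : (\int[P]_x (`|f x|)%:E)%E \is a fin_num by exact: integrable_fin_num.
  move=> /fineK; rewrite -[fine _]/(Ex (fun x => `|f x|)) => <-.
  by rewrite lee_fin.
have /ae_eq_integral_abs : measurable_fun setT (EFin \o f).
  by apply/measurable_EFinP; exact: hf.1.
move=> /(_ P measurableT)[/(_ h0')[N [mN N0 hN]] _].
apply: prob0_setC => //.
apply/eqP; rewrite eq_le measure_ge0 andbT -N0.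
apply: le_measure; rewrite ?inE//; first exact: measurableC.
apply: subset_trans hN => x /= fx; apply: contra_not fx => /(_ I) /=.
by move=> [].
Qed.

End expectation.

(** * Probability measures from limits of means on a cube *)

Section binary_digits.
Variable R : realType.
Implicit Types (r : R) (c : nat -> R) (b : nat -> bool).

(** The digit of weight [2 ^- k]. Index 0 is the units digit, so that the value 1 has an expansion
    as well; hence the range [[0, 2[] below. *)
Definition dig (k : nat) r : bool := odd (Num.truncn (2 ^+ k * r)).

Lemma truncn_double r : 0 <= r ->
  Num.truncn (2 * r) = (dig 1 r + (Num.truncn r).*2)%N.
Proof.
move=> r0; rewrite /dig expr1.
suff -> : Num.truncn r = (Num.truncn (2 * r))./2 by rewrite odd_double_half.
apply/eqP; rewrite truncn_eq//.
have /truncn_itv/andP[] : 0 <= 2 * r by rewrite mulr_ge0.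
set n := Num.truncn _ => h1 h2.
have e : n%:R = (odd n)%:R + 2 * (n./2)%:R :> R.
  by rewrite -{1}(odd_double_half n) natrD -mul2n natrM.
rewrite -[n.+1%:R]natr1 in h2; rewrite -[_.+1%:R]natr1.
by rewrite e in h1 h2; case: (odd n) h1 h2 => /= h1 h2; apply/andP; split; lra.
Qed.

Lemma dig_sum K r : 0 <= r < 2 ->
  \sum_(k < K.+1) (dig k r)%:R * 2 ^- k = (Num.truncn (2 ^+ K * r))%:R * 2 ^- K :> R.
Proof.
move=> /andP[r0 r2]; elim: K => [|K ih].
  rewrite big_ord1 /dig expr0 mul1r invr1 !mulr1.
  have : (Num.truncn r < 2)%N by rewrite truncn_lt_nat.
  by case: (Num.truncn r) => [|[|]].
rewrite big_ord_recr/= ih exprS -mulrA truncn_double; last first.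
  by rewrite mulr_ge0// exprn_ge0.
have -> : dig 1 (2 ^+ K * r) = dig K.+1 r by rewrite /dig expr1 mulrA -exprS.
rewrite natrD -mul2n natrM.
by have : (2 : R) ^+ K != 0 by []; move=> ?; field.
Qed.

Lemma dig_approx K r : 0 <= r < 2 ->
  0 <= r - \sum_(k < K.+1) (dig k r)%:R * 2 ^- k <= 2 ^- K.
Proof.
move=> r02; rewrite dig_sum//; case/andP: r02 => r0 _.
have /truncn_itv/andP[] : 0 <= 2 ^+ K * r by rewrite mulr_ge0// exprn_ge0.
set n := Num.truncn _; rewrite -[n.+1%:R]natr1 => h1 h2.
have p0 : 0 < (2 : R) ^- K by rewrite invr_gt0 exprn_gt0.
have e : 2 ^- K * (2 ^+ K * r) = r by rewrite mulrA mulVf ?mul1r.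
have := ler_wpM2l (ltW p0) h1; have := ler_wpM2l (ltW p0) (ltW h2).
rewrite e mulrDr mulr1 => h3 h4; apply/andP; split; lra.
Qed.

Lemma binary_tail c K n : (forall k, 0 <= c k <= 1) ->
  0 <= \sum_(0 <= k < n) c k * 2 ^- k -
       \sum_(0 <= k < n | (k <= K)%N) c k * 2 ^- k <= 2 ^- K.
Proof.
move=> c01.
have t k : 0 <= c k * 2 ^- k by rewrite mulr_ge0 ?invr_ge0 ?exprn_ge0//; case/andP: (c01 k).
rewrite (bigID (fun k => (k <= K)%N))/= addrC addrK; apply/andP; split.
  exact: sumr_ge0.
apply: (@le_trans _ _ (\sum_(0 <= k < n | ~~ (k <= K)%N) 2 ^- k)).
  by apply: ler_sum => k _; rewrite ler_piMl ?invr_ge0 ?exprn_ge0//; case/andP: (c01 k).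
(* The exact geometric remainder is kept so that the induction on [n] closes; [maxn K n.-1] makes
   the bound 0 as long as no index exceeds [K]. *)
suff : \sum_(0 <= k < n | ~~ (k <= K)%N) 2 ^- k <= 2 ^- K - 2 ^- (maxn K n.-1) :> R.
  by move=> /le_trans; apply; rewrite gerBl invr_ge0 exprn_ge0.
elim: n => [|n ih].
  by rewrite big_geq// maxn0 subrr.
rewrite big_mkcond big_nat_recr//= -big_mkcond/= -ltnNge.
case: ltnP => [Kn|nK]; last first.
  have e1 : maxn K n.-1 = K by move: nK; clear; lia.
  by rewrite addr0; rewrite e1 in ih.
have e2 : maxn K n.-1 = n.-1 by move: Kn; clear; lia.
have n0 : n = n.-1.+1 by move: Kn; clear; lia.
rewrite e2 in ih.
have e3 : 2 ^- n.-1 = 2 * 2 ^- n :> R.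
  by rewrite {2}n0 exprS; have : (2 : R) ^+ n.-1 != 0 by []; move=> ?; field.
rewrite e3 in ih; lra.
Qed.

Lemma binary_diff c c' K n n' : (forall k, 0 <= c k <= 1) ->
  (forall k, 0 <= c' k <= 1) -> (K < n)%N -> (K < n')%N ->
  (forall k, (k <= K)%N -> c k = c' k) ->
  `|\sum_(0 <= k < n) c k * 2 ^- k - \sum_(0 <= k < n') c' k * 2 ^- k| <= 2 ^- K.
Proof.
move=> c1 c'1 Kn Kn' cc'.
have := binary_tail K n c1; have := binary_tail K n' c'1.
have aux m (d : nat -> R) : (K < m)%N ->
    \sum_(0 <= k < m | (k <= K)%N) d k * 2 ^- k = \sum_(0 <= k < K.+1) d k * 2 ^- k.
  move=> Km; rewrite [RHS](big_nat_widen _ _ m)//; exact: eq_bigl.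
rewrite !aux// (_ : \sum_(0 <= k < K.+1) c' k * 2 ^- k = \sum_(0 <= k < K.+1) c k * 2 ^- k); last first.
  by apply: eq_big_nat => k /andP[_ kK]; rewrite cc'.
move=> /andP[? ?] /andP[? ?]; rewrite ler_norml; apply/andP; split; lra.
Qed.

End binary_digits.

Section ultralimits.
Variables (R : realType) (U : set_system nat).
Hypothesis UU : UltraFilter U.

(** The image of an ultrafilter is an ultrafilter, and on a compact segment every ultrafilter
    converges. This replaces the extraction of subsequences. *)
Lemma ultra_bounded_cvg (u : nat -> R) (a b : R) :
  (forall n, a <= u n <= b) -> cvg (u @ U).
Proof.
move=> uab; have PU := @ultra_proper _ _ UU.
have UI : UltraFilter (u @ U).
  split; first exact: fmap_proper_filter.
  move=> G PG UG; rewrite eqEsubset; split => // A GA.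
  have [//|UA] := in_ultra_setVsetC (u @^-1` A) UU.
  have /UG GC : (u @ U) (~` A) by [].
  by exfalso; apply: (@filter_not_empty _ G PG); rewrite -(setICr A); exact: filterI.
have := @segment_compact R a b; rewrite compact_ultra => /(_ _ UI)[].
  have : U (u @^-1` `[a, b]) by apply: filterE => n /=; rewrite in_itv/=.
  by [].
by move=> l [_ ul]; apply/cvg_ex; exists l.
Qed.

End ultralimits.

Section words.
Implicit Types (b : nat -> bool) (w : seq bool).

Fixpoint words (n : nat) : seq (seq bool) :=
  if n is n'.+1 then map (cons false) (words n') ++ map (cons true) (words n')
  else [:: [::]].

(** The most recent bit comes first, so that lengthening a prefix is a [cons]; positions are read
    back through [rev]. *)
Fixpoint pref b (n : nat) : seq bool := if n is n'.+1 then b n' :: pref b n' else [::].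

Lemma size_pref b n : size (pref b n) = n.
Proof. by elim: n => //= n ->. Qed.

Lemma sum_words (R : realType) b n (F : seq bool -> R) :
  \sum_(w <- words n) (pref b n == w)%:R * F w = F (pref b n).
Proof.
elim: n F => [|n ih] F; first by rewrite big_seq1 eqxx mul1r.
rewrite /= big_cat/= !big_map; case: (b n).
  rewrite big1 ?add0r; last by move=> w _; rewrite eqseq_cons/= mul0r.
  by under eq_bigr do rewrite eqseq_cons eqxx/=; exact: (ih (fun w => F (true :: w))).
rewrite addrC big1 ?add0r; last by move=> w _; rewrite eqseq_cons/= mul0r.
by under eq_bigr do rewrite eqseq_cons eqxx/=; exact: (ih (fun w => F (false :: w))).
Qed.

Lemma nth_pref b n j : (j < n)%N -> nth false (rev (pref b n)) j = b j.
Proof.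
elim: n => // n ih; rewrite /= rev_cons nth_rcons size_rev size_pref ltnS leq_eqVlt.
by move=> /predU1P[->|jn]; [rewrite ltnn eqxx|rewrite jn ih].
Qed.

Lemma size_words n w : w \in words n -> size w = n.
Proof.
elim: n w => [|n ih] w; first by rewrite inE => /eqP ->.
by rewrite /= mem_cat => /orP[] /mapP[v /ih <- ->].
Qed.

End words.

Section coordinates_from_bits.
Variable R : realType.
Implicit Types (b : nat -> bool) (y : nat -> R).

Definition cube y : Prop := forall i, 0 <= y i <= 1.

(* The bits of a whole sequence are listed along [pickle : nat * nat -> nat]. *)
Definition seqbit y (j : nat) : bool :=
  if @unpickle (nat * nat)%type j is Some ik then dig ik.2 (y ik.1) else false.

Definition bitco b n i k : R :=
  if (@pickle (nat * nat)%type (i, k) < n)%N then (b (@pickle (nat * nat)%type (i, k)))%:R else 0.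

(** An arbitrary bit sequence with a units digit can encode any number up to 2; [Num.min 1] brings
    the value back into the cube. *)
Definition bitval b n i : R := Num.min 1 (\sum_(0 <= k < n) bitco b n i k * 2 ^- k).

Definition bitlim b i : R := limn (fun n => bitval b n i).

Lemma bitco01 b n i k : 0 <= bitco b n i k <= 1.
Proof. by rewrite /bitco; case: ifP => _; rewrite ?lexx ?ler01//; case: b; rewrite /= ?lexx ?ler01. Qed.

Lemma bitval01 b n : cube (bitval b n).
Proof.
move=> i; rewrite /bitval le_min ler01/= ge_min lexx andbT.
by apply: sumr_ge0 => k _; rewrite mulr_ge0 ?invr_ge0 ?exprn_ge0//; case/andP: (bitco01 b n i k).
Qed.

Lemma bitval_nd b i : nondecreasing_seq (fun n => bitval b n i).
Proof.
move=> m n mn; rewrite /bitval.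
suff h : \sum_(0 <= k < m) bitco b m i k / 2 ^+ k <= \sum_(0 <= k < n) bitco b n i k / 2 ^+ k.
  by rewrite le_min ge_min lexx/= ge_min h orbT.
rewrite (big_cat_nat (n := m) (leq0n _) mn)/= -[leLHS]addr0 lerD//.
  apply: ler_sum => k _; rewrite ler_wpM2r ?invr_ge0 ?exprn_ge0// /bitco.
  case: ifP => [km|_]; first by rewrite (leq_trans km mn).
  by case: ifP => // _; rewrite ler0n.
by apply: sumr_ge0 => k _; rewrite mulr_ge0 ?invr_ge0 ?exprn_ge0//; case/andP: (bitco01 b n i k).
Qed.

Lemma bitval_cvg b i : bitval b n i @[n --> \oo] --> bitlim b i.
Proof.
apply: nondecreasing_is_cvgn; first exact: bitval_nd.
by exists 1 => _ [n _ <-]; case/andP: (bitval01 b n i).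
Qed.

Lemma bitlim01 b : cube (bitlim b).
Proof.
move=> i; apply/andP; split.
  by apply: (cvgr_to_ge (@bitval_cvg b i)); apply: nearW => n; case/andP: (bitval01 b n i).
by apply: (cvgr_to_le (@bitval_cvg b i)); apply: nearW => n; case/andP: (bitval01 b n i).
Qed.

(** Number of bits to read in order to know the digits [0..K] of the coordinates [0..K]. The index
    [p] runs over these pairs by quotient and remainder, and the last summand ensures
    [K < depth K]. *)
Definition depth K : nat :=
  \max_(p < K.+1 * K.+1) (@pickle (nat * nat)%type (p %/ K.+1, p %% K.+1)%N).+1 + K.+1.

Lemma depth_gt K i k : (i <= K)%N -> (k <= K)%N ->
  (@pickle (nat * nat)%type (i, k) < depth K)%N.
Proof.
move=> iK kK; have lt : (i * K.+1 + k < K.+1 * K.+1)%N by nia.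
rewrite /depth; apply: ltn_addr; apply: leq_trans (leq_bigmax (Ordinal lt)) => /=.
by rewrite divnMDl// modnMDl divn_small ?modn_small// addn0.
Qed.

Lemma min1_dist (x y : R) : `|Num.min 1 x - Num.min 1 y| <= `|x - y|.
Proof. by rewrite /Num.min; do 2 case: ltP => ?; rewrite !ler_norml; have := ler_norm (x - y); have := ler_norm (y - x); rewrite (distrC y); lra. Qed.

Lemma depth_ge K : (K < depth K)%N.
Proof. by rewrite /depth; lia. Qed.

Lemma bitval_diff b b' K n n' i : (i <= K)%N -> (depth K <= n)%N -> (depth K <= n')%N ->
  (forall j, (j < depth K)%N -> b j = b' j) ->
  `|bitval b n i - bitval b' n' i| <= 2 ^- K.
Proof.
move=> iK n1 n2 bb'; apply: (le_trans (min1_dist _ _)).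
apply: binary_diff; [exact: bitco01|exact: bitco01| | |].
- exact: leq_trans (depth_ge K) _.
- exact: leq_trans (depth_ge K) _.
- move=> k kK; have h := depth_gt iK kK.
  by rewrite /bitco !(leq_trans h)// bb'.
Qed.

Lemma bitlim_diff b K n i : (i <= K)%N -> (depth K <= n)%N ->
  `|bitlim b i - bitval b n i| <= 2 ^- K.
Proof.
move=> iK hn.
have : `|bitval b m i - bitval b n i| @[m --> \oo] --> `|bitlim b i - bitval b n i|.
  by apply: cvg_norm; apply: cvgB; [exact: bitval_cvg|exact: cvg_cst].
move/cvgr_to_le; apply; exists (depth K) => // m /= hm.
exact: bitval_diff.
Qed.

(** The digits of [y i] are compared at two lengths: [m] digits, whose value tends to [y i], and
    those stored among the first [n] bits. *)
Lemma seqbit_diff y K n i : cube y -> (i <= K)%N -> (depth K <= n)%N ->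
  `|y i - bitval (seqbit y) n i| <= 2 ^- K.
Proof.
move=> cy iK hn; have y02 : 0 <= y i < 2.
  by case/andP: (cy i) => -> /= /le_lt_trans; apply; lra.
have lim1 : `|y i - \sum_(k < m.+1) (dig k (y i))%:R * 2 ^- k| @[m --> \oo] --> (0 : R).
  apply: (@squeeze_cvgr _ _ _ _ (fun=> 0) (fun m => 2 ^- m)).
  - apply: nearW => m; rewrite normr_ge0/= ger0_norm; case/andP: (dig_approx m y02) => //.
  - exact: cvg_cst.
  - by under eq_fun do rewrite -exprVn; apply: cvg_expr; rewrite ger0_norm; lra.
have h m : (n <= m)%N -> `|\sum_(k < m.+1) (dig k (y i))%:R * 2 ^- k -
    \sum_(0 <= k < n) bitco (seqbit y) n i k * 2 ^- k| <= 2 ^- K.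
  move=> nm; rewrite -(big_mkord xpredT (fun k => (dig k (y i))%:R * 2 ^- k)).
  apply: (@binary_diff _ (fun k => (dig k (y i))%:R)); [|exact: bitco01| | |].
  - by move=> k; case: (dig k _); rewrite /= ?lexx ?ler01.
  - by rewrite ltnS (leq_trans _ nm)// (leq_trans _ hn)// ltnW// depth_ge.
  - by rewrite (leq_trans _ hn)// depth_ge.
  - move=> k kK; rewrite /bitco (leq_trans (depth_gt iK kK))//.
    by rewrite /seqbit pickleK.
have key : `|y i - \sum_(0 <= k < n) bitco (seqbit y) n i k * 2 ^- k| <= 2 ^- K.
  have lim2 : (`|y i - \sum_(k < m.+1) (dig k (y i))%:R * 2 ^- k| + 2 ^- K) @[m --> \oo] --> (0 + 2 ^- K : R).
    by apply: cvgD => //; exact: cvg_cst.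
  rewrite add0r in lim2; apply: (cvgr_to_ge lim2).
  exists n => // m /= nm.
  apply: le_trans (ler_distD (\sum_(k < m.+1) (dig k (y i))%:R * 2 ^- k) _ _) _.
  by rewrite lerD2l h.
have <- : Num.min 1 (y i) = y i by apply/min_idPr; case/andP: (cy i).
exact: le_trans (min1_dist _ _) key.
Qed.

Definition wordval (w : seq bool) : nat -> R :=
  bitval (fun j => nth false (rev w) j) (size w).

Lemma bitval_pref b n : bitval b n = wordval (pref b n).
Proof.
apply/funext => i; rewrite /wordval /bitval size_pref; congr (Num.min 1 _).
by apply: eq_bigr => k _; rewrite /bitco; case: ifP => // h; rewrite nth_pref.
Qed.

End coordinates_from_bits.

Section mean_limits.
Variable R : realType.
Implicit Types (f g : (nat -> R) -> R).

Definition is_mean (L : ((nat -> R) -> R) -> R) : Prop :=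
  [/\ forall f g, L (fun y => f y + g y) = L f + L g,
      forall c f, L (fun y => c * f y) = c * L f,
      forall f g, (forall y, cube y -> f y <= g y) -> L f <= L g &
      L (fun=> 1) = 1].

(** Uniform continuity on the cube for the product topology; one integer [K] is both the number of
    coordinates examined and the precision. *)
Definition UC f : Prop := forall e : R, 0 < e -> exists K : nat,
  forall y z, cube y -> cube z -> (forall i, (i <= K)%N -> `|y i - z i| <= 2 ^- K) ->
  `|f y - f z| <= e.

Variable E : nat -> ((nat -> R) -> R) -> R.
Hypothesis Emean : forall N, is_mean (E N).
Variable U : set_system nat.
Hypotheses (UU : UltraFilter U) (Uoo : \oo `<=` U).

Let PU : ProperFilter U := @ultra_proper _ _ UU.

Lemma mean_sum N (I : Type) (r : seq I) (F : I -> (nat -> R) -> R) :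
  E N (fun y => \sum_(i <- r) F i y) = \sum_(i <- r) E N (F i).
Proof.
have [ED EZ _ _] := Emean N.
elim: r => [|i r ih].
  rewrite big_nil; under eq_fun do rewrite big_nil.
  by have := EZ 0 (fun=> 0); rewrite !mul0r.
by rewrite big_cons -ih -ED; congr E; apply: funext => y; rewrite big_cons.
Qed.

Definition cylind (w : seq bool) (y : nat -> R) : R :=
  (pref (seqbit y) (size w) == w)%:R.

(** A consistent family of weights on binary words. An ultralimit preserves finite additivity only;
    countable additivity is regained below by realising the family with Lebesgue measure. *)
Definition cylprob (w : seq bool) : R := lim (E N (cylind w) @[N --> U]).

Lemma cylind01 N w : 0 <= E N (cylind w) <= 1.
Proof.
have [ED EZ EM E1] := Emean N.
have E0 : E N (fun=> 0) = 0.
  by have := EZ 0 (fun=> 0); rewrite !mul0r.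
apply/andP; split; [rewrite -[leLHS]E0|rewrite -[leRHS]E1]; apply: EM => y _.
  by rewrite /cylind; case: eqP.
by rewrite /cylind; case: eqP => _; rewrite ?ler01.
Qed.

Lemma cylprob_cvg w : E N (cylind w) @[N --> U] --> cylprob w.
Proof. by apply: (ultra_bounded_cvg UU (cylind01 ^~ w)). Qed.

Lemma cylprob_ge0 w : 0 <= cylprob w.
Proof.
apply: (cvgr_to_ge (cylprob_cvg (w:=w))).
by apply: nearW => N; case/andP: (cylind01 N w).
Qed.

Lemma cylprob_nil : cylprob [::] = 1.
Proof.
rewrite /cylprob (_ : (fun N => E N (cylind [::])) = fun=> 1); first exact: lim_cst.
apply: funext => N; have [_ _ _ <-] := Emean N; congr E; exact: funext.
Qed.

Lemma cylprob_cons w : cylprob (false :: w) + cylprob (true :: w) = cylprob w.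
Proof.
apply: esym; apply: cvg_lim => //.
rewrite (_ : (fun N => E N (cylind w)) =
  (fun N => E N (cylind (false :: w)) + E N (cylind (true :: w)))).
  by apply: cvgD; exact: cylprob_cvg.
apply: funext => N; have [ED _ _ _] := Emean N.
rewrite -ED; congr E; apply: funext => y.
by rewrite /cylind /= !eqseq_cons; case: (seqbit y _) => /=; rewrite ?add0r ?addr0.
Qed.

(** Left endpoint of the subinterval of [[0, 1[], of length [cylprob w], that is assigned to [w].
    The piece of [false :: w] lies on its left and the piece of [true :: w] on its right. *)
Fixpoint lft (w : seq bool) : R :=
  if w is b :: v then lft v + (if b then cylprob (false :: v) else 0) else 0.

Fixpoint upref (u : R) (n : nat) : seq bool :=
  if n is m.+1 then (lft (upref u m) + cylprob (false :: upref u m) <= u) :: upref u m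
  else [::].

Definition ubit (u : R) (j : nat) : bool :=
  lft (upref u j) + cylprob (false :: upref u j) <= u.

Lemma uprefE u n : upref u n = pref (ubit u) n.
Proof. by elim: n => //= n ih; rewrite -ih. Qed.

Lemma lft_bounds w : 0 <= lft w /\ lft w + cylprob w <= 1.
Proof.
elim: w => [|b w [h1 h2]]; first by rewrite /= cylprob_nil add0r.
have hp := cylprob_cons w; have p0 := cylprob_ge0 (false :: w).
have p1 := cylprob_ge0 (true :: w).
by case: b => /=; split; lra.
Qed.

(** The intervals of the words of length [n] tile [[0, 1[], and reading [u] bit by bit descends to
    the one that contains it. *)
Lemma upref_lft u n w : 0 <= u < 1 -> size w = n ->
  (upref u n == w) = (lft w <= u < lft w + cylprob w).
Proof.
move=> u01; elim: n w => [|n ih] [|b w]//= => [_|[/ih e]].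
  by rewrite eqxx cylprob_nil add0r u01.
have hp := cylprob_cons w; have p0 := cylprob_ge0 (false :: w).
have p1 := cylprob_ge0 (true :: w).
rewrite eqseq_cons andbC; case: (eqVneq (upref u n) w) e => [-> /esym/andP[h1 h2]|_ /esym/negbT] /=.
  case: b => /=.
    by rewrite eqb_id (_ : u < _ + _ + _) ?andbT//; lra.
  by rewrite addr0 h1 eqbF_neg -ltNge.
rewrite negb_and -ltNge -leNgt => /orP h; apply/esym/negbTE.
rewrite negb_and -!ltNge -!leNgt; apply/orP.
by case: b; case: h => h; (left; lra) || (right; lra).
Qed.

Let P0 : probability (measurableTypeR R) R := uniform_prob (@ltr01 R).

Lemma measurable_upref n w : measurable [set u : R | upref u n = w].
Proof.
elim: n w => [|n ih] [|b w].
- by rewrite (_ : [set _ | _] = setT)//; exact/seteqP.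
- by rewrite (_ : [set _ | _] = set0)//; apply/seteqP; split.
- by rewrite (_ : [set _ | _] = set0)//; apply/seteqP; split.
- rewrite (_ : [set _ | _] = [set u | upref u n = w] `&`
     (if b then `[lft w + cylprob (false :: w), +oo[%classic
      else `]-oo, lft w + cylprob (false :: w)[%classic)); last first.
    apply/seteqP; split => u /=.
      case=> <- <-; split=> //; case: leP => h /=; by rewrite in_itv/= ?andbT.
    case=> ->; case: b; rewrite /= in_itv/= ?andbT => h; first by rewrite h.
    by rewrite leNgt h.
  by apply: measurableI => //; case: b; exact: measurable_itv.
Qed.

Lemma P0_itv (a b : R) : 0 <= a -> a <= b -> b <= 1 -> P0 `[a, b[%classic = (b - a)%:E.
Proof.
move=> a0 ab b1; change (uniform_prob (@ltr01 R) `[a, b[%classic = (b - a)%:E).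
rewrite /uniform_prob integral_uniform_pdf.
rewrite (_ : `[a, b[ `&` `[0, 1] = `[a, b[%classic); last first.
  apply/seteqP; split => x /=; first by case.
  by rewrite !in_itv/= => /andP[h1 h2]; rewrite h1 h2; split => //; apply/andP; split; lra.
transitivity (\int[lebesgue_measure]_(x in `[a, b[) (cst 1%:E x : \bar R))%E.
  apply: eq_integral => x; rewrite inE/= in_itv/= => /andP[h1 h2].
  rewrite /uniform_pdf (_ : 0 <= x <= 1); last by apply/andP; split; lra.
  by rewrite subr0 invr1.
rewrite integral_cst//= mul1e.
by rewrite lebesgue_measure_itv/= lte_fin; case: ltP => // ba; have -> : b = a by [lra]; rewrite subrr.
Qed.

Lemma P0_upref n w : size w = n -> fine (P0 [set u | upref u n = w]) = cylprob w.
Proof.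
move=> sw; have [l0 l1] := lft_bounds w; have p0 := cylprob_ge0 w.
have P01 : P0 `[0, 1[%classic = 1%E by rewrite P0_itv// subr0.
have <- : Ex P0 \1_(`[lft w, (lft w + cylprob w)[%classic) = cylprob w.
  rewrite Ex_indic//; transitivity (fine (cylprob w)%:E) => //; apply: (congr1 fine).
  by apply: etrans (P0_itv _ _ _) _; rewrite ?lerDl// addrC addKr.
rewrite -Ex_indic; last exact: measurable_upref.
(* The cells are described by half-open intervals for [0 <= u < 1] only, a set of probability
   one. *)
apply: (@Ex_as _ _ _ P0 _ _ `[0, 1[%classic) => //.
- by apply: bmf_indic; exact: measurable_upref.
- by apply: bmf_indic; exact: measurable_itv.
- move=> u /=; rewrite in_itv/= => u01; rewrite !indicE.
  by congr (_%:R); congr nat_of_bool; apply/idP/idP; rewrite !inE/= in_itv/=;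
    rewrite -(upref_lft u01 sw) => /eqP.
Qed.

Definition xi (i : nat) (u : R) : R := bitlim R (ubit u) i.

Lemma bmf_upref n (F : seq bool -> R) :
  bmf (fun u : measurableTypeR R => \sum_(w <- words n) (upref u n == w)%:R * F w).
Proof.
apply: bmf_sum => w; apply: bmfM; last exact: bmf_cst.
rewrite (_ : (fun _ => _) = \1_[set u | upref u n = w]); last first.
  by apply: funext => u; rewrite indicE; congr (_%:R); congr nat_of_bool;
    apply/eqP/idP; rewrite inE.
by apply: bmf_indic; exact: measurable_upref.
Qed.

Lemma xi01 u : cube (xi ^~ u).
Proof. by move=> i; exact: bitlim01. Qed.

(** Up to [e], a uniformly continuous function depends on the first [n] bits only, both at the
    constructed random point and at every point of the cube. This links the means of cylinders to
    the law of [xi]. *)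
Lemma UC_close f (e : R) : UC f -> 0 < e -> exists n0 : nat, forall n, (n0 <= n)%N ->
  (forall u, `|f (xi ^~ u) - f (wordval R (upref u n))| <= e) /\
  (forall y, cube y -> `|f y - f (wordval R (pref (seqbit y) n))| <= e).
Proof.
move=> /[apply] -[K hK]; exists (depth K) => n hn; split => [u|y cy].
  rewrite uprefE -bitval_pref; apply: hK; [exact: xi01|exact: bitval01|].
  by move=> i iK; exact: bitlim_diff.
rewrite -bitval_pref; apply: hK => //; first exact: bitval01.
by move=> i iK; exact: seqbit_diff.
Qed.

Lemma UC_bmf f : UC f -> bmf (fun u : measurableTypeR R => f (xi ^~ u)).
Proof.
move=> ucf.
pose h n (u : measurableTypeR R) := \sum_(w <- words n) (upref u n == w)%:R * f (wordval R w).
have hE n u : h n u = f (wordval R (upref u n)).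
  by rewrite /h uprefE (sum_words (ubit u) n (fun w => f (wordval R w))).
have hc u : h n u @[n --> \oo] --> f (xi ^~ u).
  apply/cvgrPdist_le => e e0; have [n0 hn0] := UC_close ucf e0.
  exists n0 => // n /= nn0; rewrite hE; exact: (hn0 n nn0).1.
split.
  by apply: (measurable_fun_cvg (h := h)) => [n|x _]; [exact: (bmf_upref n (fun w => f (wordval R w))).1|exact: hc].
have [n0 hn0] := UC_close ucf (@ltr01 R).
have [_ [M hM]] := bmf_upref n0 (fun w => f (wordval R w)).
exists (1 + M) => u; have := (hn0 n0 (leqnn _)).1 u; have := hM u.
rewrite -[\sum_(_ <- _) _]/(h n0 u) hE => h1 h2.
rewrite -[f _](subrK (f (wordval R (upref u n0)))).
by apply: (le_trans (ler_normD _ _)); exact: lerD.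
Qed.

(** On both sides [f] is replaced by a function of the [n]-bit prefix. Its mean is a finite
    combination of the means of cylinders, hence converges along [U]. *)
Lemma mean_limit f (c : R) : UC f -> (exists N0, forall N, (N0 <= N)%N -> E N f <= c) ->
  Ex P0 (fun u => f (xi ^~ u)) <= c.
Proof.
move=> ucf [N0 hN0]; apply/ler_addgt0Pr => e e0.
have e2 : 0 < e / 2 by rewrite divr_gt0.
have [n /(_ _ (leqnn _))[h1 h2]] := UC_close ucf e2.
pose F w := f (wordval R w).
have step1 : Ex P0 (fun u => f (xi ^~ u)) <= \sum_(w <- words n) cylprob w * F w + e / 2.
  have -> : \sum_(w <- words n) cylprob w * F w + e / 2 =
      Ex P0 (fun u => \sum_(w <- words n) (upref u n == w)%:R * F w + e / 2).
    rewrite ExD; [|exact: bmf_upref|exact: bmf_cst].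
    rewrite Ex_cst; congr (_ + _).
    have hb w : bmf (fun u : measurableTypeR R => (upref u n == w)%:R : R).
      rewrite (_ : (fun _ => _) = \1_[set u | upref u n = w]); last first.
        by apply: funext => u; rewrite indicE; congr (_%:R); congr nat_of_bool;
          apply/eqP/idP; rewrite inE.
      by apply: bmf_indic; exact: measurable_upref.
    rewrite Ex_sum; last by move=> w; apply: bmfM => //; exact: bmf_cst.
    apply: eq_big_seq => w /size_words sw.
    rewrite -(P0_upref sw) -Ex_indic; last exact: measurable_upref.
    rewrite mulrC -ExZ; last by apply: bmf_indic; exact: measurable_upref.
    apply: eq_Ex => u; rewrite mulrC; congr (_ * _).
    by rewrite indicE; congr (_%:R); congr nat_of_bool; apply/idP/eqP; rewrite inE.
  apply: le_Ex; [exact: UC_bmf|by apply: bmfD; [exact: bmf_upref|exact: bmf_cst]|].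
  move=> u; rewrite uprefE sum_words -uprefE.
  by have := h1 u; rewrite ler_norml => /andP[_]; rewrite lerBlDl.
apply: (le_trans step1); rewrite [e in leRHS]splitr addrA lerD2r.
have : \sum_(w <- words n) E N (cylind w) * F w @[N --> U] --> \sum_(w <- words n) cylprob w * F w.
  by apply: cvg_big => // [|w _]; [exact: add_continuous|apply: cvgM; [exact: cylprob_cvg|exact: cvg_cst]].
(* [U] refines the filter of eventual events, so the bound is only required for large [N]. *)
move/cvgr_to_le; apply; apply: Uoo; exists N0 => // N /= NN0.
have [ED EZ EM E1] := Emean N.
have -> : \sum_(w <- words n) E N (cylind w) * F w =
   E N (fun y => \sum_(w <- words n) F w * cylind w y).
  by rewrite mean_sum; apply: eq_bigr => w _; rewrite EZ mulrC.
apply: (@le_trans _ _ (E N (fun y => f y + e / 2 * 1))).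
  apply: EM => y cy.
  rewrite (_ : \sum_(w <- words n) _ = F (pref (seqbit y) n)); last first.
    rewrite -(sum_words (seqbit y) n F); apply: eq_big_seq => w /size_words sw.
    by rewrite mulrC /cylind sw.
  by have := h2 y cy; rewrite ler_norml mulr1 => /andP[+ _]; rewrite lerNl opprB lerBlDl.
by rewrite ED (EZ _ (fun=> 1)) E1 mulr1 lerD2r hN0.
Qed.

End mean_limits.

(** The ultrafilter disappears from the statement: all that is kept is that inequalities valid for
    all large [N] survive. *)
Lemma mean_limit_exists (R : realType) (E : nat -> ((nat -> R) -> R) -> R) :
  (forall N, is_mean (E N)) ->
  exists (d : measure_display) (S : measurableType d) (P : probability S R)
    (X : nat -> S -> R),
  [/\ forall u, cube (X ^~ u),
      forall f, UC f -> bmf (fun u => f (X ^~ u)) &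
      forall f (c : R), UC f -> (exists N0, forall N, (N0 <= N)%N -> E N f <= c) ->
        Ex P (fun u => f (X ^~ u)) <= c].
Proof.
move=> hE; have [U [UU Uoo]] := @ultraFilterLemma nat \oo _.
exists _, (measurableTypeR R), (uniform_prob (@ltr01 R)), (xi E U); split.
- by move=> u i; exact: xi01.
- by move=> f; exact: UC_bmf.
- by move=> f c; exact: mean_limit.
Qed.

(** * Approximating Markov chains *)

Section chain.
Variables (R : realType) (d : nat) (al : nat -> R) (ainf A delta : R).
Local Notation D := d.+1.
Hypothesis al0 : forall i, 0 <= al i.
Hypothesis alA : \sum_(i < D) al i <= A.
Hypothesis ainf0 : 0 <= ainf.
Hypothesis delta0 : 0 <= delta.

(** The jump variance [delta^2 free x_i] is [2 eta free x_i], the variance of the diffusion over a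
    time [eta]. A step moves a single coordinate, drawn uniformly among [D], so it counts for the
    time [eta / D] ([tstep]). *)
Definition eta : R := delta ^+ 2 / 2.
Definition driftB : R := A + ainf.
Hypothesis small : delta + eta * driftB <= 1.

Implicit Types (x : nat -> R) (f g : (nat -> R) -> R).

Definition ysum m x : R := \sum_(m <= i < D) x i.

Definition is_state x : Prop := (forall i, 0 <= x i) /\ ysum 0 x <= 1.

Definition free x : R := 1 - ysum 0 x.

Definition drift i x : R := al i * free x - ainf * x i.

(* With this probability of moving up, the two-point jump of size [delta * free x]
   or [- delta * x i] is centred with variance [delta^2 * free x * x i], and it keeps
   the chain in the simplex.  Both moves are null when [free x + x i = 0]. *)
Definition pup i x : R := x i / (free x + x i).

Definition move x i (r : R) : nat -> R := fun j => x j + (j == i)%:R * r.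

Definition dup i x : R := eta * drift i x + delta * free x.
Definition ddn i x : R := eta * drift i x - delta * x i.

Definition stepQ f x : R := D%:R^-1 *
  \sum_(i < D) (pup i x * f (move x i (dup i x)) + (1 - pup i x) * f (move x i (ddn i x))).

(** The second moment of the jump of coordinate [i], not its variance: the squared mean is
    included. *)
Definition jvar i x : R := delta ^+ 2 * (free x * x i) + (eta * drift i x) ^+ 2.

Lemma ysumE m x : ysum m x = \sum_(m <= i < D) x i. Proof. by []. Qed.

Lemma etaE : eta = delta ^+ 2 / 2. Proof. by []. Qed.

Lemma stepQE f x : stepQ f x = D%:R^-1 *
  \sum_(i < D) (pup i x * f (move x i (dup i x)) + (1 - pup i x) * f (move x i (ddn i x))).
Proof. by []. Qed.

Lemma eta_ge0 : 0 <= eta. Proof. by rewrite divr_ge0// exprn_ge0. Qed.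

Lemma A_ge0 : 0 <= A.
Proof. by apply: le_trans alA; apply: sumr_ge0. Qed.

Lemma driftB_ge0 : 0 <= driftB.
Proof. by rewrite addr_ge0// A_ge0. Qed.

Lemma etaB_le1 : eta * driftB <= 1.
Proof. by apply: le_trans small; rewrite lerDr. Qed.

Lemma ysum_ge0 m x : (forall i, 0 <= x i) -> 0 <= ysum m x.
Proof. by move=> x0; apply: sumr_ge0. Qed.

Lemma ysum_nonincr m n x : (forall i, 0 <= x i) -> (m <= n)%N -> ysum n x <= ysum m x.
Proof.
move=> x0 mn; rewrite /ysum; have [nD|Dn] := leqP n D.
  by rewrite (big_cat_nat mn nD)/= lerDr; apply: sumr_ge0.
by rewrite big_geq ?(ltnW Dn)//; apply: sumr_ge0.
Qed.

Lemma ysum_le1 m x : is_state x -> ysum m x <= 1.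
Proof. by move=> [x0 x1]; apply: le_trans x1; exact: ysum_nonincr. Qed.

Lemma coord_le x i : (forall i, 0 <= x i) -> (i < D)%N -> x i <= ysum 0 x.
Proof.
move=> x0 iD; rewrite /ysum (big_cat_nat (n := i))//= ?(ltnW iD)//.
rewrite (big_ltn iD) addrCA lerDl addr_ge0//; exact: sumr_ge0.
Qed.

Lemma free01 x : is_state x -> 0 <= free x <= 1.
Proof.
move=> [x0 x1]; rewrite /free; have := ysum_ge0 0 x0.
by move=> h; apply/andP; split; lra.
Qed.

Lemma al_le i : (i < D)%N -> al i <= A.
Proof.
move=> iD; apply: le_trans alA; rewrite (bigD1 (Ordinal iD))//= lerDl.
exact: sumr_ge0.
Qed.

Lemma coord_le1 x i : is_state x -> (i < D)%N -> x i <= 1.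
Proof. by move=> [x0 x1] iD; apply: le_trans x1; exact: coord_le. Qed.

Lemma drift_abs x i : is_state x -> `|drift i x| <= al i * free x + ainf * x i.
Proof.
move=> sx; have /andP[f0 f1] := free01 sx.
rewrite (le_trans (ler_normB _ _))// !normrM !ger0_norm//.
by case: sx.
Qed.

Lemma drift_le x i : is_state x -> (i < D)%N -> `|drift i x| <= driftB.
Proof.
move=> sx iD; apply: le_trans (drift_abs i sx) _; have /andP[f0 f1] := free01 sx.
rewrite /driftB lerD//.
  by rewrite -[leRHS]mulr1 ler_pM// al_le.
by rewrite -[leRHS]mulr1 ler_pM// ?coord_le1//; case: sx.
Qed.

Lemma pup01 x i : is_state x -> 0 <= pup i x <= 1.
Proof.
move=> sx; have /andP[f0 f1] := free01 sx; have x0 : 0 <= x i by case: sx.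
rewrite /pup; have [e|ne] := eqVneq (free x + x i) 0.
  by rewrite e invr0 mulr0 lexx ler01.
have p : 0 < free x + x i by rewrite lt_neqAle eq_sym ne addr_ge0.
by rewrite divr_ge0 ?(ltW p)//= ler_pdivrMr// mul1r lerDr.
Qed.

Lemma pup_mean x i : is_state x -> pup i x * dup i x + (1 - pup i x) * ddn i x = eta * drift i x.
Proof.
move=> sx; have /andP[f0 f1] := free01 sx; have x0 : 0 <= x i by case: sx.
(* Both sides equal [free x * x i / (free x + x i)]: the diffusive part of the jump is centred. *)
suff e : pup i x * free x = (1 - pup i x) * x i.
  transitivity (eta * drift i x + delta * (pup i x * free x - (1 - pup i x) * x i)).
    by rewrite /dup /ddn; ring.
  by rewrite e subrr mulr0 addr0.
rewrite /pup; have [e|ne] := eqVneq (free x + x i) 0.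
  by have [-> ->] : free x = 0 /\ x i = 0 by [split; lra]; rewrite !mulr0.
by field.
Qed.

Lemma pup_var x i : is_state x ->
  pup i x * dup i x ^+ 2 + (1 - pup i x) * ddn i x ^+ 2 = jvar i x.
Proof.
move=> sx; have /andP[f0 f1] := free01 sx; have x0 : 0 <= x i by case: sx.
rewrite /pup /jvar /dup /ddn; have [e|ne] := eqVneq (free x + x i) 0.
  have [-> ->] : free x = 0 /\ x i = 0 by [split; lra].
  by rewrite !addr0 invr0; ring.
by field.
Qed.

Lemma jump_small x i : is_state x -> (i < D)%N ->
  `|dup i x| <= delta + eta * driftB /\ `|ddn i x| <= delta + eta * driftB.
Proof.
move=> sx iD; have /andP[f0 f1] := free01 sx; have x0 : 0 <= x i by case: sx.
have h : `|eta * drift i x| <= eta * driftB.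
  by rewrite normrM (ger0_norm eta_ge0) ler_wpM2l ?eta_ge0// drift_le.
split.
  apply: le_trans (ler_normD _ _) _; rewrite addrC lerD//.
  by rewrite normrM !ger0_norm// ler_piMr.
apply: le_trans (ler_normB _ _) _; rewrite addrC lerD//.
by rewrite normrM !ger0_norm// ler_piMr// coord_le1.
Qed.

Lemma ysum_move m x i (r : R) : (i < D)%N ->
  ysum m (move x i r) = ysum m x + (m <= i)%:R * r.
Proof.
move=> iD; rewrite /ysum big_split/= -mulr_suml; congr (_ + _ * _).
transitivity (\sum_(m <= j < D | j == i) (1 : R)).
  by rewrite [RHS]big_mkcond; apply: eq_bigr => j _; case: (j == i).
by rewrite big_nat1_eq iD andbT; case: leqP.
Qed.

Lemma etaA_le1 : delta + eta * A <= 1 /\ delta + eta * ainf <= 1.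
Proof.
have := small; rewrite /driftB mulrDr.
have := mulr_ge0 eta_ge0 A_ge0; have := mulr_ge0 eta_ge0 ainf0.
by move=> *; split; lra.
Qed.

(** Every term that lowers [x i] is a fraction of [x i], and every term that raises it is at most a
    fraction of [free x]; by [small] the fractions on each side add up to at most 1. *)
Lemma state_move x i : is_state x -> (i < D)%N ->
  is_state (move x i (dup i x)) /\ is_state (move x i (ddn i x)).
Proof.
move=> sx iD; have [x0 x1] := sx; have /andP[f0 f1] := free01 sx.
have [sA sB] := etaA_le1; have e0 := eta_ge0.
have alf : eta * (al i * free x) <= eta * A * free x.
  by rewrite mulrA ler_wpM2r// ler_wpM2l// al_le.
have alf0 : 0 <= eta * (al i * free x) by rewrite !mulr_ge0.
have xf : eta * (ainf * x i) + delta * x i <= x i.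
  by rewrite mulrA -mulrDl addrC ler_piMl.
have xf0 : 0 <= eta * (ainf * x i) by rewrite !mulr_ge0.
have d0 : 0 <= delta * x i by rewrite mulr_ge0.
have df0 : 0 <= delta * free x by rewrite mulr_ge0.
have ff : (delta + eta * A) * free x <= free x by rewrite ler_piMl.
have fE : ysum 0 x = 1 - free x by rewrite /free opprB addrCA subrr addr0.
split; split.
- move=> j; rewrite /move; case: eqP => [->|_]; last by rewrite mul0r addr0.
  by rewrite mul1r /dup /drift mulrBr; lra.
- by rewrite ysum_move// leq0n mul1r /dup /drift mulrBr fE; rewrite mulrDl in ff; lra.
- move=> j; rewrite /move; case: eqP => [->|_]; last by rewrite mul0r addr0.
  by rewrite mul1r /ddn /drift mulrBr; lra.
- by rewrite ysum_move// leq0n mul1r /ddn /drift mulrBr fE; rewrite mulrDl in ff; lra.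
Qed.

Lemma stepQ_le f g x : is_state x -> (forall y, is_state y -> f y <= g y) ->
  stepQ f x <= stepQ g x.
Proof.
move=> sx fg; rewrite /stepQ ler_wpM2l ?invr_ge0//; apply: ler_sum => i _.
have /andP[p0 p1] := pup01 i sx; have [s1 s2] := state_move sx (ltn_ord i).
by rewrite lerD// ler_wpM2l ?subr_ge0//; exact: fg.
Qed.

Lemma stepQ_cst (c : R) x : stepQ (fun=> c) x = c.
Proof.
rewrite /stepQ; under eq_bigr do rewrite -mulrDl addrCA subrr addr0 mul1r.
by rewrite sumr_const card_ord -[c *+ _]mulr_natl mulrA mulVf ?mul1r.
Qed.

Lemma stepQD f g x : stepQ (fun y => f y + g y) x = stepQ f x + stepQ g x.
Proof.
rewrite /stepQ -mulrDr -big_split/=; congr (_ * _); apply: eq_bigr => i _; ring.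
Qed.

Lemma stepQZ (c : R) f x : stepQ (fun y => c * f y) x = c * stepQ f x.
Proof.
rewrite /stepQ mulrCA; congr (_ * _); rewrite mulr_sumr; apply: eq_bigr => i _; ring.
Qed.

Definition iterQ k f : (nat -> R) -> R := iter k stepQ f.

Lemma iterQSr k f : iterQ k.+1 f = iterQ k (stepQ f).
Proof. by rewrite /iterQ iterSr. Qed.

Lemma iterQ_le k f g x : is_state x -> (forall y, is_state y -> f y <= g y) ->
  iterQ k f x <= iterQ k g x.
Proof.
move=> sx fg; elim: k x sx => [|k ih] x sx; first exact: fg.
by rewrite /iterQ /=; apply: stepQ_le.
Qed.

Lemma iterQ_cst k (c : R) : iterQ k (fun=> c) = (fun=> c).
Proof. by elim: k => //= k ih; rewrite /iterQ /= -/(iterQ _ _) ih; apply: funext => x; rewrite stepQ_cst. Qed.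

Lemma iterQD k f g : iterQ k (fun y => f y + g y) = (fun y => iterQ k f y + iterQ k g y).
Proof.
elim: k => //= k ih; apply: funext => x; rewrite /iterQ /= -!/(iterQ _ _) ih.
exact: stepQD.
Qed.

Lemma iterQZ k c f : iterQ k (fun y => c * f y) = (fun y => c * iterQ k f y).
Proof.
elim: k => //= k ih; apply: funext => x; rewrite /iterQ /= -!/(iterQ _ _) ih.
exact: stepQZ.
Qed.

Lemma iterQ_sum k (I : Type) (r : seq I) (F : I -> (nat -> R) -> R) x :
  iterQ k (fun y => \sum_(i <- r) F i y) x = \sum_(i <- r) iterQ k (F i) x.
Proof.
elim: r => [|i r ih].
  by rewrite big_nil; under eq_fun do rewrite big_nil; rewrite iterQ_cst.
by rewrite big_cons -ih; under eq_fun do rewrite big_cons; rewrite iterQD.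
Qed.

Definition tstep : R := eta / D%:R.

Lemma tstep_ge0 : 0 <= tstep. Proof. by rewrite divr_ge0 ?eta_ge0. Qed.

Lemma tstepE (c : R) : tstep * c = D%:R^-1 * (eta * c).
Proof. by rewrite /tstep mulrAC mulrC. Qed.

Lemma mulrACA3 (a b c : R) : a * b * c = b * (a * c).
Proof. by ring. Qed.

(** Discrete Dynkin formula, as an inequality: one-step increments accumulate along the chain. *)
Lemma iterQ_drift k f g x : is_state x ->
  (forall y, is_state y -> stepQ f y <= f y + tstep * g y) ->
  iterQ k f x <= f x + tstep * \sum_(j < k) iterQ j g x.
Proof.
move=> sx h; elim: k => [|k ih].
  by rewrite big_ord0 mulr0 addr0.
rewrite iterQSr big_ord_recr/= mulrDr addrA.
apply: le_trans (_ : iterQ k (fun y => f y + tstep * g y) x <= _).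
  exact: iterQ_le.
by rewrite iterQD iterQZ lerD2r.
Qed.

(** Moves of coordinates below [m] leave the tail mass unchanged, so only the block from [m] on
    contributes. *)
Lemma stepQ_ysum (phi : R -> R) m x : is_state x ->
  stepQ (fun y => phi (ysum m y)) x = phi (ysum m x) + D%:R^-1 *
  \sum_(m <= i < D) (pup i x * (phi (ysum m x + dup i x) - phi (ysum m x)) +
     (1 - pup i x) * (phi (ysum m x + ddn i x) - phi (ysum m x))).
Proof.
move=> sx; rewrite -{1}(stepQ_cst (phi (ysum m x)) x).
apply: (addrI (- stepQ (fun=> phi (ysum m x)) x)); rewrite !addrA addNr add0r.
rewrite addrC -mulN1r -stepQZ -stepQD /stepQ; congr (_ * _).
rewrite -(big_mkord xpredT (fun i => pup i x * (phi (ysum m (move x i (dup i x))) + -1 * phi (ysum m x)) +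
   (1 - pup i x) * (phi (ysum m (move x i (ddn i x))) + -1 * phi (ysum m x)))).
rewrite [RHS](big_nat_widenl _ 0)//= [RHS]big_mkcond/=; apply: eq_big_nat => i /andP[_ iD].
rewrite !ysum_move// !mulN1r; case: leqP => mi /=; first by rewrite !mul1r.
by rewrite !mul0r !addr0 subrr !mulr0 addr0.
Qed.

(** Bounding by tail masses, and not merely by [driftB], is what makes the moment constants vanish
    as [m] grows. *)
Lemma block_drift_abs m x : is_state x ->
  \sum_(m <= i < D) `|drift i x| <= ysum m al + ainf * ysum m x.
Proof.
move=> sx; have /andP[f0 f1] := free01 sx.
rewrite /ysum mulr_sumr -big_split/=; apply: ler_sum => i _.
apply: le_trans (drift_abs i sx) _; rewrite lerD2r ler_piMr//.
Qed.

Lemma ysum_alA m : ysum m al <= A.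
Proof.
apply: le_trans (ysum_nonincr al0 (leq0n m)) _.
by rewrite /ysum big_mkord.
Qed.

Lemma block_drift_B m x : is_state x -> \sum_(m <= i < D) `|drift i x| <= driftB.
Proof.
move=> sx; apply: le_trans (block_drift_abs m sx) _; rewrite /driftB lerD ?ysum_alA//.
by rewrite ler_piMr// ysum_le1.
Qed.

Lemma block_drift_sqr m x : is_state x ->
  \sum_(m <= i < D) drift i x ^+ 2 <= driftB * \sum_(m <= i < D) `|drift i x|.
Proof.
move=> sx; rewrite mulr_sumr [leLHS]big_nat_cond [leRHS]big_nat_cond.
apply: ler_sum => i /andP[/andP[_ iD] _].
by rewrite -real_normK ?num_real// expr2 ler_wpM2r// drift_le.
Qed.

Lemma block_jvar m x : is_state x ->
  \sum_(m <= i < D) jvar i x <= eta * (2 * ysum m x + (ysum m al + ainf * ysum m x)).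
Proof.
move=> sx; have /andP[f0 f1] := free01 sx; have x0 : 0 <= ysum m x by apply: ysum_ge0; case: sx.
rewrite /jvar big_split/= mulrDr lerD//.
  rewrite -!mulr_sumr -/(ysum m x).
  have -> : delta ^+ 2 = eta * 2 by rewrite /eta divfK.
  by rewrite -mulrA ler_wpM2l ?eta_ge0// ler_wpM2l// ler_piMl.
under eq_bigr do rewrite exprMn; rewrite -mulr_sumr expr2 -mulrA ler_wpM2l ?eta_ge0//.
have h := block_drift_sqr m sx; have h' := block_drift_abs m sx.
have s0 : 0 <= \sum_(m <= i < D) `|drift i x| by apply: sumr_ge0.
apply: le_trans (ler_wpM2l eta_ge0 h) _; rewrite mulrA.
by apply: le_trans (ler_piMl _ etaB_le1) _.
Qed.

Lemma stepQ_mean m x : is_state x -> stepQ (ysum m) x <= ysum m x + tstep * ysum m al.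
Proof.
move=> sx; have /andP[f0 f1] := free01 sx.
rewrite (stepQ_ysum id)// lerD2l tstepE ler_wpM2l ?invr_ge0//.
have -> : \sum_(m <= i < D) (pup i x * (ysum m x + dup i x - ysum m x) +
   (1 - pup i x) * (ysum m x + ddn i x - ysum m x)) = eta * \sum_(m <= i < D) drift i x.
  rewrite mulr_sumr; apply: eq_bigr => i _.
  by rewrite -pup_mean// ![_ + _ - ysum m x]addrAC !subrr !add0r.
rewrite ler_wpM2l ?eta_ge0//; apply: ler_sum => i _.
rewrite /drift lerBlDr; have x0 : 0 <= x i by case: sx.
by apply: (@le_trans _ _ (al i)); [rewrite ler_piMr|rewrite lerDl mulr_ge0].
Qed.

(** Twice the bound on the block drift plus the bound on the block second moments give
    [3 ysum m al + (2 + 3 ainf) ysum m x], rounded up to a common factor. *)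
Definition Csqr : R := 3 * ainf + 3.

Lemma stepQ_sqr m (c : R) x : 0 <= c <= 1 -> is_state x ->
  stepQ (fun y => (ysum m y - c) ^+ 2) x <=
  (ysum m x - c) ^+ 2 + tstep * (Csqr * (ysum m x + ysum m al)).
Proof.
move=> /andP[c0 c1] sx; have y1 := ysum_le1 m sx.
have y0 : 0 <= ysum m x by apply: ysum_ge0; case: sx.
have a0 : 0 <= ysum m al by apply: ysum_ge0.
rewrite (stepQ_ysum (fun r => (r - c) ^+ 2))// lerD2l tstepE.
rewrite ler_wpM2l ?invr_ge0//; set u := ysum m x - c.
have -> : \sum_(m <= i < D) (pup i x * ((ysum m x + dup i x - c) ^+ 2 - u ^+ 2) +
   (1 - pup i x) * ((ysum m x + ddn i x - c) ^+ 2 - u ^+ 2)) =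
   2 * u * eta * \sum_(m <= i < D) drift i x + \sum_(m <= i < D) jvar i x.
  rewrite mulr_sumr -big_split/=; apply: eq_bigr => i _.
  rewrite -pup_var// -(mulrA (2 * u)) -pup_mean// /u; ring.
have hd : 2 * u * eta * \sum_(m <= i < D) drift i x <= eta * (2 * (ysum m al + ainf * ysum m x)).
  rewrite [2 * u * eta]mulrC -mulrA ler_wpM2l ?eta_ge0//.
  apply: le_trans (ler_norm _) _; rewrite -mulrA normrM (ger0_norm (ler0n _ 2)) ler_wpM2l//.
  have u1 : `|u| <= 1 by rewrite /u ler_norml; apply/andP; split; lra.
  rewrite normrM; apply: le_trans (_ : 1 * `|\sum_(m <= i < D) drift i x| <= _).
    by rewrite ler_wpM2r.
  by rewrite mul1r; apply: le_trans (ler_norm_sum _ _ _) (block_drift_abs m sx).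
apply: le_trans (lerD hd (block_jvar m sx)) _; rewrite -mulrDr ler_wpM2l ?eta_ge0//.
have := mulr_ge0 ainf0 a0; have := mulr_ge0 ainf0 y0.
by rewrite /Csqr => ? ?; lra.
Qed.

Definition kappa : R := delta + eta * driftB.
(** With [B] for [driftB]: the drift contributes [4 u^2 B], the second moments of the jumps
    contribute [(8 u^2 + 3 kappa^2) (2 + B)]. *)
Definition Cpow4 : R := 16 + 12 * driftB.

(** In the binomial expansion the cubic term satisfies [4 u r^3 <= 2 u^2 r^2 + 2 r^4], and then
    [r^4 <= K^2 r^2]: only the first two moments of [r] remain. *)
Lemma pow4_increment (u r K : R) : `|r| <= K ->
  (u + r) ^+ 4 - u ^+ 4 <= 4 * u ^+ 3 * r + (8 * u ^+ 2 + 3 * K ^+ 2) * r ^+ 2.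
Proof.
move=> rK; have r2 : r ^+ 2 <= K ^+ 2.
  by rewrite -(real_normK (num_real r)) lerXn2r// nnegrE// (le_trans _ rK).
have h : 0 <= (u - r) ^+ 2 * r ^+ 2 by rewrite mulr_ge0// ?sqr_ge0.
have h2 : 0 <= (K ^+ 2 - r ^+ 2) * r ^+ 2 by rewrite mulr_ge0 ?sqr_ge0 ?subr_ge0.
nra.
Qed.

Lemma stepQ_pow4 m (c : R) x : 0 <= c <= 1 -> is_state x ->
  stepQ (fun y => (ysum m y - c) ^+ 4) x <=
  (ysum m x - c) ^+ 4 + tstep * (Cpow4 * ((ysum m x - c) ^+ 2 + kappa ^+ 2)).
Proof.
move=> /andP[c0 c1] sx; have y1 := ysum_le1 m sx.
have y0 : 0 <= ysum m x by apply: ysum_ge0; case: sx.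
rewrite (stepQ_ysum (fun r => (r - c) ^+ 4))// lerD2l tstepE.
rewrite ler_wpM2l ?invr_ge0//; set u := ysum m x - c.
have u1 : `|u| <= 1 by rewrite /u ler_norml; apply/andP; split; lra.
pose W := 8 * u ^+ 2 + 3 * kappa ^+ 2.
have W0 : 0 <= W by rewrite addr_ge0// mulr_ge0// sqr_ge0.
apply: (@le_trans _ _ (4 * u ^+ 3 * eta * \sum_(m <= i < D) drift i x +
    W * \sum_(m <= i < D) jvar i x)).
  rewrite !mulr_sumr -big_split/= [leLHS]big_nat_cond [leRHS]big_nat_cond.
  apply: ler_sum => i /andP[/andP[_ iD] _].
  have [k1 k2] := jump_small sx iD; have /andP[p0 p1] := pup01 i sx.
  have p1' : 0 <= 1 - pup i x by rewrite subr_ge0.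
  rewrite -pup_var// -(mulrA (4 * u ^+ 3)) -pup_mean//.
  have e1 := ler_wpM2l p0 (pow4_increment u k1).
  have e2 := ler_wpM2l p1' (pow4_increment u k2).
  have := lerD e1 e2; rewrite -/kappa -/W /u ![_ + _ - c]addrAC => /le_trans; apply.
  by rewrite le_eqVlt; apply/orP; left; apply/eqP; ring.
have u2 : 0 <= u ^+ 2 by exact: sqr_ge0.
have k2 : 0 <= kappa ^+ 2 by exact: sqr_ge0.
have B0 := driftB_ge0.
have hd : 4 * u ^+ 3 * eta * \sum_(m <= i < D) drift i x <= eta * (4 * u ^+ 2 * driftB).
  rewrite mulrAC mulrC ler_wpM2l ?eta_ge0//.
  apply: le_trans (ler_norm _) _; rewrite normrM ler_pM//.
    rewrite normrM (ger0_norm (ler0n _ 4)) ler_wpM2l// exprSr normrM (ger0_norm u2).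
    by rewrite ler_piMr.
  by apply: le_trans (ler_norm_sum _ _ _) (block_drift_B m sx).
have hj : \sum_(m <= i < D) jvar i x <= eta * (2 + driftB).
  apply: le_trans (block_jvar m sx) _; rewrite ler_wpM2l ?eta_ge0// lerD//.
    by rewrite ler_piMr.
  by rewrite /driftB lerD ?ysum_alA// ler_piMr.
have hWj := ler_wpM2l W0 hj.
apply: le_trans (lerD hd hWj) _; rewrite [W * _]mulrCA -mulrDr ler_wpM2l ?eta_ge0//.
rewrite /W /Cpow4.
have h1 : 0 <= u ^+ 2 * driftB by rewrite mulr_ge0.
have h2 : 0 <= kappa ^+ 2 * driftB by rewrite mulr_ge0.
nra.
Qed.

Lemma iterQ_mean k m x : is_state x ->
  iterQ k (ysum m) x <= ysum m x + k%:R * tstep * ysum m al.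
Proof.
move=> sx; apply: le_trans (iterQ_drift k (g := fun=> ysum m al) sx _) _.
  by move=> y sy; exact: stepQ_mean.
under eq_bigr do rewrite iterQ_cst.
by rewrite sumr_const card_ord -[ysum m al *+ k]mulr_natl mulrA [tstep * _]mulrC.
Qed.

Definition ybound (S : R) m x : R := ysum m x + (1 + S) * ysum m al.

Lemma ybound_ge0 S m x : 0 <= S -> is_state x -> 0 <= ybound S m x.
Proof.
by move=> S0 [x0 _]; rewrite addr_ge0 ?mulr_ge0 ?ysum_ge0// addr_ge0.
Qed.

Lemma iterQ_sqr k m (c S : R) x : 0 <= c <= 1 -> is_state x -> k%:R * tstep <= S ->
  iterQ k (fun y => (ysum m y - c) ^+ 2) x <=
  (ysum m x - c) ^+ 2 + k%:R * tstep * (Csqr * ybound S m x).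
Proof.
move=> c01 sx kS.
apply: le_trans (iterQ_drift k (g := fun y => Csqr * (ysum m y + ysum m al)) sx _) _.
  by move=> y sy; exact: stepQ_sqr.
rewrite lerD2l (mulrACA3 k%:R) ler_wpM2l ?tstep_ge0//.
rewrite mulr_natl -[X in _ *+ X](card_ord k) -sumr_const; apply: ler_sum => j _.
have Csqr0 : 0 <= Csqr by rewrite /Csqr addr_ge0// mulr_ge0.
rewrite iterQZ ler_wpM2l// iterQD iterQ_cst /ybound mulrDl mul1r.
rewrite [leRHS]addrCA [leLHS]addrC lerD2l.
apply: le_trans (iterQ_mean j m sx) _; rewrite lerD2l ler_wpM2r ?ysum_ge0//.
by apply: le_trans kS; rewrite ler_wpM2r ?tstep_ge0// ler_nat ltnW.
Qed.

(** The second moment is linear in time, so integrating it once more gives a bound quadratic in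
    time. The [kappa] term disappears when the jumps shrink. *)
Lemma iterQ_pow4 k m (S : R) x : is_state x -> k%:R * tstep <= S ->
  iterQ k (fun y => (ysum m y - ysum m x) ^+ 4) x <=
  k%:R * tstep * (Cpow4 * (k%:R * tstep * (Csqr * ybound S m x) + kappa ^+ 2)).
Proof.
move=> sx kS; set c := ysum m x; set t := k%:R * tstep.
have c01 : 0 <= c <= 1 by rewrite /c ysum_le1// ysum_ge0//; case: sx.
have t0 : 0 <= t by rewrite mulr_ge0 ?tstep_ge0.
have S0 : 0 <= S by exact: le_trans kS.
apply: le_trans (iterQ_drift k (g := fun y => Cpow4 * ((ysum m y - c) ^+ 2 + kappa ^+ 2)) sx _) _.
  by move=> y sy; exact: stepQ_pow4.
rewrite subrr expr0n/= add0r [in leRHS]/t (mulrACA3 k%:R) ler_wpM2l ?tstep_ge0//.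
rewrite mulr_natl -[X in _ *+ X](card_ord k) -sumr_const; apply: ler_sum => j _.
have Cpow40 : 0 <= Cpow4 by rewrite /Cpow4 addr_ge0// mulr_ge0// driftB_ge0.
have Csqr0 : 0 <= Csqr by rewrite /Csqr addr_ge0// mulr_ge0.
have jk : j%:R * tstep <= t by rewrite ler_wpM2r ?tstep_ge0// ler_nat ltnW.
rewrite iterQZ ler_wpM2l// iterQD iterQ_cst lerD2r.
apply: le_trans (iterQ_sqr m c01 sx (le_trans jk kS)) _.
rewrite subrr expr0n/= add0r -/t ler_wpM2r//.
by rewrite mulr_ge0// ybound_ge0.
Qed.

End chain.

(** * Uniform continuity and Taylor estimates for functions of finitely many coordinates *)

Section row_functions.
Variable R : realType.

Definition rcube n (v : 'rV[R]_n) : Prop := forall j, 0 <= v 0 j <= 1.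

Lemma compact_rcube n : compact (@rcube n).
Proof.
have := @rV_compact R n (fun=> `[0, 1]%classic) (fun=> @segment_compact R 0 1).
by rewrite (_ : mkset _ = @rcube n)//; apply/seteqP; split => v h j; have := h j; rewrite /= ?in_itv.
Qed.

(** Only [v] is confined to the cube: Taylor expansions are evaluated on segments that may leave
    it. *)
Lemma row_unif_cont n (rho : 'rV[R]_n -> R) (e : R) : continuous rho -> 0 < e ->
  exists2 dl : R, 0 < dl & forall v v' : 'rV[R]_n, rcube v -> (forall j, `|v 0 j - v' 0 j| < dl) ->
    `|rho v - rho v'| < e.
Proof.
move=> crho e0.
have /compact_near_coveringP := @compact_rcube n.
pose P (dl : R) (v : 'rV[R]_n) := forall v' : 'rV[R]_n, (forall j, `|v 0 j - v' 0 j| < dl) -> `|rho v - rho v'| < e.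
move=> /(_ R (nbhs (0 : R)) P _)[].
- move=> v cv.
  have e2 : 0 < e / 2 by rewrite divr_gt0.
  have /nbhs_ballP[r /= r0 hr] := crho v _ (nbhsx_ballx (rho v) (e / 2) e2).
  have r2 : 0 < r / 2 by rewrite divr_gt0.
  exists (ball v (r / 2), ball (0 : R) (r / 2)) => /=.
    by split; exact: nbhsx_ballx.
  move=> [w dl] /= [bw bdl] v' hv'.
  have h1 : `|rho v - rho w| < e / 2.
    by apply: hr; split=> // i j; apply: lt_trans (bw.2 i j) _; lra.
  have h2 : `|rho v - rho v'| < e / 2.
    apply: hr; split=> // i j; rewrite ord1 /ball/=.
    apply: le_lt_trans (ler_distD (w 0 j) _ _) _.
    rewrite [r]splitr; apply: ltrD; first exact: bw.2.
    apply: lt_trans (hv' j) _; apply: le_lt_trans (ler_norm _) _.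
    by move: bdl; rewrite /ball/= sub0r normrN.
  rewrite [e]splitr; apply: le_lt_trans (ler_distD (rho v) _ _) _.
  by rewrite distrC ltrD.
move=> dl /= dl0 hd.
have d2 : 0 < dl / 2 by rewrite divr_gt0.
exists (dl / 2) => // v v' cv hv; apply: (hd (dl / 2) _ v cv v' hv).
by rewrite /ball_/= sub0r normrN ger0_norm ?ltW//; lra.
Qed.

Lemma row_bounded n (rho : 'rV[R]_n -> R) : continuous rho ->
  exists2 M : R, 0 <= M & forall v, rcube v -> `|rho v| <= M.
Proof.
move=> crho.
have := @continuous_compact _ _ rho _ (continuous_subspaceT crho) (@compact_rcube n).
move/compact_bounded => [M [_ hM]].
exists (`|M| + 1) => [|v cv]; first by rewrite addr_ge0.
apply: (hM (`|M| + 1)); last by exists v.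
by apply: le_lt_trans (ler_norm M) _; lra.
Qed.

(** Points farther apart than [dl] cost at most [2 M], which is at most [2 M / dl^2] times their
    squared distance. A modulus of continuity is thereby turned into second moments, which the chain
    controls. *)
Lemma row_modulus n (rho : 'rV[R]_n -> R) (e : R) : continuous rho -> 0 < e ->
  exists2 C : R, 0 <= C & forall v v' : 'rV[R]_n, rcube v -> rcube v' ->
    `|rho v - rho v'| <= e + C * \sum_j (v 0 j - v' 0 j) ^+ 2.
Proof.
move=> crho e0; have [dl dl0 hd] := row_unif_cont crho e0.
have [M M0 hM] := row_bounded crho.
have d2 : 0 < dl ^+ 2 by rewrite exprn_gt0.
have C0 : 0 <= 2 * M / dl ^+ 2 by apply: divr_ge0; [exact: mulr_ge0|exact: ltW].
exists (2 * M / dl ^+ 2) => // v v' cv cv'.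
have [h|/existsNP[j hj]] := pselect (forall j, `|v 0 j - v' 0 j| < dl).
  apply: le_trans (ltW (hd _ _ cv h)) _; rewrite lerDl mulr_ge0//.
  by apply: sumr_ge0 => j _; exact: sqr_ge0.
move/negP: hj; rewrite -leNgt => hj.
apply: (@le_trans _ _ (2 * M)).
  by apply: le_trans (ler_normB _ _) _; rewrite mulr_natl mulr2n lerD ?hM.
apply: (@le_trans _ _ (2 * M / dl ^+ 2 * \sum_j (v 0 j - v' 0 j) ^+ 2)); last by rewrite lerDr ltW.
rewrite -mulrA ler_peMr ?mulr_ge0// mulrC ler_pdivlMr// mul1r.
rewrite (bigD1 j)//= -[leLHS]addr0 lerD ?sumr_ge0//; last by move=> i _; exact: sqr_ge0.
by rewrite -[leRHS]real_normK ?num_real// lerXn2r// nnegrE ltW.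
Qed.

Lemma mean_value (f f' : R -> R) (r : R) : (forall s : R, is_derive s 1 f (f' s)) ->
  exists2 th : R, 0 <= th <= 1 & f r - f 0 = f' (th * r) * r.
Proof.
move=> df.
have cf a b : {within `[a, b], continuous f}.
  apply: continuous_subspaceT => s; apply: differentiable_continuous.
  by apply/derivable1_diffP; case: (df s).
have [r0|r0|->] := ltgtP r 0.
- have [c] := MVT r0 (fun s _ => df s) (cf r 0); rewrite in_itv/= => /andP[c1 c2] e.
  exists (c / r).
    by rewrite ler_ndivrMr// mul1r (ltW c1) andbT -mulrNN -invrN divr_ge0// oppr_ge0 ltW.
  have rn : r != 0 by rewrite lt_eqF.
  by rewrite divfK//; move: e; rewrite sub0r mulrN => e; rewrite -opprB e opprK.
- have [c] := MVT r0 (fun s _ => df s) (cf 0 r); rewrite in_itv/= => /andP[c1 c2] e.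
  exists (c / r).
    by rewrite ler_pdivrMr// mul1r (ltW c2) andbT divr_ge0// ltW.
  have rn : r != 0 by rewrite gt_eqF.
  by rewrite divfK// e subr0.
- by exists 0; rewrite ?lexx ?ler01// subrr mulr0.
Qed.

(** The mean value theorem is applied to [k] minus its Taylor polynomial and then to [k1], so that
    only the oscillation of [k2] along the segment enters. *)
Lemma taylor2 (k k1 k2 : R -> R) (r e : R) :
  (forall s : R, is_derive s 1 k (k1 s)) -> (forall s : R, is_derive s 1 k1 (k2 s)) ->
  (forall th : R, 0 <= th <= 1 -> `|k2 (th * r) - k2 0| <= e) ->
  `|k r - k 0 - r * k1 0 - r ^+ 2 / 2 * k2 0| <= e * r ^+ 2.
Proof.
move=> dk dk1 he.
pose psi s := k s - s * k1 0 - s ^+ 2 / 2 * k2 0.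
have dpsi s : is_derive s (1 : R) psi (k1 s - k1 0 - s * k2 0).
  have h1 := dk s.
  have h2 : is_derive s (1 : R) (fun s : R => s * k1 0 : R) (k1 0).
    by apply: is_derive_eq; rewrite scaler0 add0r /GRing.scale/= mulr1.
  have h3 : is_derive s (1 : R) (fun s : R => s ^+ 2 / 2 * k2 0 : R) (s * k2 0).
    by apply: is_derive_eq; rewrite !scaler0 !add0r /GRing.scale/=; field.
  by apply: is_deriveB.
have [th th01 e1] := mean_value r dpsi.
have [th' th'01 e2] := mean_value (th * r) dk1.
have -> : k r - k 0 - r * k1 0 - r ^+ 2 / 2 * k2 0 = psi r - psi 0.
  by rewrite /psi; field.
have -> : psi r - psi 0 = (k2 (th' * th * r) - k2 0) * (th * r ^+ 2).
  by rewrite e1 e2 -(mulrA th' th r); ring.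
have th2 : 0 <= th' * th <= 1.
  by case/andP: th01 => ? ?; case/andP: th'01 => ? ?; rewrite mulr_ge0//= mulr_ile1.
case/andP: th01 => t0 t1; have e0 : 0 <= e by apply: le_trans (he _ th2).
have r2 : 0 <= r ^+ 2 by exact: sqr_ge0.
have tr : 0 <= th * r ^+ 2 by exact: mulr_ge0.
by rewrite normrM ler_pM ?he// ger0_norm// ler_piMl.
Qed.

Lemma derive_line n (g : 'rV[R]_n -> R) (v : 'rV[R]_n) (j : 'I_n) :
  (forall w, derivable g w (delta_mx 0 j)) ->
  forall s : R, is_derive s 1 (fun s : R => g (v + s *: delta_mx 0 j)) (partial g j (v + s *: delta_mx 0 j)).
Proof.
move=> dg s; have e : (fun h : R => h^-1 *: (((fun s : R => g (v + s *: delta_mx 0 j)) \o shift s) (h *: 1) -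
    g (v + s *: delta_mx 0 j))) =
   (fun h : R => h^-1 *: ((g \o shift (v + s *: delta_mx 0 j)) (h *: delta_mx 0 j) - g (v + s *: delta_mx 0 j))).
  apply: funext => h /=; congr (_ *: (g _ - _)).
  by rewrite scalerDl addrCA /GRing.scale/= mulr1.
split; first by rewrite /derivable e; exact: dg.
by rewrite /derive e.
Qed.

Lemma C2_taylor n (g : 'rV[R]_n -> R) (e : R) : C2 g -> 0 < e ->
  exists2 dl : R, 0 < dl & forall v j (r : R), rcube v -> `|r| < dl ->
    `|g (v + r *: delta_mx 0 j) - g v - r * partial g j v
      - r ^+ 2 / 2 * partial (partial g j) j v| <= e * r ^+ 2.
Proof.
move=> [_ dg _ d2g c2g] e0.
have /choice[dl hdl] : forall j : 'I_n, exists dl : R, 0 < dl /\ forall v v' : 'rV[R]_n, rcube v ->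
    (forall i, `|v 0 i - v' 0 i| < dl) ->
    `|partial (partial g j) j v - partial (partial g j) j v'| < e.
  by move=> j; have [dl d0 hd] := row_unif_cont (c2g j j) e0; exists dl.
exists (\big[Num.min/1]_j dl j) => [|v j r cv hr].
  by apply: (big_ind (fun x : R => 0 < x)) => // [x y x0 y0|j _]; [rewrite lt_min x0 y0|exact: (hdl j).1].
have {}hr : `|r| < dl j by apply: lt_le_trans hr _; exact: bigmin_le_cond.
have := @taylor2 (fun s => g (v + s *: delta_mx 0 j))
  (fun s => partial g j (v + s *: delta_mx 0 j))
  (fun s => partial (partial g j) j (v + s *: delta_mx 0 j)) r e
  (derive_line v (dg j)) (derive_line v (d2g j j)).
rewrite !scale0r !addr0; apply => th th01.
rewrite distrC ltW//; apply: (hdl j).2 => // i; rewrite !mxE opprD addrA subrr sub0r normrN.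
case: (_ && _); rewrite ?mulr0 ?normr0 ?(hdl j).1// mulr1 normrM.
by apply: le_lt_trans hr; rewrite ler_piMl// ger0_norm; case/andP: th01.
Qed.

End row_functions.

Lemma cvg_sumr (R : realType) (T : Type) (F : set_system T) (FF : Filter F) (I : Type)
  (r : seq I) (f : I -> T -> R) (l : I -> R) : (forall i, f i x @[x --> F] --> l i) ->
  \sum_(i <- r) f i x @[x --> F] --> \sum_(i <- r) l i.
Proof.
move=> fl; elim: r => [|i r ih].
  by rewrite big_nil; under eq_fun do rewrite big_nil; exact: cvg_cst.
by rewrite big_cons; under eq_fun do rewrite big_cons; exact: cvgD.
Qed.

Section generator_form.
Variables (R : realType) (n : nat).
Implicit Types (a : nat -> R) (g : 'rV[R]_n -> R).

Definition genL a (ainf : R) g (v : 'rV[R]_n) : R :=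
  \sum_(j < n) ((a j * (1 - \sum_k v 0 k) - ainf * v 0 j) * partial g j v
    + (1 - \sum_k v 0 k) * v 0 j * partial (partial g j) j v).

Lemma continuous_entry (j : 'I_n) : continuous (fun v : 'rV[R]_n => v 0 j).
Proof. by move=> v; exact: coord_continuous. Qed.

Lemma continuous_sum_entries : continuous (fun v : 'rV[R]_n => \sum_k v 0 k).
Proof. by move=> v; apply: (@cvg_sumr _ _ (nbhs v) (nbhs_filter v)) => k; exact: continuous_entry. Qed.

Lemma continuous_genL a ainf g : C2 g -> continuous (genL a ainf g).
Proof.
move=> [_ _ c1 _ c2] v; have FF : Filter (nbhs v) := nbhs_filter v.
have cs := @continuous_sum_entries v.
have c1s : (fun v : 'rV[R]_n => 1 - \sum_k v 0 k) @ v --> 1 - \sum_k v 0 k.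
  by apply: cvgB => //; exact: cvg_cst.
apply: (@cvg_sumr _ _ (nbhs v) (nbhs_filter v)) => j; have cj := @continuous_entry j v.
apply: cvgD; apply: cvgM.
- by apply: cvgB; apply: cvgM => //; exact: cvg_cst.
- exact: c1.
- exact: cvgM.
- exact: c2.
Qed.

End generator_form.

Lemma LnE (R : realType) (alpha : nat -> R) (ainf : R) (n : nat) (g : 'rV[R]_n -> R)
  (z : nat -> R) : Ln alpha ainf g z = genL (alphan alpha n) ainf g (firstm n z).
Proof.
rewrite /Ln /genL; apply: eq_bigr => i _.
have -> : \sum_k firstm n z 0 k = \sum_(j < n) z j by apply: eq_bigr => j _; rewrite mxE.
by rewrite mxE.
Qed.

(** [minn i m] is the block of index [i] when all indices from [m] on are merged into one block. *)
Lemma sum_blocks (R : realType) (d m : nat) (f : nat -> R) (phi : 'I_m.+1 -> R) : (m <= d)%N ->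
  \sum_(0 <= i < d.+1) f i * phi (inord (minn i m)) =
  \sum_(j < m.+1) (if (j < m)%N then f j else \sum_(m <= i < d.+1) f i) * phi j.
Proof.
move=> md; rewrite (big_cat_nat (n := m))//=; last by rewrite ltnW.
rewrite big_ord_recr/= ltnn; congr (_ + _).
  rewrite big_mkord; apply: eq_bigr => i _; rewrite (ltn_ord i); congr (_ * phi _).
  by apply/val_inj; rewrite /= inordK ?ltnS ?geq_minr//; exact/minn_idPl/ltnW.
rewrite mulr_suml; apply: eq_big_nat => i /andP[mi _]; congr (_ * phi _).
by apply/val_inj; rewrite /= inordK ?ltnS ?geq_minr//; exact/minn_idPr.
Qed.

Section chain_generator.
Variables (R : realType) (d : nat) (al : nat -> R) (ainf A delta : R).
Local Notation D := d.+1.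
Hypothesis al0 : forall i, 0 <= al i.
Hypothesis alA : \sum_(i < D) al i <= A.
Hypothesis ainf0 : 0 <= ainf.
Hypothesis delta0 : 0 <= delta.
Hypothesis small : delta + eta delta * driftB ainf A <= 1.
Variables (m : nat).
Hypothesis md : (m <= d)%N.
Implicit Types (x : nat -> R).

Local Notation stepQ := (stepQ d al ainf delta).
Local Notation iterQ := (iterQ d al ainf delta).
Local Notation tstep := (tstep d delta).
Local Notation eta := (eta delta).
Local Notation B := (driftB ainf A).
Local Notation kappa := (kappa ainf A delta).
Local Notation drift := (drift d al ainf).
Local Notation jvar := (jvar d al ainf delta).
Local Notation pup := (pup d).
Local Notation dup := (dup d al ainf delta).
Local Notation ddn := (ddn d al ainf delta).
Local Notation free := (free d).
Local Notation ysum := (ysum d).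

Definition lump x : 'rV[R]_m.+1 := \row_(j < m.+1) if (j < m)%N then x j else ysum m x.

Definition lump_al (j : nat) : R := if (j < m)%N then al j else ysum m al.

Lemma rcube_lump x : is_state d x -> rcube (lump x).
Proof.
move=> sx j; rewrite mxE; case: ifP => jm.
  have jD : (j < d.+1)%N by rewrite (ltn_trans jm).
  by rewrite (coord_le1 sx jD) andbT; case: sx.
by rewrite ysum_le1// andbT ysum_ge0//; case: sx.
Qed.

Lemma sum_lump x : \sum_j lump x 0 j = ysum 0 x.
Proof.
have := sum_blocks x (fun=> 1) md; under eq_bigr do rewrite mulr1.
by rewrite (ysumE d 0 x) => ->; apply: eq_bigr => j _; rewrite mulr1 mxE.
Qed.

Lemma lump_move x i (r : R) : (i < D)%N ->
  lump (move x i r) = lump x + r *: delta_mx 0 (inord (minn i m)).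
Proof.
move=> iD; apply/rowP => j; rewrite !mxE eqxx/=.
have -> : (j == inord (minn i m) :> 'I_m.+1) = (j == minn i m :> nat).
  by rewrite -val_eqE/= inordK// ltnS geq_minr.
case: ifP => jm.
  rewrite /move mulrC; congr (_ + _ * _%:R); congr nat_of_bool; apply/eqP/eqP; lia.
have -> : nat_of_ord j = m by have := ltn_ord j; move/negbT: jm; lia.
rewrite ysum_move// mulrC; congr (_ + _ * _%:R); congr nat_of_bool.
by apply/idP/eqP; lia.
Qed.

(** Taylor expansion in the direction of the moved coordinate: the mean and the second moment of the
    jump reproduce the generator. What remains is the Taylor error and the squared drift, of order
    [eta^2]. *)
Lemma stepQ_generator (g : 'rV[R]_m.+1 -> R) (e dl M : R) x :
  (forall v j (r : R), rcube v -> `|r| < dl ->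
    `|g (v + r *: delta_mx 0 j) - g v - r * partial g j v
      - r ^+ 2 / 2 * partial (partial g j) j v| <= e * r ^+ 2) ->
  (forall v j, rcube v -> `|partial (partial g j) j v| <= M) ->
  kappa < dl -> is_state d x ->
  `|stepQ (fun y => g (lump y)) x - g (lump x) - tstep * genL lump_al ainf g (lump x)|
   <= tstep * (e * (2 + B) + eta * (M * (B * B))).
Proof.
move=> hg hM kdl sx.
have cx := rcube_lump sx.
pose J i : 'I_m.+1 := inord (minn i m).
pose g1 i := partial g (J i) (lump x); pose g2 i := partial (partial g (J i)) (J i) (lump x).
(* Lumping is exact: [free] depends on the total mass only, and [drift i x] and [free x * x i] add
   up over the last block to the same expressions in the block mass. *)
have gen : genL lump_al ainf g (lump x) =
   \sum_(0 <= i < D) (drift i x * g1 i + free x * x i * g2 i).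
  rewrite big_split/= /genL.
  rewrite (@sum_blocks _ d m (drift ^~ x) (fun j => partial g j (lump x)) md).
  rewrite (@sum_blocks _ d m (fun i => free x * x i) (fun j => partial (partial g j) j (lump x)) md).
  rewrite -big_split/=; apply: eq_bigr => j _; rewrite sum_lump -/(free x).
  congr (_ * _ + _ * _); rewrite /lump_al mxE; case: ifP => jm //.
    by rewrite /drift ysumE big_split/= sumrN -mulr_suml -mulr_sumr.
  by rewrite ysumE mulr_sumr.
rewrite gen tstepE mulr_sumr.
have -> : stepQ (fun y => g (lump y)) x - g (lump x) = D%:R^-1 *
    \sum_(0 <= i < D) (pup i x * (g (lump x + dup i x *: delta_mx 0 (J i)) - g (lump x)) +
      (1 - pup i x) * (g (lump x + ddn i x *: delta_mx 0 (J i)) - g (lump x))).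
  rewrite -{1}(stepQ_cst d al ainf delta (g (lump x)) x) -mulN1r -stepQZ -stepQD stepQE.
  congr (_ * _).
  rewrite -(big_mkord xpredT (fun i => pup i x * (g (lump (move x i (dup i x))) + -1 * g (lump x)) +
     (1 - pup i x) * (g (lump (move x i (ddn i x))) + -1 * g (lump x)))).
  by apply: eq_big_nat => i /andP[_ iD]; rewrite !lump_move// !mulN1r.
rewrite -mulrBr -sumrB normrM ger0_norm ?invr_ge0// tstepE ler_wpM2l ?invr_ge0//.
apply: le_trans (ler_norm_sum _ _ _) _.
have hb := block_jvar al0 alA ainf0 delta0 small 0 sx.
have hs := block_drift_sqr al0 alA ainf0 0 sx; have hB := block_drift_B al0 alA ainf0 0 sx.
have e0 := eta_ge0 delta0; have B0 := driftB_ge0 al0 alA ainf0.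
have dl0 : 0 < dl by apply: le_lt_trans kdl; rewrite addr_ge0// mulr_ge0.
have M0 : 0 <= M by apply: le_trans (hM _ (J 0) cx).
have ee0 : 0 <= e.
  have h2 : `|dl / 2| < dl by rewrite gtr0_norm; lra.
  have h3 : 0 < (dl / 2) ^+ 2 by rewrite exprn_gt0// divr_gt0.
  by have := le_trans (normr_ge0 _) (hg _ (J 0) _ cx h2); rewrite pmulr_lge0.
apply: (@le_trans _ _ (\sum_(0 <= i < D) (e * jvar i x + eta ^+ 2 * M * drift i x ^+ 2))).
  rewrite [leLHS]big_nat_cond [leRHS]big_nat_cond; apply: ler_sum => i /andP[/andP[_ iD] _].
  have [k1 k2] := jump_small al0 alA ainf0 delta0 sx iD.
  have /andP[p0 p1] := pup01 i sx; have q0 : 0 <= 1 - pup i x by rewrite subr_ge0.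
  have t1 := hg _ (J i) _ cx (le_lt_trans k1 kdl).
  have t2 := hg _ (J i) _ cx (le_lt_trans k2 kdl).
  rewrite -/(g1 i) -/(g2 i) in t1 t2.
  set r1 := dup i x in t1 *; set r2 := ddn i x in t2 *.
  set G1 := g (_ + r1 *: _) in t1 *; set G2 := g (_ + r2 *: _) in t2 *.
  set G0 := g (lump x) in t1 t2 *.
  have mean := pup_mean al ainf delta i sx; have var := pup_var al ainf delta i sx.
  rewrite -/r1 -/r2 in mean var.
  have hv : jvar i x / 2 = eta * (free x * x i) + eta ^+ 2 * drift i x ^+ 2 / 2.
    by rewrite /jvar etaE; field.
  (* The two Taylor remainders, plus the part of the second moment that comes from the squared
     drift. *)
  have -> : pup i x * (G1 - G0) + (1 - pup i x) * (G2 - G0) - eta * (drift i x * g1 i + free x * x i * g2 i) =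
     pup i x * (G1 - G0 - r1 * g1 i - r1 ^+ 2 / 2 * g2 i) +
     (1 - pup i x) * (G2 - G0 - r2 * g1 i - r2 ^+ 2 / 2 * g2 i) +
     eta ^+ 2 * drift i x ^+ 2 / 2 * g2 i.
    transitivity (pup i x * (G1 - G0) + (1 - pup i x) * (G2 - G0) - (eta * drift i x) * g1 i -
      (jvar i x / 2 - eta ^+ 2 * drift i x ^+ 2 / 2) * g2 i).
      by rewrite hv; ring.
    by rewrite -mean -var; field.
  apply: le_trans (ler_normD _ _) _; apply: lerD.
    rewrite -var [leRHS]mulrDr; apply: le_trans (ler_normD _ _) _; apply: lerD.
      by rewrite normrM (ger0_norm p0) mulrCA ler_wpM2l.
    by rewrite normrM (ger0_norm q0) mulrCA ler_wpM2l.
  have s0 : 0 <= eta ^+ 2 * drift i x ^+ 2 by rewrite mulr_ge0 ?sqr_ge0.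
  rewrite normrM (mulrAC _ M) ler_pM ?hM//.
  by rewrite ger0_norm ?divr_ge0//; lra.
rewrite big_split/= -!mulr_sumr mulrDr; apply: lerD.
  rewrite mulrCA ler_wpM2l//; apply: le_trans hb _; rewrite ler_wpM2l// lerD//.
    by rewrite ler_piMr// ysum_le1.
  by rewrite /driftB lerD ?(ysum_alA al0 alA)// ler_piMr// ysum_le1.
set S := \sum_(0 <= i < D) drift i x ^+ 2 in hs *.
have -> : eta ^+ 2 * M * S = eta * (eta * (M * S)) by ring.
rewrite ler_wpM2l// ler_wpM2l// ler_wpM2l//.
by apply: le_trans hs _; rewrite ler_wpM2l.
Qed.

Lemma iterQ_abs k f g x : is_state d x -> (forall y, is_state d y -> `|f y| <= g y) ->
  `|iterQ k f x| <= iterQ k g x.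
Proof.
move=> sx fg; rewrite ler_norml; apply/andP; split.
  rewrite lerNl -mulN1r -[_ * _]/((fun y => -1 * iterQ k f y) x) -iterQZ.
  apply: (iterQ_le al0 alA) => // y sy; rewrite mulN1r.
  by have := fg y sy; rewrite ler_norml lerNl => /andP[].
by apply: (iterQ_le al0 alA) => // y sy; have := fg y sy; rewrite ler_norml => /andP[].
Qed.

(** The entries of [lump] are differences of consecutive tail masses, except the last, which is one;
    the rest is [(a - b)^2 <= 2 a^2 + 2 b^2]. *)
Lemma lump_sqr x y : \sum_j (lump x 0 j - lump y 0 j) ^+ 2 <=
  4 * \sum_(j < m.+1) (ysum j x - ysum j y) ^+ 2.
Proof.
pose D j := ysum j x - ysum j y.
have hj (j : 'I_m.+1) : lump x 0 j - lump y 0 j = if (j < m)%N then D j - D j.+1 else D j.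
  rewrite !mxE; case: ifP => jm; last first.
    by have -> : nat_of_ord j = m by have := ltn_ord j; move/negbT: jm; lia.
  have jD : (j < d.+1)%N by lia.
  by rewrite /D !ysumE !(big_ltn jD); ring.
under eq_bigr do rewrite hj.
rewrite big_ord_recr/= ltnn [in leRHS]big_ord_recr/= mulrDr.
under eq_bigr => j _ do rewrite (ltn_ord j).
apply: (@le_trans _ _ (\sum_(j < m) (2 * D j ^+ 2 + 2 * D j.+1 ^+ 2) + D m ^+ 2)).
  rewrite lerD2r; apply: ler_sum => j _.
  by have := sqr_ge0 (D j + D j.+1); nra.
rewrite big_split/= -!mulr_sumr.
have : \sum_(j < m) D j.+1 ^+ 2 <= \sum_(j < m) D j ^+ 2 + D m ^+ 2.
  have := big_ord_recr (idx := 0) (op := +%R) m (fun j : 'I_m.+1 => D j ^+ 2).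
  rewrite big_ord_recl/= => <-; rewrite lerDr; exact: sqr_ge0.
have : 0 <= \sum_(j < m) D j ^+ 2 by apply: sumr_ge0 => j _; exact: sqr_ge0.
have : 0 <= D m ^+ 2 by exact: sqr_ge0.
rewrite -[\sum_(i < m) (ysum i x - ysum i y) ^+ 2]/(\sum_(j < m) D j ^+ 2).
by rewrite -[ysum m x - ysum m y]/(D m) => *; lra.
Qed.

(** The one-step errors telescope. Freezing [rho] at the starting state costs its modulus, whose
    quadratic part is bounded by the second moments of the tail masses. *)
Lemma iterQ_generator (g : 'rV[R]_m.+1 -> R) (rho : 'rV[R]_m.+1 -> R) (e1 e2 C : R) k x :
  0 <= C -> is_state d x -> k%:R * tstep <= 1 ->
  (forall y, is_state d y ->
    `|stepQ (fun y => g (lump y)) y - g (lump y) - tstep * rho (lump y)| <= tstep * e1) ->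
  (forall v v' : 'rV[R]_m.+1, rcube v -> rcube v' ->
    `|rho v - rho v'| <= e2 + C * \sum_j (v 0 j - v' 0 j) ^+ 2) ->
  `|iterQ k (fun y => g (lump y)) x - g (lump x) - k%:R * tstep * rho (lump x)|
  <= k%:R * tstep * (e1 + (e2 + 4 * C * (m.+1%:R * (k%:R * tstep * (Csqr ainf * (1 + 2 * A)))))).
Proof.
move=> C0 sx k1 h1 h2.
pose G y := g (lump y); pose H y := stepQ G y - G y - tstep * rho (lump y).
have t0 := tstep_ge0 d delta0.
have tele j : iterQ j G x - G x = \sum_(i < j) (iterQ i H x + tstep * iterQ i (fun y => rho (lump y)) x).
  elim: j => [|j ih]; first by rewrite big_ord0 subrr.
  rewrite iterQSr big_ord_recr/= -ih.
  have -> : iterQ j (stepQ G) x = iterQ j (fun y => G y + (H y + tstep * rho (lump y))) x.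
    by congr (iterQ j _ x); apply: funext => y; rewrite /H; ring.
  by rewrite iterQD iterQD iterQZ; ring.
rewrite tele big_split/= -mulr_sumr.
have -> : \sum_(i < k) iterQ i H x + tstep * \sum_(i < k) iterQ i (fun y => rho (lump y)) x
   - k%:R * tstep * rho (lump x) =
  \sum_(i < k) (iterQ i H x + tstep * (iterQ i (fun y => rho (lump y)) x - rho (lump x))).
  rewrite big_split/= -addrA; congr (_ + _).
  by rewrite -mulr_sumr sumrB sumr_const card_ord -[rho _ *+ k]mulr_natl; ring.
apply: le_trans (ler_norm_sum _ _ _) _.
set X := e1 + _.
have -> : k%:R * tstep * X = \sum_(i < k) tstep * X.
  by rewrite sumr_const card_ord -[RHS]mulr_natl mulrA.
apply: ler_sum => i _; apply: le_trans (ler_normD _ _) _; rewrite /X [leRHS]mulrDr; apply: lerD.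
  by apply: le_trans (iterQ_abs i (g := fun=> tstep * e1) sx h1) _; rewrite iterQ_cst.
rewrite normrM (ger0_norm t0) ler_wpM2l//.
have -> : iterQ i (fun y => rho (lump y)) x - rho (lump x) =
    iterQ i (fun y => rho (lump y) + -1 * rho (lump x)) x.
  by rewrite iterQD iterQ_cst mulN1r.
apply: le_trans (iterQ_abs i (g := fun y => e2 + (C * 4) * \sum_(j < m.+1) (ysum j y - ysum j x) ^+ 2) sx _) _.
  move=> y sy; rewrite mulN1r; apply: le_trans (h2 _ _ (rcube_lump sy) (rcube_lump sx)) _.
  by rewrite lerD2l -mulrA ler_wpM2l// lump_sqr.
rewrite iterQD iterQ_cst iterQZ lerD2l [C * 4]mulrC ler_wpM2l ?mulr_ge0//.
rewrite iterQ_sum; set Z := k%:R * tstep * _.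
have -> : m.+1%:R * Z = \sum_(j < m.+1) Z by rewrite sumr_const card_ord -[RHS]mulr_natl.
apply: ler_sum => j _; rewrite /Z.
have c01 : 0 <= ysum j x <= 1 by rewrite ysum_le1// ysum_ge0//; case: sx.
have ik : i%:R * tstep <= k%:R * tstep by rewrite ler_wpM2r// ler_nat ltnW.
apply: le_trans (iterQ_sqr al0 alA ainf0 delta0 small j c01 sx (le_trans ik k1)) _.
have C10 : 0 <= Csqr ainf by rewrite /Csqr addr_ge0// mulr_ge0.
have yb0 := ybound_ge0 al0 j (@ler01 R) sx.
rewrite subrr expr0n/= add0r ler_pM// ?mulr_ge0// ler_wpM2l//.
by rewrite /ybound lerD ?ysum_le1// ler_wpM2l// (ysum_alA al0 alA).
Qed.

End chain_generator.

(* The uniformity over [d] and [delta] is what lets the bound pass to the limit. *)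
Lemma chain_generator (R : realType) (m : nat) (a : nat -> R) (ainf A : R)
  (g : 'rV[R]_m.+1 -> R) (e : R) : 0 <= ainf -> 0 <= A -> C2 g -> 0 < e ->
  exists2 dl : R, 0 < dl & forall (d : nat) (al : nat -> R) (delta : R),
    (forall i, 0 <= al i) -> \sum_(i < d.+1) al i <= A -> 0 <= delta ->
    delta + eta delta * driftB ainf A <= 1 -> (m <= d)%N ->
    (forall j, (j <= m)%N -> lump_al d al m j = a j) ->
    kappa ainf A delta < dl -> eta delta < dl ->
    forall k x, is_state d x -> k%:R * tstep d delta < dl ->
    `|iterQ d al ainf delta k (fun y => g (lump d m y)) x - g (lump d m x)
       - k%:R * tstep d delta * genL a ainf g (lump d m x)| <= k%:R * tstep d delta * e.
Proof.
move=> ainf0 A0 cg e0; set B := driftB ainf A.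
have B0 : 0 <= B by rewrite addr_ge0.
have C10 : 0 <= Csqr ainf by rewrite /Csqr addr_ge0// mulr_ge0.
have e4 : 0 < e / 4 / (2 + B) by rewrite !divr_gt0// ltr_wpDr.
have [dl1 dl10 hg] := C2_taylor cg e4.
have [M M0 hM] : exists2 M : R, 0 <= M & forall v j, rcube v -> `|partial (partial g j) j v| <= M.
  have /choice[M hM] : forall j : 'I_m.+1, exists M : R, 0 <= M /\ forall v, rcube v -> `|partial (partial g j) j v| <= M.
    by move=> j; case: cg => _ _ _ _ c2; have [M M0 hM] := row_bounded (c2 j j); exists M.
  exists (\sum_j M j) => [|v j cv]; first by apply: sumr_ge0 => j _; exact: (hM j).1.
  apply: le_trans ((hM j).2 v cv) _; rewrite (bigD1 j)//= lerDl.
  by apply: sumr_ge0 => i _; exact: (hM i).1.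
have e40 : 0 < e / 4 by rewrite divr_gt0.
have [C C0 hC] := row_modulus (@continuous_genL _ _ a ainf _ cg) e40.
pose K := 4 * C * (m.+1%:R * (Csqr ainf * (1 + 2 * A))).
have K0 : 0 <= K.
  by rewrite /K; apply: mulr_ge0; [exact: mulr_ge0|apply: mulr_ge0 => //; apply: mulr_ge0 => //; apply: addr_ge0 => //; exact: mulr_ge0].
pose MB := M * (B * B).
have MB0 : 0 <= MB by rewrite !mulr_ge0.
(* [dl1] bounds the jumps, 1 the elapsed time; the two quotients bound the elapsed time and [eta].
   Each of the four error sources, Taylor remainder, squared drift, modulus and displacement, then
   receives [e / 4]. *)
exists (Num.min (Num.min dl1 1) (Num.min (e / 4 / (K + 1)) (e / 4 / (MB + 1)))).
  by rewrite !lt_min dl10 ltr01 !divr_gt0// ltr_wpDl.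
move=> d al delta al0 alA delta0 small md ha.
move=> kd ed k x sx td.
have k1 : kappa ainf A delta < dl1 by move: kd; rewrite !lt_min => /andP[/andP[]].
have ee : eta delta < e / 4 / (MB + 1) by move: ed; rewrite !lt_min => /andP[_ /andP[]].
have t1 : k%:R * tstep d delta < 1 by move: td; rewrite !lt_min => /andP[/andP[]].
have tK : k%:R * tstep d delta < e / 4 / (K + 1) by move: td; rewrite !lt_min => /andP[_ /andP[]].
have ext y : genL (lump_al d al m) ainf g y = genL a ainf g y.
  by apply: eq_bigr => j _; rewrite ha// -ltnS.
have step y : is_state d y -> `|stepQ d al ainf delta (fun y => g (lump d m y)) y - g (lump d m y)
    - tstep d delta * genL a ainf g (lump d m y)| <= tstep d delta * (e / 2).
  move=> sy; rewrite -ext.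
  apply: le_trans (stepQ_generator al0 alA ainf0 delta0 small md hg hM k1 sy) _.
  rewrite ler_wpM2l ?tstep_ge0// divfK; last by rewrite gt_eqF// ltr_wpDr.
  have : eta delta * MB <= e / 4.
    apply: (@le_trans _ _ (eta delta * (MB + 1))).
      by rewrite ler_wpM2l ?eta_ge0// lerDl.
    by rewrite -ler_pdivlMr ?ltr_wpDl// ltW.
  by rewrite /MB /B => h; lra.
have := iterQ_generator al0 alA ainf0 delta0 small md C0 sx (ltW t1) step hC.
move=> /le_trans; apply; rewrite ler_wpM2l ?mulr_ge0 ?tstep_ge0//.
set t := k%:R * tstep d delta in t1 tK *.
have -> : 4 * C * (m.+1%:R * (t * (Csqr ainf * (1 + 2 * A)))) = t * K by rewrite /K; ring.
have t0 : 0 <= t by rewrite mulr_ge0 ?tstep_ge0.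
have : t * K <= e / 4.
  apply: (@le_trans _ _ (t * (K + 1))); first by rewrite ler_wpM2l// lerDl.
  by rewrite -ler_pdivlMr ?ltr_wpDl// ltW.
by move=> h; lra.
Qed.

(** * Expectations of functionals of whole trajectories *)

Section trajectories.
Variables (R : realType) (d : nat) (al : nat -> R) (ainf A delta : R).
Local Notation D := d.+1.
Local Notation state := (nat -> R).
Implicit Types (x : state) (F G : (nat -> state) -> R) (tr : nat -> state).

Definition scons x tr : nat -> state := fun j => if j is i.+1 then tr i else x.

(** Expectation by recursion on the first step, without a probability space for the chain. After [K]
    steps the trajectory stays at its last state. *)
Fixpoint traj (K : nat) F x : R :=
  if K is K'.+1 then stepQ d al ainf delta (fun y => traj K' (fun tr => F (scons x tr)) y) x
  else F (fun=> x).

Lemma trajD K F G x : traj K (fun tr => F tr + G tr) x = traj K F x + traj K G x.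
Proof.
elim: K F G x => //= K ih F G x; rewrite -stepQD; congr (stepQ _ _ _ _ _ x).
by apply: funext => y; exact: ih.
Qed.

Lemma trajZ K (c : R) F x : traj K (fun tr => c * F tr) x = c * traj K F x.
Proof.
elim: K F x => //= K ih F x; rewrite -stepQZ; congr (stepQ _ _ _ _ _ x).
by apply: funext => y; exact: ih.
Qed.

Lemma traj_cst K (c : R) x : traj K (fun=> c) x = c.
Proof.
elim: K x => //= K ih x; rewrite -[RHS](stepQ_cst d al ainf delta c x).
by congr (stepQ _ _ _ _ _ x); apply: funext => y; exact: ih.
Qed.

Lemma traj_start K F G x : (forall tr, tr 0%N = x -> F tr = G tr) -> traj K F x = traj K G x.
Proof.
case: K => [|K] FG /=; first exact: FG.
congr (stepQ _ _ _ _ _ x); apply: funext => y; congr (traj K _ y).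
by apply: funext => tr; exact: FG.
Qed.

Lemma traj_marginal K j (f : state -> R) x : (j <= K)%N ->
  traj K (fun tr => f (tr j)) x = iterQ d al ainf delta j f x.
Proof.
elim: K j x => [|K ih] [|j] x //= jK.
  rewrite -[RHS](stepQ_cst d al ainf delta (f x) x).
  by congr (stepQ _ _ _ _ _ x); apply: funext => y; exact: traj_cst.
by congr (stepQ _ _ _ _ _ x); apply: funext => y; exact: ih.
Qed.

Definition past_of k (a : (nat -> state) -> state -> R) : Prop :=
  forall tr tr' : nat -> state, (forall i, (i <= k)%N -> tr i = tr' i) -> a tr = a tr'.

(** The Markov property at time [k]. The induction absorbs the first state into the functional
    through [scons]. *)
Lemma traj_markov K k j (a : (nat -> state) -> state -> R) x : (k + j <= K)%N -> past_of k a ->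
  traj K (fun tr => a tr (tr (k + j)%N)) x = traj K (fun tr => iterQ d al ainf delta j (a tr) (tr k)) x.
Proof.
elim: k K a x => [|k ih] K a x kK pa.
  have e tr : tr 0%N = x -> a tr = a (fun=> x) by move=> e; apply: pa => i; rewrite leqn0 => /eqP ->.
  rewrite (@traj_start K _ (fun tr => a (fun=> x) (tr j))); last first.
    by move=> tr /e ->; rewrite add0n.
  rewrite traj_marginal// -[LHS](traj_cst K _ x); apply: traj_start => tr ex.
  by rewrite (e _ ex) ex.
case: K kK => // K kK /=; congr (stepQ _ _ _ _ _ x); apply: funext => y.
apply: (ih K (fun tr => a (scons x tr)) y kK) => tr tr' h.
by apply: pa => -[|i] //= ik; exact: h.
Qed.

Hypothesis al0 : forall i, 0 <= al i.
Hypothesis alA : \sum_(i < D) al i <= A.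
Hypothesis ainf0 : 0 <= ainf.
Hypothesis delta0 : 0 <= delta.
Hypothesis small : delta + eta delta * driftB ainf A <= 1.

Lemma traj_le K F G x : is_state d x ->
  (forall tr, (forall j, is_state d (tr j)) -> F tr <= G tr) -> traj K F x <= traj K G x.
Proof.
elim: K F G x => [|K ih] F G x sx FG /=; first exact: FG.
apply: (stepQ_le al0 alA) => // y sy; apply: ih => // tr st; apply: FG.
by case.
Qed.

Lemma traj_abs K F (M : R) x : is_state d x ->
  (forall tr, (forall j, is_state d (tr j)) -> `|F tr| <= M) -> `|traj K F x| <= M.
Proof.
move=> sx h; rewrite ler_norml; apply/andP; split.
  rewrite -(traj_cst K (- M) x); apply: traj_le => // tr st.
  by have := h tr st; rewrite ler_norml => /andP[].
rewrite -[leRHS](traj_cst K M x); apply: traj_le => // tr st.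
by have := h tr st; rewrite ler_norml => /andP[].
Qed.

(** Given the state at time [k] the fourth moment bound of the chain applies; averaging the tail
    mass over that state costs another [S * ysum d m al], hence the factor [1 + 2 * S]. *)
Lemma traj_increment4 K k j m (S : R) x : (k + j <= K)%N -> is_state d x ->
  j%:R * tstep d delta <= S -> k%:R * tstep d delta <= S ->
  traj K (fun tr => (ysum d m (tr (k + j)%N) - ysum d m (tr k)) ^+ 4) x <=
  j%:R * tstep d delta * (Cpow4 ainf A * (j%:R * tstep d delta *
    (Csqr ainf * (ysum d m x + (1 + 2 * S) * ysum d m al)) + kappa ainf A delta ^+ 2)).
Proof.
move=> kK sx jS kS; set t := j%:R * tstep d delta in jS *.
have t0 : 0 <= t by rewrite mulr_ge0// tstep_ge0.
have S0 : 0 <= S by exact: le_trans jS.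
have C40 : 0 <= Cpow4 ainf A.
  by rewrite /Cpow4 addr_ge0// mulr_ge0// (driftB_ge0 al0 alA).
have C20 : 0 <= Csqr ainf by rewrite /Csqr addr_ge0// mulr_ge0.
rewrite (@traj_markov K k j (fun tr y => (ysum d m y - ysum d m (tr k)) ^+ 4))//; last first.
  by move=> tr tr' h; apply: funext => y; rewrite (h k).
have -> : t * (Cpow4 ainf A * (t * (Csqr ainf * (ysum d m x + (1 + 2 * S) * ysum d m al)) + kappa ainf A delta ^+ 2)) =
  t * Cpow4 ainf A * t * Csqr ainf * ((ysum d m x + S * ysum d m al) + (1 + S) * ysum d m al) +
  t * Cpow4 ainf A * kappa ainf A delta ^+ 2 by ring.
apply: le_trans (_ : traj K (fun tr => t * Cpow4 ainf A * t * Csqr ainf * (ysum d m (tr k) + (1 + S) * ysum d m al) +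
    t * Cpow4 ainf A * kappa ainf A delta ^+ 2) x <= _).
  apply: traj_le => // tr st.
  apply: le_trans (iterQ_pow4 al0 alA ainf0 delta0 small m (st k) jS) _.
  by rewrite /ybound -/t le_eqVlt; apply/orP; left; apply/eqP; ring.
rewrite trajD traj_cst lerD2r trajZ ler_wpM2l ?mulr_ge0// trajD traj_cst lerD2r.
rewrite (@traj_marginal K k (ysum d m)); last by apply: leq_trans kK; rewrite leq_addr.
apply: le_trans (iterQ_mean al0 alA ainf0 delta0 small k m sx) _.
by rewrite lerD2l ler_wpM2r// ysum_ge0.
Qed.

Lemma traj_test K k j (a : (nat -> state) -> R) (G rho : state -> R) (e : R) x :
  (k + j <= K)%N -> is_state d x ->
  (forall tr tr' : nat -> state, (forall i, (i <= k)%N -> tr i = tr' i) -> a tr = a tr') ->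
  (forall tr, (forall i, is_state d (tr i)) -> `|a tr| <= 1) ->
  (forall y, is_state d y -> `|iterQ d al ainf delta j G y - G y - rho y| <= e) ->
  `|traj K (fun tr => a tr * (G (tr (k + j)%N) - G (tr k) - rho (tr k))) x| <= e.
Proof.
move=> kK sx pa a1 hG.
rewrite (@traj_markov K k j (fun tr y => a tr * (G y - G (tr k) - rho (tr k))))//; last first.
  by move=> tr tr' h; rewrite (pa tr tr') ?(h k).
have -> : (fun tr => iterQ d al ainf delta j (fun y => a tr * (G y - G (tr k) - rho (tr k))) (tr k)) =
  (fun tr => a tr * (iterQ d al ainf delta j G (tr k) - G (tr k) - rho (tr k))).
  apply: funext => tr; rewrite iterQZ; congr (_ * _).
  have -> : (fun y => G y - G (tr k) - rho (tr k)) = (fun y => G y + (- G (tr k) - rho (tr k))).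
    by apply: funext => y; rewrite addrA.
  by rewrite iterQD iterQ_cst addrA.
apply: traj_abs => // tr st; rewrite normrM -[leRHS]mul1r ler_pM// ?a1//.
exact: hG.
Qed.

End trajectories.

(** * Tails of summable sequences and cylinder functions *)

Section uniformly_continuous_cylinder_functions.
Variable R : realType.
Implicit Types (f g : (nat -> R) -> R).

Definition UCb f : Prop := UC f /\ exists M : R, forall y, cube y -> `|f y| <= M.

Lemma UCb_cst (c : R) : UCb (fun=> c).
Proof.
split; last by exists `|c|.
by move=> e e0; exists 0%N => y z _ _ _; rewrite subrr normr0 ltW.
Qed.

Lemma pow2N_small (e : R) : 0 < e -> exists K : nat, 2 ^- K <= e.
Proof.
move=> e0; have h : 2 ^- K @[K --> \oo] --> (0 : R).
  by under eq_fun do rewrite -exprVn; apply: cvg_expr; rewrite ger0_norm//; lra.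
move/cvgrPdist_le : h => /(_ e e0)[K _ /(_ K (leqnn K))] /= hK; exists K.
by move: hK; rewrite sub0r normrN ger0_norm.
Qed.

Lemma UCb_coord i : UCb (fun y => y i).
Proof.
split.
  move=> e e0; have [K hK] := pow2N_small e0.
  exists (maxn K i) => y z _ _ /(_ i (leq_maxr _ _)) /le_trans; apply.
  by apply: le_trans hK; rewrite lef_pV2 ?posrE ?exprn_gt0// ler_eXn2l ?leq_maxl// ltr1n.
exists 1 => y cy; rewrite ger0_norm; by case/andP: (cy i).
Qed.

Lemma UC_widen (K K' : nat) (y z : nat -> R) : (K <= K')%N ->
  (forall i, (i <= K')%N -> `|y i - z i| <= 2 ^- K') ->
  forall i, (i <= K)%N -> `|y i - z i| <= 2 ^- K.
Proof.
move=> KK h i iK; apply: le_trans (h i (leq_trans iK KK)) _.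
by rewrite lef_pV2 ?posrE ?exprn_gt0// ler_eXn2l// ltr1n.
Qed.

Lemma UCb_finite (n : nat) (F : 'I_n -> (nat -> R) -> R) (e : R) : 0 < e ->
  (forall j, UCb (F j)) -> exists K : nat, forall y z, cube y -> cube z ->
   (forall i, (i <= K)%N -> `|y i - z i| <= 2 ^- K) -> forall j, `|F j y - F j z| <= e.
Proof.
move=> e0 hF.
have /choice[K hK] : forall j, exists K : nat, forall y z, cube y -> cube z ->
   (forall i, (i <= K)%N -> `|y i - z i| <= 2 ^- K) -> `|F j y - F j z| <= e.
  by move=> j; exact: (hF j).1.
exists (\max_j K j) => y z cy cz h j; apply: hK => //.
by apply: UC_widen h; exact: leq_bigmax.
Qed.

Lemma UCb_row (n : nat) (g : 'rV[R]_n -> R) (V : (nat -> R) -> 'rV[R]_n) :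
  continuous g -> (forall j, UCb (fun y => V y 0 j)) -> (forall y, cube y -> rcube (V y)) ->
  UCb (fun y => g (V y)).
Proof.
move=> cg hV cV; split; last first.
  by have [M _ hM] := row_bounded cg; exists M => y cy; exact/hM/cV.
move=> e e0; have [dl d0 hd] := row_unif_cont cg e0.
have d2 : 0 < dl / 2 by rewrite divr_gt0.
have [K hK] := UCb_finite d2 hV; exists K => y z cy cz h.
apply/ltW/hd; first exact: cV.
by move=> j; apply: le_lt_trans (hK y z cy cz h j) _; lra.
Qed.

Lemma UCbD f g : UCb f -> UCb g -> UCb (fun y => f y + g y).
Proof.
move=> [uf [M hM]] [ug [N hN]]; split; last first.
  exists (M + N) => y cy; apply: le_trans (ler_normD _ _) _.
  by apply: lerD; [exact: hM|exact: hN].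
move=> e e0; have e2 : 0 < e / 2 by rewrite divr_gt0.
have [K hK] := uf _ e2; have [L hL] := ug _ e2.
exists (maxn K L) => y z cy cz h; rewrite opprD addrACA [e]splitr.
apply: le_trans (ler_normD _ _) _; apply: lerD.
  by apply: hK => //; apply: UC_widen h; exact: leq_maxl.
by apply: hL => //; apply: UC_widen h; exact: leq_maxr.
Qed.

Lemma UCbM f g : UCb f -> UCb g -> UCb (fun y => f y * g y).
Proof.
move=> [uf [M hM]] [ug [N hN]]; split; last first.
  by exists (M * N) => y cy; rewrite normrM ler_pM ?hM ?hN.
have hM' y : cube y -> `|f y| <= `|M| + 1.
  by move=> cy; apply: le_trans (hM y cy) _; have := ler_norm M; lra.
have hN' y : cube y -> `|g y| <= `|N| + 1.
  by move=> cy; apply: le_trans (hN y cy) _; have := ler_norm N; lra.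
have M0 : 0 < `|M| + 1 by rewrite ltr_wpDl.
have N0 : 0 < `|N| + 1 by rewrite ltr_wpDl.
move=> e e0; have eN : 0 < e / 2 / (`|N| + 1) by rewrite !divr_gt0.
have eM : 0 < e / 2 / (`|M| + 1) by rewrite !divr_gt0.
have [K hK] := uf _ eN; have [L hL] := ug _ eM.
exists (maxn K L) => y z cy cz h.
have -> : f y * g y - f z * g z = (f y - f z) * g y + f z * (g y - g z) by ring.
rewrite [e]splitr; apply: le_trans (ler_normD _ _) _; apply: lerD; rewrite normrM.
  rewrite -[leRHS](divfK (lt0r_neq0 N0)) ler_pM ?hN'//.
  by apply: hK => //; apply: UC_widen h; exact: leq_maxl.
rewrite mulrC -[leRHS](divfK (lt0r_neq0 M0)) ler_pM ?hM'//.
by apply: hL => //; apply: UC_widen h; exact: leq_maxr.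
Qed.

Lemma UCbZ (c : R) f : UCb f -> UCb (fun y => c * f y).
Proof. by move=> uf; apply: UCbM => //; exact: UCb_cst. Qed.

Lemma UCbB f g : UCb f -> UCb g -> UCb (fun y => f y - g y).
Proof.
move=> uf ug; have := UCbD uf (UCbZ (-1) ug).
by under [X in UCb X]eq_fun do rewrite mulN1r.
Qed.

Lemma UCbX f n : UCb f -> UCb (fun y => f y ^+ n).
Proof.
move=> uf; elim: n => [|n ih]; first by under eq_fun do rewrite expr0; exact: UCb_cst.
by under eq_fun do rewrite exprS; exact: UCbM.
Qed.

Lemma UCb_prod (I : Type) (s : seq I) (F : I -> (nat -> R) -> R) :
  (forall i, UCb (F i)) -> UCb (fun y => \prod_(i <- s) F i y).
Proof.
move=> hF; elim: s => [|i s ih]; first by under eq_fun do rewrite big_nil; exact: UCb_cst.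
by under eq_fun do rewrite big_cons; exact: UCbM.
Qed.

Lemma lip_max0 (a b : R) : `|Num.max 0 a - Num.max 0 b| <= `|a - b|.
Proof.
rewrite /Num.max; do 2 case: ltP => ?; rewrite !ler_norml;
  have := ler_norm (a - b); have := ler_norm (b - a); rewrite (distrC b); lra.
Qed.

Lemma UCb_lip f (phi : R -> R) : (forall a b, `|phi a - phi b| <= `|a - b|) ->
  UCb f -> UCb (fun y => phi (f y)).
Proof.
move=> hp [uf [M hM]]; split.
  move=> e e0; have [K hK] := uf _ e0; exists K => y z cy cz h.
  by apply: le_trans (hp _ _) _; exact: hK.
exists (M + `|phi 0|) => y cy; have := hp (f y) 0; rewrite subr0 => h.
rewrite -[phi (f y)](subrK (phi 0)); apply: le_trans (ler_normD _ _) _.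
by rewrite lerD2r; apply: le_trans h _; exact: hM.
Qed.

Lemma UCb_norm f : UCb f -> UCb (fun y => `|f y|).
Proof. by apply: (UCb_lip (phi := Num.norm)) => a b; exact: ler_dist_dist. Qed.

Lemma UCb_max0 f : UCb f -> UCb (fun y => Num.max 0 (f y)).
Proof. by apply: (UCb_lip (phi := Num.max 0)) => a b; exact: lip_max0. Qed.

End uniformly_continuous_cylinder_functions.

Section test_polynomials.
Variable R : realType.

(** For suitable sequences of exponents these polynomials tend on [[0, 1]] to the indicator of a
    half-line. They thus generate the events of the filtration, and they expand into powers, which
    reduces uniqueness to moments. *)
Definition psi (p q : nat) (z : R) : R := (1 - z ^+ p) ^+ q.

Lemma psi01 p q z : 0 <= z <= 1 -> 0 <= psi p q z <= 1.
Proof.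
move=> /andP[z0 z1]; rewrite exprn_ge0 ?exprn_ile1//.
- by rewrite subr_ge0 exprn_ile1.
- by rewrite gerBl exprn_ge0.
- by rewrite subr_ge0 exprn_ile1.
Qed.

End test_polynomials.

Section tails.
Variable R : realType.
Implicit Types y : nat -> R.

Definition tl y m : R := limn (fun N => \sum_(m <= j < N) y j).

Definition summable y : Prop := (forall i, 0 <= y i) /\ cvgn (fun n => \sum_(i < n) y i).

Lemma tl_cvg y m : summable y -> \sum_(m <= j < N) y j @[N --> \oo] --> tl y m.
Proof.
move=> [y0 cy]; apply/cvg_ex; exists (limn (fun n => \sum_(i < n) y i) - \sum_(i < m) y i).
have h : (\sum_(i < n) y i - \sum_(i < m) y i) @[n --> \oo] -->
   (limn (fun n => \sum_(i < n) y i) - \sum_(i < m) y i).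
  by apply: cvgB => //; exact: cvg_cst.
apply: cvg_trans h; apply: near_eq_cvg; exists m => // n /= mn.
by rewrite -!(big_mkord xpredT y) (big_cat_nat (n := m) (leq0n m) mn)/= addrAC subrr add0r.
Qed.

Lemma tl_ge y m n : summable y -> \sum_(m <= j < n) y j <= tl y m.
Proof.
move=> sy; have := @tl_cvg y m sy; move/cvgr_to_ge; apply; exists (maxn m n) => // N /=.
rewrite geq_max => /andP[mN nN]; have [mn|nm] := leqP m n.
  by rewrite (big_cat_nat mn nN)/= lerDl; apply: sumr_ge0 => i _; case: sy.
by rewrite big_geq ?(ltnW nm)//; apply: sumr_ge0 => i _; case: sy.
Qed.

Lemma tl_ge0 y m : summable y -> 0 <= tl y m.
Proof. by move=> sy; apply: le_trans (tl_ge m m sy); rewrite big_geq. Qed.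

Lemma tl_split y m n : summable y -> (m <= n)%N -> tl y m = \sum_(m <= j < n) y j + tl y n.
Proof.
move=> sy mn; have h : (\sum_(m <= j < n) y j + \sum_(n <= j < N) y j) @[N --> \oo] --> \sum_(m <= j < n) y j + tl y n.
  by apply: cvgD; [exact: cvg_cst|exact: tl_cvg].
apply: cvg_lim => //; apply: cvg_trans h; apply: near_eq_cvg; exists n => // N /= nN.
by rewrite [RHS](big_cat_nat mn nN).
Qed.

Lemma tlS y m : summable y -> tl y m = y m + tl y m.+1.
Proof. by move=> sy; rewrite (tl_split sy (leqnSn m)) big_nat1. Qed.

Lemma tl_to0 y : summable y -> tl y m @[m --> \oo] --> (0 : R).
Proof.
move=> sy; have h : (tl y 0 - \sum_(0 <= j < m) y j) @[m --> \oo] --> tl y 0 - tl y 0.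
  by apply: cvgB; [exact: cvg_cst|exact: tl_cvg].
rewrite subrr in h; apply: cvg_trans h; apply: near_eq_cvg; apply: nearW => m.
by rewrite (tl_split sy (leq0n m)) addrAC subrr add0r.
Qed.

(** A truncated sequence whose last entry carries the remaining mass has exactly the tail masses of
    the full one, so passing to dimension [d.+1] introduces no error in them. *)
Lemma ysum_tl y (z : nat -> R) d m : summable y -> (m <= d)%N ->
  (forall i, (i < d)%N -> z i = y i) -> z d = tl y d -> ysum d m z = tl y m.
Proof.
move=> sy md h hd; rewrite /ysum big_nat_recr//= hd (tl_split sy md); congr (_ + _).
by apply: eq_big_nat => i /andP[_ id]; exact: h.
Qed.

Lemma ysum_xn y d m : summable y -> (m <= d)%N -> ysum d m (xn y d.+1) = tl y m.
Proof.
move=> sy md; apply: ysum_tl => // [i id|]; rewrite /xn ltnS ?id//.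
by rewrite ltnn/= eqxx.
Qed.

Lemma ysum_alphan y d m : summable y -> (m <= d)%N -> ysum d m (alphan y d.+1) = tl y m.
Proof.
move=> sy md; apply: ysum_tl => // [i id|]; rewrite /alphan ltnS ?id//.
by rewrite ltnn/=.
Qed.

Lemma xn_ge0 y n i : summable y -> 0 <= xn y n i.
Proof.
move=> sy; rewrite /xn; case: ifP => _; first by case: sy.
by case: ifP => // _; exact: tl_ge0.
Qed.

Lemma alphan_ge0 y n i : summable y -> 0 <= alphan y n i.
Proof.
by move=> sy; rewrite /alphan; case: ifP => _; [case: sy|exact: tl_ge0].
Qed.

Lemma in_Delta_summable y : in_Delta y -> summable y /\ tl y 0 <= 1.
Proof.
move=> [y01 y1]; have y0 i : 0 <= y i by case/andP: (y01 i).
have sy : summable y.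
  split=> //; apply: nondecreasing_is_cvgn.
    move=> m n mn; rewrite -!(big_mkord xpredT y) (big_cat_nat (n := m) (leq0n m) mn)/= lerDl.
    by apply: sumr_ge0.
  by exists 1 => _ [n _ <-].
split=> //; have := @tl_cvg y 0 sy; move/cvgr_to_le; apply; apply: nearW => n.
by rewrite big_mkord.
Qed.

End tails.

(** * The path space *)

Section l1_distance.
Variable R : realType.
Implicit Types a b c y : nat -> R.

Lemma l1_nd y : nondecreasing_seq (fun n => \sum_(i < n) `|y i|).
Proof.
move=> m n mn; rewrite -!(big_mkord xpredT (fun i => `|y i|)) (big_cat_nat (n := m) (leq0n m) mn)/= lerDl.
by apply: sumr_ge0.
Qed.

Lemma l1_cvg y (M : R) : (forall n, \sum_(i < n) `|y i| <= M) ->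
  \sum_(i < n) `|y i| @[n --> \oo] --> l1 y.
Proof.
move=> hM; apply: nondecreasing_is_cvgn; first exact: l1_nd.
by exists M => _ [n _ <-].
Qed.

Lemma l1_le y (M : R) : (forall n, \sum_(i < n) `|y i| <= M) -> l1 y <= M.
Proof. by move=> hM; have := l1_cvg hM; move/cvgr_to_le; apply; apply: nearW. Qed.

Lemma l1_ge y (M : R) n : (forall n, \sum_(i < n) `|y i| <= M) -> \sum_(i < n) `|y i| <= l1 y.
Proof.
move=> hM; have := l1_cvg hM; move/cvgr_to_ge; apply; exists n => // m /= nm.
exact: l1_nd.
Qed.

Lemma Delta_sum_dist a b n : in_Delta a -> in_Delta b -> \sum_(i < n) `|a i - b i| <= 2.
Proof.
move=> [a01 a1] [b01 b1].
apply: (@le_trans _ _ (\sum_(i < n) (a i + b i))).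
  apply: ler_sum => i _; apply: le_trans (ler_normB _ _) _.
  by case/andP: (a01 i) => a0 _; case/andP: (b01 i) => b0 _; rewrite !ger0_norm.
by rewrite big_split/=; have := a1 n; have := b1 n; lra.
Qed.

Definition ld a b : R := l1 (fun i => a i - b i).

Lemma ld_ge a b n : in_Delta a -> in_Delta b -> \sum_(i < n) `|a i - b i| <= ld a b.
Proof. by move=> ha hb; apply: (l1_ge (M := 2)) => k; exact: Delta_sum_dist. Qed.

Lemma ld_coord a b i : in_Delta a -> in_Delta b -> `|a i - b i| <= ld a b.
Proof.
move=> ha hb; apply: le_trans (ld_ge i.+1 ha hb); rewrite big_ord_recr/= lerDr.
exact: sumr_ge0.
Qed.

Lemma ld_ge0 a b : in_Delta a -> in_Delta b -> 0 <= ld a b.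
Proof. by move=> ha hb; have := ld_ge 0 ha hb; rewrite big_ord0. Qed.

Lemma ld_le2 a b : in_Delta a -> in_Delta b -> ld a b <= 2.
Proof. by move=> ha hb; apply: l1_le => n; exact: Delta_sum_dist. Qed.

Lemma ld_sym a b : ld a b = ld b a.
Proof.
rewrite /ld /l1 (_ : (fun n => \sum_(i < n) `|a i - b i|) = (fun n => \sum_(i < n) `|b i - a i|))//.
by apply: funext => n; apply: eq_bigr => i _; rewrite distrC.
Qed.

Lemma ld_tri b a c : in_Delta a -> in_Delta b -> in_Delta c -> ld a c <= ld a b + ld b c.
Proof.
move=> ha hb hc; apply: l1_le => n.
apply: (@le_trans _ _ (\sum_(i < n) (`|a i - b i| + `|b i - c i|))).
  by apply: ler_sum => i _; exact: ler_distD.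
by rewrite big_split/= lerD ?ld_ge.
Qed.

Lemma Delta_summable a : in_Delta a -> summable a.
Proof. by move=> /in_Delta_summable[]. Qed.

Lemma tl_le1 a m : in_Delta a -> 0 <= tl a m <= 1.
Proof.
move=> /in_Delta_summable[sa a1]; rewrite tl_ge0//=.
by apply: le_trans a1; rewrite (tl_split sa (leq0n m)) lerDr; apply: sumr_ge0 => i _; case: sa.
Qed.

Lemma tl_dist a b m : in_Delta a -> in_Delta b -> `|tl a m - tl b m| <= ld a b.
Proof.
move=> ha hb; have sa := Delta_summable ha; have sb := Delta_summable hb.
have : `|\sum_(m <= j < n) a j - \sum_(m <= j < n) b j| @[n --> \oo] --> `|tl a m - tl b m|.
  by apply: cvg_norm; apply: cvgB; exact: tl_cvg.
move/cvgr_to_le; apply; exists m => // n /= mn.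
rewrite -sumrB; apply: le_trans (ler_norm_sum _ _ _) _.
apply: le_trans (ld_ge n ha hb).
rewrite -(big_mkord xpredT (fun i => `|a i - b i|)) (big_cat_nat (n := m) (leq0n m) mn)/= lerDr.
exact: sumr_ge0.
Qed.

(** The l^1 distance is controlled by finitely many coordinates and two tails; every approximation
    in the path space goes through this bound. *)
Lemma ld_tails a b m : in_Delta a -> in_Delta b ->
  ld a b <= \sum_(i < m) `|a i - b i| + (tl a m + tl b m).
Proof.
move=> ha hb; have sa := Delta_summable ha; have sb := Delta_summable hb.
apply: l1_le => n.
have [nm|mn] := leqP n m.
  apply: le_trans (l1_nd (fun i => a i - b i) nm) _.
  by rewrite lerDl addr_ge0// tl_ge0.
rewrite -!(big_mkord xpredT (fun i => `|a i - b i|)) (big_cat_nat (n := m) (leq0n m) (ltnW mn))/= lerD2l.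
apply: (@le_trans _ _ (\sum_(m <= i < n) (a i + b i))).
  by apply: ler_sum => i _; apply: le_trans (ler_normB _ _) _; rewrite !ger0_norm//; [case: sb|case: sa].
by rewrite big_split/= lerD// tl_ge.
Qed.

Lemma l1_tl a : in_Delta a -> l1 a = tl a 0.
Proof.
move=> ha; rewrite /l1 /tl.
rewrite (_ : (fun n => \sum_(i < n) `|a i|) = (fun n => \sum_(0 <= i < n) a i))//.
apply: funext => n; rewrite big_mkord; apply: eq_bigr => i _; rewrite ger0_norm//.
by case: (Delta_summable ha).
Qed.

Lemma in_Delta_intro a : (forall i, 0 <= a i) -> (forall n, \sum_(i < n) a i <= 1) -> in_Delta a.
Proof.
move=> a0 a1; split=> // i; rewrite a0/=.
by apply: le_trans (a1 i.+1); rewrite big_ord_recr/= lerDr sumr_ge0.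
Qed.

End l1_distance.

Section path_space.
Variables (R : realType) (T : R).
Hypothesis T0 : 0 < T.
Implicit Types w v : Omega T.

Lemma path_Delta w t : 0 <= t <= T -> in_Delta (opath w t).
Proof. by move=> tT; case: (Defs.pathP w) => + _ _; apply. Qed.

Lemma path_out w t : ~ (0 <= t <= T) -> opath w t = fun=> 0.
Proof. by move=> tT; case: (Defs.pathP w) => _ + _; apply. Qed.

Lemma path_cont w t (e : R) : 0 <= t <= T -> 0 < e -> exists2 dl : R, 0 < dl &
  forall s, 0 <= s <= T -> `|s - t| < dl -> ld (opath w s) (opath w t) < e.
Proof. by move=> tT e0; case: (Defs.pathP w) => _ _ + ; apply. Qed.

Definition time_set : set R := [set t | 0 <= t <= T].

Lemma compact_time : compact time_set.
Proof.
by have := @segment_compact R 0 T; rewrite (_ : `[0, T]%classic = time_set).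
Qed.

Lemma path_unif_cont w (e : R) : 0 < e -> exists2 dl : R, 0 < dl &
  forall s t, 0 <= s <= T -> 0 <= t <= T -> `|s - t| < dl -> ld (opath w s) (opath w t) < e.
Proof.
move=> e0; have /compact_near_coveringP := compact_time.
pose P (dl : R) (t : R) := 0 <= t <= T -> forall s, 0 <= s <= T -> `|s - t| < dl -> ld (opath w s) (opath w t) < e.
move=> /(_ R (nbhs (0 : R)) P _)[].
- move=> t /= tT; have e2 : 0 < e / 2 by rewrite divr_gt0.
  have [dl d0 hd] := path_cont w tT e2; have d2 : 0 < dl / 2 by rewrite divr_gt0.
  exists (ball t (dl / 2), ball (0 : R) (dl / 2)) => /=; first by split; exact: nbhsx_ballx.
  move=> [u r] [/= bu br] uT s sT su.
  have hu : `|u - t| < dl by rewrite distrC; apply: lt_trans bu _; lra.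
  have hs : `|s - t| < dl.
    apply: le_lt_trans (ler_distD u _ _) _; rewrite [dl]splitr ltrD//; last by rewrite distrC.
    apply: lt_trans su _; apply: le_lt_trans (ler_norm _) _.
    by move: br; rewrite /ball/= sub0r normrN.
  rewrite [e]splitr; apply: le_lt_trans (ld_tri (path_Delta w sT) (path_Delta w tT) (path_Delta w uT)) _.
  by apply: ltrD; [exact: hd|rewrite ld_sym; exact: hd].
- move=> dl /= d0 hd; have d2 : 0 < dl / 2 by rewrite divr_gt0.
  exists (dl / 2) => // s t sT tT st; apply: (hd (dl / 2)) => //=.
  by rewrite /ball_/= sub0r normrN ger0_norm ?ltW//; lra.
Qed.

(** [tl] is 1-Lipschitz for [ld] and tends to 0 at each fixed time; compactness of the time interval
    makes this uniform. *)
Lemma path_unif_tail w (e : R) : 0 < e -> exists m0 : nat, forall m t, (m0 <= m)%N ->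
  0 <= t <= T -> tl (opath w t) m < e.
Proof.
move=> e0; have /compact_near_coveringP := compact_time.
pose P (m : nat) (t : R) := 0 <= t <= T -> tl (opath w t) m < e.
move=> /(_ nat \oo P _)[].
- move=> t /= tT; have e2 : 0 < e / 2 by rewrite divr_gt0.
  have [dl d0 hd] := path_cont w tT e2.
  have /cvgrPdist_lt/(_ _ e2)[m0 _ hm] := tl_to0 (Delta_summable (path_Delta w tT)).
  exists (ball t dl, [set m | (m0 <= m)%N]) => /=.
    by split; [exact: nbhsx_ballx|exists m0].
  move=> [u m] [/= bu hm0] uT.
  have h1 : tl (opath w t) m < e / 2.
    by have := hm m hm0; rewrite sub0r normrN; apply: le_lt_trans; exact: ler_norm.
  have h2 : ld (opath w u) (opath w t) < e / 2 by apply: hd => //; rewrite distrC.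
  have := tl_dist m (path_Delta w uT) (path_Delta w tT).
  by rewrite ler_norml => /andP[_ h3]; lra.
- by move=> m0 _ hm; exists m0 => m t mm tT; exact: (hm m).
Qed.

Lemma dist_ge w v t : 0 <= t <= T -> ld (opath w t) (opath v t) <= dist_Omega w v.
Proof.
move=> tT; apply: ub_le_sup; last by exists t.
by exists 2 => _ [s /= sT <-]; apply: ld_le2; exact: path_Delta.
Qed.

Lemma dist_le w v (M : R) : (forall t, 0 <= t <= T -> ld (opath w t) (opath v t) <= M) ->
  dist_Omega w v <= M.
Proof.
move=> h; apply: ge_sup; last by move=> _ [t /= tT <-]; exact: h.
by exists (ld (opath w 0) (opath v 0)), 0 => //=; rewrite lexx ltW.
Qed.

Lemma dist_sym w v : dist_Omega w v = dist_Omega v w.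
Proof. by apply/eqP; rewrite eq_le; apply/andP; split; apply: dist_le => t tT; rewrite ld_sym; exact: dist_ge. Qed.

Lemma dist_tri v w u : dist_Omega w u <= dist_Omega w v + dist_Omega v u.
Proof.
apply: dist_le => t tT.
apply: le_trans (ld_tri (path_Delta w tT) (path_Delta v tT) (path_Delta u tT)) _.
by apply: lerD; exact: dist_ge.
Qed.

Lemma dist_coord w v t i : `|opath w t i - opath v t i| <= dist_Omega w v.
Proof.
have d0 : 0 <= dist_Omega w v.
  have z : 0 <= (0 : R) <= T by rewrite lexx ltW.
  by apply: le_trans (dist_ge w v z); apply: ld_ge0; exact: path_Delta.
have [tT|tT] := pselect (0 <= t <= T); last by rewrite !path_out// subrr normr0.
apply: le_trans (dist_ge w v tT); apply: ld_coord; exact: path_Delta.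
Qed.

Lemma open_measurable (U : set (OmegaB T)) : @open_Omega R T U -> measurable U.
Proof. by move=> oU; apply: sub_sigma_algebra. Qed.

Lemma continuous_measurable (F : OmegaB T -> R) :
  (forall w (e : R), 0 < e -> exists2 dl : R, 0 < dl &
     forall v, dist_Omega w v < dl -> `|F v - F w| < e) -> measurable_fun setT F.
Proof.
move=> cF; apply: (measurability _ (RGenOpens.measurableE R)) => // _ [_ [a [b ->] <-]].
rewrite setTI; apply: open_measurable => w /=; rewrite in_itv/= => /andP[aw wb].
pose r := Num.min (F w - a) (b - F w).
have r0 : 0 < r by rewrite lt_min !subr_gt0 aw.
have [dl d0 hd] := cF w r r0; exists dl => // v /hd; rewrite lt_min => /andP[h1 h2].
move: h1 h2; rewrite !ltr_norml => /andP[? ?] /andP[? ?]; rewrite in_itv/=.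
by apply/andP; split; lra.
Qed.

Lemma eval_bmf t i : bmf (fun w : OmegaB T => opath w t i).
Proof.
split.
  apply: continuous_measurable => w e e0; exists e => // v; apply: le_lt_trans.
  by rewrite distrC; exact: dist_coord.
exists 1 => w; have [tT|tT] := pselect (0 <= t <= T); last by rewrite path_out// normr0.
by have [/(_ i)/andP[h0 h1] _] := path_Delta w tT; rewrite ger0_norm.
Qed.

End path_space.

Lemma measurable_eval (R : realType) (T : R) t i (z : R) (T0 : 0 < T) : measurable [set w : OmegaB T | opath w t i = z].
Proof.
rewrite (_ : [set w : OmegaB T | opath w t i = z] = setT `&` (fun w : OmegaB T => opath w t i) @^-1` [set z]).
  exact: (@eval_bmf R T T0 t i).1.
by rewrite setTI.
Qed.

Lemma measurable_start (R : realType) (T : R) (T0 : 0 < T) (y : nat -> R) : measurable [set w : OmegaB T | forall i, opath w 0 i = y i].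
Proof.
rewrite (_ : [set w : OmegaB T | _] = \bigcap_i [set w : OmegaB T | opath w 0 i = y i]); last first.
  by apply/seteqP; split => w h i; [move=> _; exact: h|exact: h].
by apply: bigcapT_measurable => i; exact: measurable_eval.
Qed.

(** * Continuous paths from arrays of values at dyadic times *)

Section path_of_array.
Variables (R : realType) (T : R) (Y : nat -> nat -> nat -> R) (r : R).
Hypothesis T0 : 0 < T.
Hypotheses (r0 : 0 < r) (r1 : r < 1).
Hypothesis Y01 : forall m n k, 0 <= Y m n k <= 1.
Hypothesis Ymono : forall m n k, (k <= 2 ^ n)%N -> Y m.+1 n k <= Y m n k.
Hypothesis Ylev : forall m n k, (k <= 2 ^ n)%N -> Y m n.+1 k.*2 = Y m n k.
Hypothesis Yinc : forall m, exists n0 : nat, forall n k, (n0 <= n)%N -> (k < 2 ^ n)%N ->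
  `|Y m n k.+1 - Y m n k| <= r ^+ n.
Hypothesis Ytail : forall e : R, 0 < e -> exists m, forall n k, (k <= 2 ^ n)%N -> Y m n k <= e.

Definition idx (n : nat) (t : R) : nat := Num.truncn (2 ^+ n * (t / T)).

Local Notation inT t := (0 <= t <= T).

Lemma frac01 t : inT t -> 0 <= t / T <= 1.
Proof. by move=> /andP[t0 t1]; rewrite divr_ge0 ?(ltW T0)//= ler_pdivrMr// mul1r. Qed.

Lemma idx_itv n t : inT t -> (idx n t)%:R <= 2 ^+ n * (t / T) < (idx n t).+1%:R.
Proof.
by move=> /frac01/andP[t0 _]; apply: truncn_itv; rewrite mulr_ge0// exprn_ge0.
Qed.

Lemma idx_le n t : inT t -> (idx n t <= 2 ^ n)%N.
Proof.
move=> tT; have /andP[h _] := idx_itv n tT; have /andP[_ t1] := frac01 tT.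
rewrite -(ler_nat R) natrX; apply: le_trans h _; by rewrite ler_piMr// exprn_ge0.
Qed.

Lemma idxS n t : inT t -> idx n.+1 t = (idx n t).*2 \/ idx n.+1 t = (idx n t).*2.+1.
Proof.
move=> /frac01/andP[t0 _]; rewrite /idx exprS -mulrA truncn_double; last first.
  by rewrite mulr_ge0// exprn_ge0.
by case: (dig _ _); [right|left].
Qed.

Lemma idx_dyadic n n' k : (n <= n')%N -> idx n' (T * (k%:R / 2 ^+ n)) = (k * 2 ^ (n' - n))%N.
Proof.
move=> nn; rewrite /idx; apply: truncn_def.
have -> : 2 ^+ n' * (T * (k%:R / 2 ^+ n) / T) = (k * 2 ^ (n' - n))%:R :> R.
  rewrite natrM natrX -{1}(subnK nn) exprD.
  have h1 : T != 0 by rewrite gt_eqF.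
  have h2 : (2 : R) ^+ n != 0 by [].
  by field; rewrite h1 h2.
by rewrite lexx/= ltr_nat.
Qed.

Lemma dyadic_in n k : (k <= 2 ^ n)%N -> inT (T * (k%:R / 2 ^+ n)).
Proof.
move=> kn; have p : 0 < (2 : R) ^+ n by rewrite exprn_gt0.
rewrite mulr_ge0 ?divr_ge0 ?(ltW T0) ?(ltW p)//= ler_piMr ?(ltW T0)// ler_pdivrMr// mul1r.
by rewrite -natrX ler_nat.
Qed.

Definition lev m n t : R := Y m n (idx n t).
Definition limY m t : R := limn (fun n => lev m n t).

Lemma Ylev_iter m n j k : (k <= 2 ^ n)%N -> Y m (n + j) (k * 2 ^ j) = Y m n k.
Proof.
move=> kn; elim: j => [|j ih]; first by rewrite addn0 muln1.
rewrite addnS expnS mulnCA mul2n Ylev// expnD leq_mul2r kn orbT//.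
Qed.

(** At the next level the left grid point of [t] is either the same time, where [Ylev] applies, or
    one fine step further, where the increment bound applies. *)
Lemma lev_step m n0 n t : (forall n k, (n0 <= n)%N -> (k < 2 ^ n)%N -> `|Y m n k.+1 - Y m n k| <= r ^+ n) ->
  (n0 <= n)%N -> inT t -> `|lev m n.+1 t - lev m n t| <= r ^+ n.+1.
Proof.
move=> h nn tT; rewrite /lev -(Ylev m (idx_le n tT)); have [->|e] := idxS n tT.
  by rewrite subrr normr0 exprn_ge0// ltW.
rewrite e; apply: h; first by rewrite (leq_trans nn).
have := idx_le n.+1 tT; rewrite e.
by [].
Qed.

(** The geometric remainder is subtracted so that the induction on [j] closes. *)
Lemma lev_diff m n0 n j t : (forall n k, (n0 <= n)%N -> (k < 2 ^ n)%N -> `|Y m n k.+1 - Y m n k| <= r ^+ n) ->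
  (n0 <= n)%N -> inT t -> `|lev m (n + j) t - lev m n t| <= r ^+ n / (1 - r) - r ^+ (n + j) / (1 - r).
Proof.
move=> h nn tT; have p : 0 < 1 - r by rewrite subr_gt0.
elim: j => [|j ih]; first by rewrite addn0 !subrr normr0.
rewrite addnS; apply: le_trans (ler_distD (lev m (n + j) t) _ _) _.
have hs := lev_step h (leq_trans nn (leq_addr j n)) tT.
apply: le_trans (lerD hs ih) _.
have q : 0 <= r ^+ (n + j) by rewrite exprn_ge0// ltW.
have -> : r ^+ (n + j).+1 + (r ^+ n / (1 - r) - r ^+ (n + j) / (1 - r)) =
   r ^+ n / (1 - r) - r ^+ (n + j).+1 / (1 - r) - (1 - r) * r ^+ (n + j).
  by rewrite exprS; have h1 : 1 - r != 0 by [rewrite gt_eqF]; field.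
by rewrite gerBl mulr_ge0// ltW.
Qed.

Lemma geo_small (c e : R) : 0 < e -> exists n0 : nat, forall n, (n0 <= n)%N -> c * r ^+ n < e.
Proof.
move=> e0; have : c * r ^+ n @[n --> \oo] --> c * 0.
  by apply: cvgM; [exact: cvg_cst|apply: cvg_expr; rewrite ger0_norm// ltW].
rewrite mulr0 => /cvgrPdist_lt/(_ e e0)[n0 _ h]; exists n0 => n nn.
by have := h n nn; rewrite /= sub0r normrN; apply: le_lt_trans; exact: ler_norm.
Qed.

Lemma lev_cvg m t : inT t -> lev m n t @[n --> \oo] --> limY m t.
Proof.
move=> tT; have [n0 h] := Yinc m; have p : 0 < 1 - r by rewrite subr_gt0.
apply: cauchy_cvg; apply: cauchy_exP => e e0.
have [n1 hn1] := geo_small (1 - r)^-1 e0.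
exists (lev m (maxn n0 n1) t); exists (maxn n0 n1) => // n /= nn.
rewrite /ball/= distrC -(subnKC nn).
apply: le_lt_trans (lev_diff _ h (leq_maxl n0 n1) tT) _.
apply: le_lt_trans (hn1 (maxn n0 n1) (leq_maxr _ _)).
by rewrite mulrC gerBl mulr_ge0 ?invr_ge0 ?exprn_ge0 ?(ltW r0) ?(ltW p).
Qed.

Lemma limY_diff m n0 n t : (forall n k, (n0 <= n)%N -> (k < 2 ^ n)%N -> `|Y m n k.+1 - Y m n k| <= r ^+ n) ->
  (n0 <= n)%N -> inT t -> `|limY m t - lev m n t| <= r ^+ n / (1 - r).
Proof.
move=> h nn tT; have p : 0 < 1 - r by rewrite subr_gt0.
have : `|lev m k t - lev m n t| @[k --> \oo] --> `|limY m t - lev m n t|.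
  by apply: cvg_norm; apply: cvgB; [exact: lev_cvg|exact: cvg_cst].
move/cvgr_to_le; apply; exists n => // k /= nk; rewrite -(subnKC nk).
apply: le_trans (lev_diff _ h nn tT) _.
by rewrite gerBl divr_ge0 ?exprn_ge0 ?(ltW r0) ?(ltW p).
Qed.

Lemma limY_dyadic m n k : (k <= 2 ^ n)%N -> limY m (T * (k%:R / 2 ^+ n)) = Y m n k.
Proof.
move=> kn; apply: cvg_lim => //.
have : (fun=> Y m n k) @ \oo --> Y m n k by exact: cvg_cst.
apply: cvg_trans; apply: near_eq_cvg; exists n => // n' /= nn'.
by rewrite /lev (idx_dyadic k nn') -{1}(subnKC nn') Ylev_iter.
Qed.

Lemma limY01 m t : inT t -> 0 <= limY m t <= 1.
Proof.
move=> tT; have := @lev_cvg m t tT => h; apply/andP; split.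
  by move/cvgr_to_ge: h; apply; apply: nearW => n; case/andP: (Y01 m n (idx n t)).
by move/cvgr_to_le: h; apply; apply: nearW => n; case/andP: (Y01 m n (idx n t)).
Qed.

Lemma limY_mono m t : inT t -> limY m.+1 t <= limY m t.
Proof.
move=> tT; apply: ler_cvg_to (@lev_cvg m.+1 t tT) (@lev_cvg m t tT) _.
by apply: nearW => n; apply: Ymono; exact: idx_le.
Qed.

Lemma limY_anti m m' t : inT t -> (m <= m')%N -> limY m' t <= limY m t.
Proof.
move=> tT /subnKC <-; elim: (m' - m)%N => [|j ih]; first by rewrite addn0.
by rewrite addnS; apply: le_trans (limY_mono _ tT) ih.
Qed.

Lemma limY_tail (e : R) : 0 < e -> exists m0, forall m t, (m0 <= m)%N -> inT t -> limY m t <= e.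
Proof.
move=> e0; have [m0 h] := Ytail e0; exists m0 => m t mm tT.
apply: le_trans (limY_anti tT mm) _.
have := @lev_cvg m0 t tT; move/cvgr_to_le; apply; apply: nearW => n.
by apply: h; exact: idx_le.
Qed.

Lemma idx_close n s t : inT s -> inT t -> `|s - t| <= T / 2 ^+ n ->
  [\/ idx n s = idx n t, idx n s = (idx n t).+1 | idx n t = (idx n s).+1].
Proof.
move=> sT tT st; have p : 0 < (2 : R) ^+ n by rewrite exprn_gt0.
have h : `|2 ^+ n * (s / T) - 2 ^+ n * (t / T)| <= 1.
  rewrite -mulrBr -mulrBl !normrM normfV (gtr0_norm p) (gtr0_norm T0).
  by rewrite mulrA ler_pdivrMr// mul1r mulrC -ler_pdivlMr.
have /andP[s1 s2] := idx_itv n sT; have /andP[t1 t2] := idx_itv n tT.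
move: h; rewrite ler_norml => /andP[h1 h2].
have a1 : (idx n s < (idx n t).+2)%N by rewrite -(ltr_nat R) -[_.+2%:R]natr1; lra.
have a2 : (idx n t < (idx n s).+2)%N by rewrite -(ltr_nat R) -[_.+2%:R]natr1; lra.
have [->|[->|->]] : idx n s = idx n t \/ idx n s = (idx n t).+1 \/ idx n t = (idx n s).+1.
  by move: a1 a2; move: (idx n s) (idx n t) => a b; clear; lia.
- by constructor 1.
- by constructor 2.
- by constructor 3.
Qed.

(** Both times are replaced by grid points of a level whose mesh exceeds their distance; these are
    equal or adjacent. *)
Lemma limY_cont m (e : R) : 0 < e -> exists2 dl : R, 0 < dl &
  forall s t, inT s -> inT t -> `|s - t| < dl -> `|limY m s - limY m t| < e.
Proof.
move=> e0; have [n0 h] := Yinc m; have p : 0 < 1 - r by rewrite subr_gt0.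
have [n1 hn1] := geo_small (1 + 2 * (1 - r)^-1) e0.
pose n := maxn n0 n1; exists (T / 2 ^+ n); first by rewrite divr_gt0// exprn_gt0.
move=> s t sT tT st; apply: le_lt_trans (hn1 n (leq_maxr _ _)).
have ds := limY_diff h (leq_maxl n0 n1) sT; have dt := limY_diff h (leq_maxl n0 n1) tT.
rewrite -/n in ds dt.
have dl : `|lev m n s - lev m n t| <= r ^+ n.
  rewrite /lev; case: (idx_close sT tT (ltW st)) => e1.
  - by rewrite e1 subrr normr0 exprn_ge0// ltW.
  - by rewrite e1; apply: h; [exact: leq_maxl|have := idx_le n sT; rewrite e1].
  - by rewrite e1 distrC; apply: h; [exact: leq_maxl|have := idx_le n tT; rewrite e1].
have -> : (1 + 2 * (1 - r)^-1) * r ^+ n = r ^+ n / (1 - r) + (r ^+ n + r ^+ n / (1 - r)) by ring.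
apply: le_trans (ler_distD (lev m n s) _ _) _; apply: lerD => //.
apply: le_trans (ler_distD (lev m n t) _ _) _; apply: lerD => //.
by rewrite distrC.
Qed.

Definition wpath (t : R) (i : nat) : R := if inT t then limY i t - limY i.+1 t else 0.

Lemma wpath_sum m n t : inT t -> (m <= n)%N -> \sum_(m <= i < n) wpath t i = limY m t - limY n t.
Proof.
move=> tT mn; rewrite (eq_bigr (fun i => - (limY i.+1 t - limY i t))); last first.
  by move=> i _; rewrite /wpath tT opprB.
by rewrite sumrN telescope_sumr// opprB.
Qed.

Lemma wpath_Delta t : inT t -> in_Delta (wpath t).
Proof.
move=> tT; apply: in_Delta_intro => [i|n].
  by rewrite /wpath tT subr_ge0 limY_mono.
rewrite -(big_mkord xpredT (wpath t)) wpath_sum//.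
by have /andP[_ h1] := limY01 0 tT; have /andP[h0 _] := limY01 n tT; lra.
Qed.

(** The uniform tail bound enters here: the partial sums telescope to [limY m t - limY n t], and the
    subtracted term vanishes, so no mass is lost at infinity. *)
Lemma wpath_tl m t : inT t -> tl (wpath t) m = limY m t.
Proof.
move=> tT; apply: cvg_lim => //.
have lim0 : limY n t @[n --> \oo] --> (0 : R).
  apply/cvgrPdist_le => e e0; have [m0 h] := limY_tail e0; exists m0 => // n /= mn.
  by rewrite sub0r normrN ger0_norm ?h//; case/andP: (limY01 n tT).
have : (limY m t - limY n t) @[n --> \oo] --> limY m t - 0.
  by apply: cvgB => //; exact: cvg_cst.
rewrite subr0; apply: cvg_trans; apply: near_eq_cvg; exists m => // n /= mn.
by rewrite wpath_sum.
Qed.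

Lemma wpath_is_path : is_path T wpath.
Proof.
split.
- exact: wpath_Delta.
- by move=> t tT; apply: funext => i; rewrite /wpath; case: ifP.
- move=> t tT e e0; have e4 : 0 < e / 4 by rewrite divr_gt0.
  have [m hm] := limY_tail e4.
  (* The two tails take [e / 4] each. The first [m] coordinates are differences of two tail masses,
     so [2 m] increments must fit into another [e / 4]. *)
  have e4m : 0 < e / 4 / (m.*2.+1)%:R by rewrite divr_gt0.
  have /choice[dl hd] : forall i, exists dl : R, 0 < dl /\ forall s t, inT s -> inT t -> `|s - t| < dl -> `|limY i s - limY i t| < e / 4 / (m.*2.+1)%:R.
    by move=> i; have [dl d0 hd] := limY_cont i e4m; exists dl.
  exists (\big[Num.min/1]_(i < m.+1) dl i).
    by apply: (big_ind (fun x : R => 0 < x)) => // [x y x0 y0|j _]; [rewrite lt_min x0 y0|exact: (hd j).1].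
  move=> s sT st; have hs i : (i <= m)%N -> `|limY i s - limY i t| < e / 4 / (m.*2.+1)%:R.
    move=> im; apply: (hd i).2 => //; apply: lt_le_trans st _.
    pose j : 'I_m.+1 := Ordinal (im : (i < m.+1)%N).
    by rewrite -[dl i]/(dl j); exact: bigmin_le_cond.
  apply: le_lt_trans (ld_tails m (wpath_Delta sT) (wpath_Delta tT)) _.
  rewrite !wpath_tl//.
  have h1 := hm m s (leqnn m) sT; have h2 := hm m t (leqnn m) tT.
  suff h3 : \sum_(i < m) `|wpath s i - wpath t i| <= e / 4 by lra.
  have e5 : 0 <= e / 4 / (m.*2.+1)%:R by exact: ltW.
  apply: (@le_trans _ _ (\sum_(i < m) (2 * (e / 4 / (m.*2.+1)%:R)))).
    apply: ler_sum => i _; rewrite /wpath sT tT.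
    have -> : limY i s - limY i.+1 s - (limY i t - limY i.+1 t) =
      (limY i s - limY i t) - (limY i.+1 s - limY i.+1 t) by ring.
    apply: le_trans (ler_normB _ _) _; rewrite mulr_natl mulr2n.
    by apply: lerD; apply/ltW/hs => //; exact: ltnW.
  rewrite sumr_const card_ord -[leLHS]mulr_natl mulrA [_ * 2]mulrC -natrM mul2n mulrC.
  by rewrite -[leRHS](divfK (_ : (m.*2.+1)%:R != 0 :> R))// ler_wpM2l// ler_nat.
Qed.

Lemma path_of_array : exists w : Omega T, forall m n k, (k <= 2 ^ n)%N ->
  tl (opath w (T * (k%:R / 2 ^+ n))) m = Y m n k /\
  opath w (T * (k%:R / 2 ^+ n)) m = Y m n k - Y m.+1 n k.
Proof.
exists (MkOmega wpath_is_path) => m n k kn; have tT := dyadic_in kn.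
by split; [rewrite /= wpath_tl// limY_dyadic|rewrite /= /wpath tT !limY_dyadic].
Qed.

End path_of_array.

(** Chaining from time 0: a grid point of level [n.+1] is one of level [n] or the right neighbour of
    one, so each level adds one increment. *)
Lemma array_sup (R : realType) (Z : nat -> nat -> R) (r th : R) : 0 < r -> r < 1 -> 0 <= th ->
  (forall n k, (k <= 2 ^ n)%N -> Z n.+1 k.*2 = Z n k) ->
  (forall n k, (k < 2 ^ n)%N -> `|Z n k.+1 - Z n k| <= th * r ^+ n) ->
  forall n k, (k <= 2 ^ n)%N -> Z n k <= Z 0 0 + th / (1 - r).
Proof.
move=> r0 r1 th0 hlev hinc; have p : 0 < 1 - r by rewrite subr_gt0.
suff h n k : (k <= 2 ^ n)%N -> Z n k <= Z 0 0 + (th / (1 - r) - th * r ^+ n.+1 / (1 - r)).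
  move=> n k /h /le_trans; apply; rewrite lerD2l gerBl; apply: divr_ge0; last exact: ltW.
  by apply: mulr_ge0 => //; apply: exprn_ge0; exact: ltW.
elim: n k => [|n ih] k kn.
  have -> : th / (1 - r) - th * r ^+ 1 / (1 - r) = th by rewrite expr1; have h1 : 1 - r != 0 by [rewrite gt_eqF]; field.
  case: k kn => [|[|k]] // _; first by rewrite lerDl.
  by have := hinc 0 0 isT; rewrite expr0 mulr1 ler_norml => /andP[_]; rewrite lerBlDl.
have -> : th / (1 - r) - th * r ^+ n.+2 / (1 - r) = th / (1 - r) - th * r ^+ n.+1 / (1 - r) + th * r ^+ n.+1.
  by rewrite [r ^+ n.+2]exprS; have h1 : 1 - r != 0 by [rewrite gt_eqF]; field.
have t0 : 0 <= th * r ^+ n.+1 by apply: mulr_ge0 => //; apply: exprn_ge0; exact: ltW.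
have k2 : (k./2 <= 2 ^ n)%N by have := half_leq kn; rewrite expnS mul2n doubleK.
have hk := ih _ k2; rewrite addrA.
have [ok|ek] := boolP (odd k); last first.
  by rewrite -[k]odd_double_half (negbTE ek) add0n hlev// (le_trans hk)// lerDl.
rewrite -[k]odd_double_half ok add1n.
have kl : (k./2.*2 < 2 ^ n.+1)%N by move: kn; rewrite -{1}[k]odd_double_half ok.
have := hinc n.+1 _ kl; rewrite ler_norml => /andP[_]; rewrite lerBlDl hlev// => /le_trans; apply.
by rewrite lerD2r.
Qed.

Lemma bigcap_countType_measurable d (S : measurableType d) (U : countType) (F : U -> set S) :
  (forall i, measurable (F i)) -> measurable (\bigcap_i F i).
Proof.
move=> mF; rewrite -[X in measurable X]setCK setC_bigcap; apply: measurableC.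
by apply: countable_bigcupT_measurable => [|i]; [exact: countableP|exact: measurableC].
Qed.

(** * Separability of the path space; its Borel sets are generated by evaluations *)

Section separability.
Variables (R : realType) (T : R).
Hypothesis T0 : 0 < T.
Implicit Types w v : Omega T.

Definition gridt (n k : nat) : R := T * (k%:R / 2 ^+ n).

Definition flr (n : nat) (t : R) : R := gridt n (idx T n t).

Lemma gridt_in n k : (k <= 2 ^ n)%N -> 0 <= gridt n k <= T.
Proof. exact: dyadic_in. Qed.

Lemma flr_bounds n t : 0 <= t <= T -> flr n t <= t < flr n t + T / 2 ^+ n.
Proof.
move=> tT; have /andP[h1 h2] := idx_itv T0 n tT; have p : 0 < (2 : R) ^+ n by rewrite exprn_gt0.
have e : T * (2 ^+ n * (t / T) / 2 ^+ n) = t.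
  by field; rewrite !gt_eqF.
have h1' : (idx T n t)%:R / 2 ^+ n <= 2 ^+ n * (t / T) / 2 ^+ n by rewrite ler_wpM2r// invr_ge0 ltW.
have h2' : 2 ^+ n * (t / T) / 2 ^+ n < (idx T n t).+1%:R / 2 ^+ n by rewrite ltr_pM2r// invr_gt0.
apply/andP; split.
  by rewrite -[leRHS]e /flr /gridt ler_wpM2l// ltW.
rewrite -[ltLHS]e /flr /gridt -mulrDr ltr_pM2l//.
by rewrite -[X in _ + X]mul1r -mulrDl natr1.
Qed.

Lemma flr_in n t : 0 <= t <= T -> 0 <= flr n t <= T.
Proof. by move=> tT; apply: gridt_in; exact: idx_le. Qed.

Lemma flr_dist n t : 0 <= t <= T -> `|flr n t - t| <= T / 2 ^+ n.
Proof.
move=> tT; have /andP[h1 h2] := flr_bounds n tT.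
by rewrite distrC ger0_norm ?subr_ge0//; lra.
Qed.

Lemma flr_near (dl : R) : 0 < dl -> exists n0 : nat, forall n t, (n0 <= n)%N -> 0 <= t <= T ->
  `|flr n t - t| < dl.
Proof.
move=> d0; have dT : 0 < dl / T / 2 by rewrite !divr_gt0.
have [K hK] := pow2N_small dT; exists K => n t Kn tT; apply: le_lt_trans (flr_dist n tT) _.
rewrite mulrC -ltr_pdivlMr//; apply: (@le_lt_trans _ _ (2 ^- K)).
  by rewrite lef_pV2 ?posrE ?exprn_gt0// ler_eXn2l// ltr1n.
by apply: le_lt_trans hK _; rewrite ltr_pdivrMr// ltr_pMr ?divr_gt0// ltr1n.
Qed.

Lemma flr_ld w t (e : R) : 0 <= t <= T -> 0 < e -> exists n0 : nat, forall n, (n0 <= n)%N ->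
  ld (opath w (flr n t)) (opath w t) < e.
Proof.
move=> tT e0; have [dl d0 hd] := path_cont w tT e0; have [n0 hn] := flr_near d0.
by exists n0 => n nn; apply: hd; [exact: flr_in|exact: hn].
Qed.

Lemma flr_coord w t i : 0 <= t <= T -> opath w (flr n t) i @[n --> \oo] --> opath w t i.
Proof.
move=> tT; apply/cvgrPdist_lt => e e0; have [n0 h] := flr_ld w tT e0.
exists n0 => // n /= nn; rewrite distrC; apply: le_lt_trans (h n nn).
by apply: ld_coord; apply: path_Delta => //; exact: flr_in.
Qed.

Definition FT (t : R) := g_sigma_algebraType (@filt_gen R T t).

Lemma eval_FT t s i : 0 <= s <= t -> measurable_fun setT (fun w : FT t => opath w s i).
Proof.
move=> st _ B mB; rewrite setTI; apply: sub_sigma_algebra; exists s, i, B; split => //.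
Qed.

Lemma filt_measurable t (A : set (OmegaB T)) : filt t A -> measurable A.
Proof.
apply: smallest_sub; first exact: sigma_algebra_measurable.
move=> _ [s [i [B [_ mB ->]]]]; rewrite -[X in measurable X]setTI.
exact: (eval_bmf T0 s i).1.
Qed.

(** A single [n] serves as time mesh and as number of retained coordinates, certifying both moduli
    of [w] at precision [1 / (j + 1)]. *)
Definition calm (n j : nat) w : Prop :=
  (forall s t, 0 <= s <= T -> 0 <= t <= T -> `|s - t| <= T / 2 ^+ n -> ld (opath w s) (opath w t) <= j.+1%:R^-1) /\
  (forall t, 0 <= t <= T -> tl (opath w t) n <= j.+1%:R^-1).

(** The factor [n.+1 * j.+1] makes the rounding errors of the [n] retained coordinates add up to at
    most [1 / (j + 1)]. *)
Definition rounding (n j : nat) w : seq nat :=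
  [seq Num.truncn ((n.+1 * j.+1)%:R * opath w (gridt n ki.1) ki.2) |
     ki <- [seq (k, i) | k <- iota 0 (2 ^ n).+1, i <- iota 0 n]].

Lemma calm_exists w j : exists n, calm n j w.
Proof.
have e0 : 0 < (j.+1%:R^-1 : R) by rewrite invr_gt0.
have [dl d0 hd] := path_unif_cont w e0; have [m0 hm] := path_unif_tail w e0.
have dT : 0 < dl / T / 2 by rewrite !divr_gt0.
have [K hK] := pow2N_small dT; exists (maxn K m0); split.
  move=> s t sT tT st; apply/ltW/hd => //; apply: le_lt_trans st _.
  rewrite mulrC -ltr_pdivlMr//; apply: (@le_lt_trans _ _ (2 ^- K)).
    by rewrite lef_pV2 ?posrE ?exprn_gt0// ler_eXn2l ?leq_maxl// ltr1n.
  by apply: le_lt_trans hK _; rewrite ltr_pdivrMr// ltr_pMr ?divr_gt0// ltr1n.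
by move=> t tT; apply/ltW/hm => //; exact: leq_maxr.
Qed.

Lemma truncn_close (a b : R) : 0 <= a -> 0 <= b -> Num.truncn a = Num.truncn b -> `|a - b| <= 1.
Proof.
move=> /truncn_itv/andP[a1 a2] /truncn_itv/andP[b1 b2] e.
rewrite e -[_.+1%:R]natr1 in a1 a2; rewrite -[_.+1%:R]natr1 in b2.
by rewrite ler_norml; apply/andP; split; lra.
Qed.

(** The constant 5 counts one time oscillation and one tail for each path, and one rounding
    error. *)
Lemma calm_close n j w v : calm n j w -> calm n j v -> rounding n j w = rounding n j v ->
  dist_Omega w v <= 5 / j.+1%:R.
Proof.
move=> [cw tw] [cv tv] /eq_in_map hc; apply: dist_le => // t tT.
set q : R := j.+1%:R^-1 in cw tw cv tv *.
have fT := flr_in n tT; have fd := flr_dist n tT.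
have Dw := path_Delta w; have Dv := path_Delta v.
apply: le_trans (ld_tri (Dw _ tT) (Dw _ fT) (Dv _ tT)) _.
have h1 : ld (opath w t) (opath w (flr n t)) <= q by apply: cw => //; rewrite distrC.
have h2 := ld_tri (Dw _ fT) (Dv _ fT) (Dv _ tT).
have h3 : ld (opath v (flr n t)) (opath v t) <= q by apply: cv.
suff h4 : ld (opath w (flr n t)) (opath v (flr n t)) <= 3 * q by lra.
apply: le_trans (ld_tails n (Dw _ fT) (Dv _ fT)) _.
have h5 := tw _ fT; have h6 := tv _ fT.
suff h7 : \sum_(i < n) `|opath w (flr n t) i - opath v (flr n t) i| <= q by lra.
have M0 : (0 : R) < (n.+1 * j.+1)%:R by rewrite ltr0n.
apply: (@le_trans _ _ (\sum_(i < n) ((n.+1 * j.+1)%:R^-1 : R))).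
  apply: ler_sum => i _; rewrite -[leRHS]mul1r ler_pdivlMr// mulrC -{1}(gtr0_norm M0) -normrM mulrBr.
  apply: truncn_close.
  - by apply: mulr_ge0; [exact: ltW|case: (Dw _ fT) => /(_ i)/andP[]].
  - by apply: mulr_ge0; [exact: ltW|case: (Dv _ fT) => /(_ i)/andP[]].
  - apply: (hc (idx T n t, val i)); apply/allpairsP; exists (idx T n t, val i).
    by split => //; rewrite mem_iota add0n leq0n andTb; [rewrite ltnS; exact: idx_le|exact: ltn_ord].
rewrite sumr_const card_ord -[leLHS]mulr_natl natrM invfM mulrA ler_piMl ?invr_ge0//.
by rewrite ler_pdivrMr// mul1r ler_nat.
Qed.

(** There are countably many triples of a mesh, a precision and a rounding. One path is chosen for
    each triple that occurs, so no explicit dense family has to be shown to consist of paths. *)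
Lemma countable_dense : exists r : nat -> Omega T, forall w (e : R), 0 < e ->
  exists k, dist_Omega w (r k) <= e.
Proof.
have /choice[rep hrep] : forall c : nat * nat * seq nat, exists v, forall w,
    calm c.1.1 c.1.2 w -> rounding c.1.1 c.1.2 w = c.2 ->
    calm c.1.1 c.1.2 v /\ rounding c.1.1 c.1.2 v = c.2.
  move=> c; have [[w [h1 h2]]|h] := pselect (exists w, calm c.1.1 c.1.2 w /\ rounding c.1.1 c.1.2 w = c.2).
    by exists w.
  by exists point => w h1 h2; exfalso; apply: h; exists w.
exists (fun k => rep (odflt (0%N, 0%N, [::]) (unpickle k))) => w e e0.
pose j := Num.bound (5 / e).
have [n cw] := calm_exists w j.
pose c := (n, j, rounding n j w).
exists (pickle c); rewrite pickleK /=.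
have [h1 h2] := hrep c w cw erefl.
apply: le_trans (calm_close cw h1 _) _; first by rewrite h2.
rewrite ler_pdivrMr// mulrC -ler_pdivrMr//.
apply: le_trans (ltW (archi_boundP _)) _; first by rewrite divr_ge0 ?(ltW e0).
by rewrite ler_nat.
Qed.

(** Countably many finite sums of evaluations determine the distance; this makes closed balls events
    of the coordinate filtration. *)
Lemma dist_le_grid w v (a : R) : (forall n k N, (k <= 2 ^ n)%N ->
   \sum_(i < N) `|opath w (gridt n k) i - opath v (gridt n k) i| <= a) -> dist_Omega w v <= a.
Proof.
move=> h; apply: dist_le => // t tT; apply/ler_addgt0Pr => e e0.
have e2 : 0 < e / 2 by rewrite divr_gt0.
have [n1 h1] := flr_ld w tT e2; have [n2 h2] := flr_ld v tT e2.
pose n := maxn n1 n2; have fT := flr_in n tT.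
have Dw := path_Delta w; have Dv := path_Delta v.
have hw := h1 n (leq_maxl _ _); have hv := h2 n (leq_maxr _ _).
have h3 : ld (opath w (flr n t)) (opath v (flr n t)) <= a.
  by apply: l1_le => N; apply: h; exact: idx_le.
have := ld_tri (Dw _ tT) (Dw _ fT) (Dv _ tT); have := ld_tri (Dw _ fT) (Dv _ fT) (Dv _ tT).
by rewrite (ld_sym (opath w t) (opath w (flr n t))); lra.
Qed.

Lemma closed_ball_filt v (a : R) : filt T [set w : OmegaB T | dist_Omega w v <= a].
Proof.
pose B (p : nat * nat * nat) : set (FT T) := [set w | if (p.1.2 <= 2 ^ p.1.1)%N then
   \sum_(i < p.2) `|opath w (gridt p.1.1 p.1.2) i - opath v (gridt p.1.1 p.1.2) i| <= a else true].
have -> : [set w : OmegaB T | dist_Omega w v <= a] = \bigcap_p B p.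
  apply/seteqP; split=> [w /= hw [[n k] N] _ | w hw].
    rewrite /B/=; case: ifP => // kn; apply: le_trans hw.
    apply: le_trans (dist_ge w v (gridt_in kn)).
    by apply: ld_ge; apply: path_Delta; exact: gridt_in.
  apply: dist_le_grid => n k N kn; have := hw (n, k, N) I.
  by rewrite /B/= kn.
have mB p : measurable (B p).
  have [kn|kn] := boolP (p.1.2 <= 2 ^ p.1.1)%N; rewrite /B; last first.
    by rewrite (negbTE kn) (_ : [set _ | _] = setT)//; exact/seteqP.
  rewrite kn.
  have mf : measurable_fun setT (fun w : FT T => \sum_(i < p.2) `|opath w (gridt p.1.1 p.1.2) i - opath v (gridt p.1.1 p.1.2) i|).
    apply: measurable_sum => i; apply: measurableT_comp => //.
    apply: measurable_funB; last exact: measurable_cst.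
    by apply: eval_FT; exact: gridt_in.
  rewrite -[X in measurable X]setTI.
  have := measurable_fun_ler mf (@measurable_cst _ _ (FT T) _ setT a).
  by move=> /(_ measurableT [set true])/= /(_ I); congr measurable; apply/seteqP; split => w /=.
exact: (bigcap_countType_measurable mB).
Qed.

Lemma open_filt (U : set (OmegaB T)) : @open_Omega R T U -> filt T U.
Proof.
move=> oU; have [r hr] := countable_dense.
pose K (p : nat * nat) : set (OmegaB T) := [set w | dist_Omega w (r p.1) <= p.2.+1%:R^-1].
pose B (p : nat * nat) : set (FT T) := if `[< K p `<=` U >] then K p else set0.
have -> : U = \bigcup_p B p.
  apply/seteqP; split => [w Uw|w [p _]]; last first.
    by rewrite /B; case: ifP => // /asboolP h; exact: h.
  have [e e0 he] := oU w Uw.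
  (* Two radii [1 / (q + 1)] must be less than [e], so that a ball around a nearby dense point stays
     inside [U]. *)
  pose q := Num.bound (2 / e).
  have qe : 2 * q.+1%:R^-1 < e.
    rewrite ltr_pdivrMr// mulrC -ltr_pdivrMr//.
    apply: lt_le_trans (archi_boundP _) _; first by rewrite divr_ge0 ?(ltW e0).
    by rewrite ler_nat.
  have q0 : (0 : R) < q.+1%:R^-1 by rewrite invr_gt0.
  have [k hk] := hr w _ q0; exists (k, q) => //.
  rewrite /B; case: asboolP => [_|nK]; first exact: hk.
  exfalso; apply: nK => v /= hv; apply: he; apply: le_lt_trans qe.
  apply: le_trans (dist_tri T0 (r k) w v) _; rewrite mulr_natl mulr2n lerD//.
  by rewrite dist_sym.
have mB p : measurable (B p).
  by rewrite /B; case: ifP => _; [exact: closed_ball_filt|exact: measurable0].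
have := @countable_bigcupT_measurable _ (FT T) _ B (countableP _) mB.
by [].
Qed.

(** Two uses follow: a map into the path space is measurable as soon as its evaluations are, and a
    law is determined by events of the filtration. *)
Lemma measurable_filt (A : set (OmegaB T)) : measurable A -> filt T A.
Proof.
apply: smallest_sub; last by move=> U oU; exact: open_filt.
have := @sigma_algebra_measurable _ (FT T).
by [].
Qed.

Lemma measurable_to_Omega d (S : measurableType d) (W : S -> OmegaB T) :
  (forall t i, 0 <= t <= T -> measurable_fun setT (fun u => opath (W u) t i)) ->
  measurable_fun setT W.
Proof.
move=> mW _ A mA; rewrite setTI; have := measurable_filt mA.
move: A {mA}; apply: smallest_sub.
  split => [|A h|F h]; first by rewrite preimage_set0; exact: measurable0.
    by rewrite setTD /= preimage_setC; exact: measurableC.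
  by rewrite /= preimage_bigcup; apply: bigcupT_measurable.
move=> _ [s [i [B [st mB ->]]]] /=.
by have := mW s i st measurableT B mB; rewrite setTI.
Qed.

End separability.

Lemma lim_eq (R : realType) (u v : nat -> R) (a b : R) : u =1 v ->
  u @ \oo --> a -> v @ \oo --> b -> a = b.
Proof. by move=> /funext -> ua ub; rewrite -(cvg_lim _ ua)// -(cvg_lim _ ub). Qed.

(** * Polynomial approximation of indicators of half-lines *)

Section ray_approximation.
Variable R : realType.

Lemma bernoulli (y : R) q : 0 <= y <= 1 -> 1 - q%:R * y <= (1 - y) ^+ q.
Proof.
move=> /andP[y0 y1]; elim: q => [|q ih]; first by rewrite mul0r subr0 expr0.
rewrite exprS; apply: le_trans (_ : (1 - y) * (1 - q%:R * y) <= _).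
  rewrite -natr1; have : 0 <= q%:R * (y * y) by rewrite !mulr_ge0.
  by move=> h; nra.
by rewrite ler_wpM2l// subr_ge0.
Qed.

Lemma bernoulli_inv (y : R) q : 0 <= y <= 1 -> (1 - y) ^+ q * (1 + q%:R * y) <= 1.
Proof.
move=> /andP[y0 y1]; elim: q => [|q ih]; first by rewrite mul0r addr0 expr0 mulr1.
apply: le_trans ih; rewrite exprSr -mulrA ler_wpM2l ?exprn_ge0 ?subr_ge0//.
by rewrite -natr1; have : 0 <= q%:R * (y * y) by [rewrite !mulr_ge0]; move=> h; nra.
Qed.

(** With [s] the square root of [rho], [n * s^n] is bounded by the Bernoulli inequality, and the
    other factor [s^n] tends to 0. *)
Lemma natmul_expr_cvg0 (rho : R) : 0 <= rho < 1 -> n%:R * rho ^+ n @[n --> \oo] --> (0 : R).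
Proof.
move=> /andP[r0 r1]; pose s := Num.sqrt rho.
have s0 : 0 <= s by exact: sqrtr_ge0.
have s1 : s < 1 by rewrite -sqrtr1 ltr_sqrt.
have rs : rho = s * s by rewrite -expr2 sqr_sqrtr.
have p : 0 < 1 - s by rewrite subr_gt0.
have hb n : n%:R * s ^+ n <= (1 - s)^-1.
  have s01 : 0 <= 1 - s <= 1 by apply/andP; split; lra.
  have := bernoulli_inv n s01; rewrite subKr => h.
  rewrite -[leRHS]mul1r ler_pdivlMr//; apply: le_trans h.
  have : 0 <= s ^+ n by rewrite exprn_ge0.
  by move=> h; nra.
apply: (@squeeze_cvgr _ _ _ _ (fun=> 0) (fun n => (1 - s)^-1 * s ^+ n)).
- apply: nearW => n; rewrite mulr_ge0 ?exprn_ge0//= rs exprMn mulrA.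
  by rewrite ler_wpM2r ?exprn_ge0.
- exact: cvg_cst.
- rewrite -[X in _ --> X](mulr0 (1 - s)^-1); apply: cvgM; first exact: cvg_cst.
  by apply: cvg_expr; rewrite ger0_norm.
Qed.

(* The exponents [p k = k], [q k ~ k / c^k] make [z = c] fall on the side where the limit is [0]. *)
Lemma ray_approx (c : R) : exists p q : nat -> nat, forall z : R, 0 <= z <= 1 ->
  psi (p k) (q k) z @[k --> \oo] --> ((z < c)%R%:R : R).
Proof.
have [c0|c0] := leP c 0.
  exists (fun=> 0%N), (fun=> 1%N) => z /andP[z0 _].
  rewrite /psi expr0 subrr expr1 (_ : (z < c) = false); first exact: cvg_cst.
  by apply/negbTE; rewrite -leNgt (le_trans c0).
have [c1|c1] := ltP 1 c.
  exists (fun=> 0%N), (fun=> 0%N) => z /andP[_ z1].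
  by rewrite /psi expr0 (le_lt_trans z1 c1); exact: cvg_cst.
pose q k := (Num.truncn (k%:R / c ^+ k)).+1.
have ck k : 0 < c ^+ k by rewrite exprn_gt0.
have q1 k : k%:R / c ^+ k <= (q k)%:R by rewrite ltW// truncnS_gt.
have q2 k : (q k)%:R <= k%:R / c ^+ k + 1.
  rewrite /q -natr1 lerD2r truncn_le divr_ge0// ltW//.
exists id, q => z /andP[z0 z1]; have zk k : 0 <= z ^+ k <= 1 by rewrite exprn_ge0// exprn_ile1.
have [zc|cz] := ltP z c.
  apply: (@squeeze_cvgr _ _ _ _ (fun k => 1 - (k%:R * (z / c) ^+ k + z ^+ k)) (fun=> 1)).
  - apply: nearW => k; have /andP[_ ->] := psi01 k (q k) (introT andP (conj z0 z1)).
    rewrite andbT; apply: le_trans (bernoulli (q k) (zk k)); rewrite lerD2l lerN2.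
    have h := q2 k; case/andP: (zk k) => k0 _; apply: le_trans (ler_wpM2r k0 h) _.
    by rewrite mulrDl mul1r expr_div_n mulrA mulrAC.
  - rewrite -[X in _ --> X]subr0; apply: cvgB; first exact: cvg_cst.
    rewrite -[X in _ --> X]addr0; apply: cvgD.
      apply: natmul_expr_cvg0; rewrite divr_ge0 ?(ltW c0)//=.
      by rewrite ltr_pdivrMr// mul1r.
    by apply: cvg_expr; rewrite ger0_norm// (lt_le_trans zc).
  - exact: cvg_cst.
apply: (@squeeze_cvgr _ _ _ _ (fun=> 0) (fun k => k%:R^-1)).
- exists 1%N => // k /= k1; have /andP[-> _] := psi01 k (q k) (introT andP (conj z0 z1)).
  have k0 : (0 : R) < k%:R by rewrite ltr0n.
  rewrite /= -[leRHS]mul1r ler_pdivlMr//; apply: le_trans (bernoulli_inv (q k) (zk k)).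
  rewrite ler_wpM2l ?exprn_ge0 ?subr_ge0//; first by case/andP: (zk k).
  apply: le_trans (_ : (q k)%:R * z ^+ k <= _); last by rewrite lerDr.
  have h := q1 k; rewrite ler_pdivrMr// in h; apply: le_trans h _.
  by rewrite ler_wpM2l// lerXn2r// nnegrE ltW.
- exact: cvg_cst.
- apply/cvgrPdist_lt => e e0; exists (Num.bound e^-1).+1 => // k /= hk.
  have k0 : (0 : R) < k%:R by rewrite ltr0n (leq_trans _ hk).
  rewrite sub0r normrN gtr0_norm ?invr_gt0// -[ltRHS]invrK ltf_pV2 ?posrE ?invr_gt0//.
  apply: lt_le_trans (archi_boundP _) _; first by rewrite invr_ge0 ltW.
  by rewrite ler_nat ltnW.
Qed.

Lemma cvg_prodr (T : Type) (F : set_system T) (FF : Filter F) (I : Type)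
  (r : seq I) (f : I -> T -> R) (l : I -> R) : (forall i, f i x @[x --> F] --> l i) ->
  \prod_(i <- r) f i x @[x --> F] --> \prod_(i <- r) l i.
Proof.
move=> fl; elim: r => [|i r ih].
  by rewrite big_nil; under eq_fun do rewrite big_nil; exact: cvg_cst.
by rewrite big_cons; under eq_fun do rewrite big_cons; exact: cvgM.
Qed.

Lemma prod01 (I : Type) (r : seq I) (f : I -> R) : (forall i, 0 <= f i <= 1) ->
  0 <= \prod_(i <- r) f i <= 1.
Proof.
move=> f01; elim: r => [|i r ih]; first by rewrite big_nil ler01 lexx.
rewrite big_cons; case/andP: ih => i0 i1; case/andP: (f01 i) => j0 j1.
by rewrite mulr_ge0//= mulr_ile1.
Qed.

End ray_approximation.

Section test_products.
Variables (R : realType) (T : R).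
Hypothesis T0 : 0 < T.

Lemma path01 (w : Omega T) t i : 0 <= opath w t i <= 1.
Proof.
have [tT|tT] := pselect (0 <= t <= T); last by rewrite path_out// lexx ler01.
by case: (path_Delta w tT) => /(_ i).
Qed.

(* An item [((t, i), (p, q))] stands for the factor [psi p q (w_i(t))]. *)
Definition tprod (l : seq ((R * nat) * (nat * nat))) (w : OmegaB T) : R :=
  \prod_(x <- l) psi x.2.1 x.2.2 (opath w x.1.1 x.1.2).

Lemma tprod01 l w : 0 <= tprod l w <= 1.
Proof. by apply: prod01 => x; apply: psi01; exact: path01. Qed.

Lemma bmf_tprod l : bmf (tprod l).
Proof.
apply: bmf_prod => x; apply: bmfX; apply: bmfB; first exact: bmf_cst.
by apply: bmfX; exact: eval_bmf.
Qed.

Definition rays (l : seq ((R * nat) * R)) : set (OmegaB T) :=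
  [set w | all (fun x => opath w x.1.1 x.1.2 < x.2) l].

Lemma rays_indic l (w : OmegaB T) : \1_(rays l) w = \prod_(x <- l) (opath w x.1.1 x.1.2 < x.2)%R%:R :> R.
Proof.
rewrite indicE; have -> : (w \in rays l) = all (fun x => opath w x.1.1 x.1.2 < x.2) l.
  by apply/idP/idP; rewrite inE.
elim: l => [|x l ih]; first by rewrite big_nil.
by rewrite big_cons -ih /=; case: (_ < _); rewrite ?mul1r ?mul0r.
Qed.

Lemma measurable_rays l : measurable (rays l).
Proof.
elim: l => [|x l ih].
  by rewrite (_ : rays [::] = setT)//; apply/seteqP; split.
have -> : rays (x :: l) = (fun w : OmegaB T => opath w x.1.1 x.1.2) @^-1` `]-oo, x.2[%classic `&` rays l.
  apply/seteqP; split => w; rewrite /rays/= in_itv/=.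
    by move=> /andP[? ?].
  by move=> [? ?]; apply/andP.
apply: measurableI => //; rewrite -[X in measurable X]setTI.
by apply: (eval_bmf T0 _ _).1 => //; exact: measurable_itv.
Qed.

Lemma rays_cvg l : exists L : nat -> seq ((R * nat) * (nat * nat)),
  (forall k s, all (fun x => 0 <= x.1.1 <= s) (L k) = all (fun x => 0 <= x.1.1 <= s) l) /\
  forall w, tprod (L k) w @[k --> \oo] --> (\1_(rays l) w : R).
Proof.
have /choice[pq hpq] : forall c : R, exists pq : nat -> nat * nat, forall z : R, 0 <= z <= 1 ->
    psi (pq k).1 (pq k).2 z @[k --> \oo] --> ((z < c)%R%:R : R).
  by move=> c; have [p [q h]] := ray_approx c; exists (fun k => (p k, q k)).
exists (fun k => [seq (x.1, pq x.2 k) | x <- l]); split.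
  by move=> k s; rewrite all_map; apply: eq_all.
move=> w; rewrite rays_indic; under eq_fun do rewrite /tprod big_map.
by apply: cvg_prodr => x; apply: hpq; exact: path01.
Qed.

(** A monotone class argument with weights. Weights equal to 1 give the uniqueness of laws; equal
    laws, weighted by a process at two times, give the martingale property. *)
Lemma filt_determined (P P' : probability (OmegaB T) R) (X X' : OmegaB T -> R) (s : R) :
  bmf X -> bmf X' ->
  (forall l, all (fun x => 0 <= x.1.1 <= s) l ->
     Ex P (fun w => X w * tprod l w) = Ex P' (fun w => X' w * tprod l w)) ->
  forall A, filt s A -> Ex P (fun w => X w * \1_A w) = Ex P' (fun w => X' w * \1_A w).
Proof.
move=> bX bX' hl A fA.
pose D (A : set (OmegaB T)) := measurable A /\ Ex P (fun w => X w * \1_A w) = Ex P' (fun w => X' w * \1_A w).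
pose G (A : set (OmegaB T)) := exists2 l, all (fun x => 0 <= x.1.1 <= s) l & A = rays l.
have lim (Q : probability (OmegaB T) R) (Z : OmegaB T -> R) (h : nat -> OmegaB T -> R) (f : OmegaB T -> R) :
    bmf Z -> (forall n, bmf (h n)) -> (forall n w, `|h n w| <= 1) ->
    (forall w, h n w @[n --> \oo] --> f w) ->
    Ex Q (fun w => Z w * h n w) @[n --> \oo] --> Ex Q (fun w => Z w * f w).
  move=> bZ bh h1 hf; have [mZ [M hM]] := bZ.
  apply: (Ex_cvg (M := M)) => [n|n w|w].
  - exact: bmfM.
  - by rewrite normrM -[leRHS]mulr1 ler_pM.
  - by apply: cvgM => //; exact: cvg_cst.
have DD : dynkin D.
  split.
  - split; first exact: measurableT.
    have := hl [::] isT; rewrite (_ : (fun w => X w * tprod [::] w) = (fun w => X w * \1_setT w)).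
      move=> ->; apply: eq_Ex => w; by rewrite /tprod big_nil indicT.
    by apply: funext => w; rewrite /tprod big_nil indicT.
  - move=> B [mB eB]; split; first exact: measurableC.
    have e (Q : probability (OmegaB T) R) (Z : OmegaB T -> R) : bmf Z ->
       Ex Q (fun w => Z w * \1_(~` B) w) = Ex Q Z - Ex Q (fun w => Z w * \1_B w).
      move=> bZ; rewrite -ExB//; last by apply: bmfM => //; exact: bmf_indic.
      apply: eq_Ex => w; rewrite !indicE in_setC.
      by case: (w \in B); rewrite ?mulr0 ?mulr1 ?subrr ?subr0.
    rewrite !e// eB; congr (_ - _).
    have := hl [::] isT.
    rewrite (eq_Ex P (g := X)); last by move=> w; rewrite /tprod big_nil mulr1.
    by rewrite (eq_Ex P' (g := X')) // => w; rewrite /tprod big_nil mulr1.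
  - move=> F tF DF; have mF n : measurable (F n) by case: (DF n).
    split; first exact: bigcupT_measurable.
    pose h n (w : OmegaB T) : R := \sum_(i < n) \1_(F i) w.
    have bh n : bmf (h n) by apply: bmf_sum => i; exact: bmf_indic.
    have hE n w : h n w = \1_(\big[setU/set0]_(i < n) F i) w.
      elim: n => [|n ih]; first by rewrite /h !big_ord0 indic0.
      rewrite /h !big_ord_recr/= -/(h n w) ih !indicE in_setU.
      have [wn|] := boolP (w \in F n); last by rewrite addr0 orbF.
      rewrite orbT; suff -> : (w \in \big[setU/set0]_(i < n) F i) = false by rewrite add0r.
      apply/negP; rewrite inE -(bigcup_mkord n F) => -[j /= jn Fj].
      move: wn; rewrite inE => wn.
      have := tF j n I I; rewrite /(_ !=set0) => /(_ _)/eqP.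
      by move=> jE; have : j = n by [apply: tF => //; exists w]; move=> e; rewrite e ltnn in jn.
    have h1 n w : `|h n w| <= 1.
      by rewrite hE indicE; case: (_ \in _); rewrite ?normr1 ?normr0.
    have hc w : h n w @[n --> \oo] --> (\1_(\bigcup_i F i) w : R).
      have [[j _ Fj]|nF] := pselect ((\bigcup_i F i) w).
        apply: cvg_near_cst; exists j.+1 => // n /= jn; rewrite hE !indicE.
        rewrite !mem_set//; first by exists j.
        by rewrite -(bigcup_mkord n F); exists j.
      apply: cvg_near_cst; apply: nearW => n; rewrite hE !indicE.
      rewrite !memNset// -(bigcup_mkord n F) => -[j _ Fj]; apply: nF; by exists j.
    have l1 := lim P X h _ bX bh h1 hc; have l2 := lim P' X' h _ bX' bh h1 hc.
    have e n : Ex P (fun w => X w * h n w) = Ex P' (fun w => X' w * h n w).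
      have es (Q : probability (OmegaB T) R) (Z : OmegaB T -> R) : bmf Z ->
          Ex Q (fun w => Z w * h n w) = \sum_(i < n) Ex Q (fun w => Z w * \1_(F i) w).
        move=> bZ; rewrite -Ex_sum; last by move=> i; apply: bmfM => //; exact: bmf_indic.
        by apply: eq_Ex => w; rewrite /h mulr_sumr.
      by rewrite !es//; apply: eq_bigr => i _; case: (DF i).
    exact: lim_eq e l1 l2.
(* Indicators of finite intersections of half-lines are bounded pointwise limits of test products
   observed at the same times. *)
have GD : G `<=` D.
  move=> _ [l al ->]; split; first exact: measurable_rays.
  have [L [aL hL]] := rays_cvg l.
  have b1 k w : `|tprod (L k) w| <= 1.
    by have /andP[h0 h1] := tprod01 (L k) w; rewrite ger0_norm.
  have l1 := lim P X _ _ bX (fun k => bmf_tprod (L k)) b1 hL.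
  have l2 := lim P' X' _ _ bX' (fun k => bmf_tprod (L k)) b1 hL.
  by apply: lim_eq l1 l2 => k; apply: hl; rewrite aL.
have GI : setI_closed G.
  move=> _ _ [l al ->] [l' al' ->]; exists (l ++ l'); first by rewrite all_cat al.
  by apply/seteqP; split => w; rewrite /rays/= all_cat; [move=> [-> ->]|move=> /andP[]].
suff : <<s G >> A.
  rewrite -(setI_closed_g_dynkin_g_sigma_algebra GI) => gA.
  by have [] : D A by exact: (smallest_sub DD GD).
move: A fA; apply: smallest_sub; first exact: smallest_sigma_algebra.
move=> _ [t [i [B [ts mB ->]]]].
pose S := g_sigma_algebraType G.
suff : measurable_fun setT (fun w : S => opath w t i).
  by move=> /(_ measurableT B mB); rewrite setTI.
apply: (measurability _ (RGenInftyO.measurableE R)) => // _ [_ [c ->] <-].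
rewrite setTI; apply: sub_sigma_algebra; exists [:: ((t, i), c)]; first by rewrite /= ts.
by apply/seteqP; split => w; rewrite /rays/= in_itv/= andbT.
Qed.

End test_products.

(** * Riemann sums and martingale criteria *)

Section riemann_sums.
Variables (R : realType) (T : R).
Hypothesis T0 : 0 < T.
Local Notation mu := (@lebesgue_measure R).

Definition UCT (h : R -> R) : Prop := forall e : R, 0 < e -> exists2 dl : R, 0 < dl &
  forall s t, 0 <= s <= T -> 0 <= t <= T -> `|s - t| < dl -> `|h s - h t| < e.

(** Left Riemann sum over the complete dyadic cells before [t]. The incomplete cell is dropped so
    that the sum uses grid values only and matches the grid increments of the array. *)
Definition riem (n : nat) (t : R) (h : R -> R) : R :=
  \sum_(k < idx T n t) T / 2 ^+ n * h (gridt T n k).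

(** Composing with it extends a function on [[0, T]] to a continuous function on the line, to which
    the integration lemmas apply. *)
Definition clamp (t : R) : R := Num.max 0 (Num.min t T).

Lemma clamp_in t : 0 <= clamp t <= T.
Proof. by rewrite /clamp le_max lexx/= ge_max (ltW T0)/= ge_min lexx orbT. Qed.

Lemma clamp_id t : 0 <= t <= T -> clamp t = t.
Proof. by move=> /andP[t0 tT]; rewrite /clamp (min_idPl tT) (max_idPr t0). Qed.

Lemma clamp_dist s t : `|clamp s - clamp t| <= `|s - t|.
Proof.
apply: le_trans (lip_max0 _ _) _.
rewrite /Num.min; do 2 case: ltP => ?; rewrite !ler_norml;
  have := ler_norm (s - t); have := ler_norm (t - s); rewrite (distrC t); lra.
Qed.

Section continuous_integrand.
Variable h : R -> R.
Hypothesis ch : continuous h.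

Let I (b : R) : R := Rintegral mu `[0, b]%classic h.

Lemma itv_integrable (a b : R) : mu.-integrable `[a, b]%classic (EFin \o h).
Proof.
apply: continuous_compact_integrable; first exact: segment_compact.
exact: continuous_subspaceT.
Qed.

Lemma itv_increment (a b e : R) : 0 <= a -> a <= b -> (forall u, a <= u <= b -> `|h u - h a| <= e) ->
  `|I b - I a - (b - a) * h a| <= e * (b - a).
Proof.
move=> a0 ab he.
have -> : I b - I a = Rintegral mu `]a, b]%classic h.
  apply: Rintegral_itvB; first exact: itv_integrable.
    by rewrite bnd_simp.
  by rewrite bnd_simp.
have ih : mu.-integrable `]a, b]%classic (EFin \o h).
  apply: (@integrableS _ _ _ mu `[a, b]%classic) => //; last exact: itv_integrable.
  exact: subset_itv_oc_cc.
have mab : mu `]a, b]%classic = (b - a)%:E.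
  rewrite lebesgue_measure_itv/= lte_fin; case: ltP => // ba.
  by have -> : a = b by [apply/le_anti; rewrite ab ba]; rewrite subrr.
have ic (c : R) : mu.-integrable `]a, b]%classic (EFin \o (fun=> c)).
  apply: (@integrableS _ _ _ mu `[a, b]%classic) => //; first exact: subset_itv_oc_cc.
  apply: continuous_compact_integrable; first exact: segment_compact.
  by apply: continuous_subspaceT => u; exact: cvg_cst.
have cst (c : R) : Rintegral mu `]a, b]%classic (fun=> c) = c * (b - a).
  by rewrite Rintegral_cst//= mab.
have lo : (h a - e) * (b - a) <= Rintegral mu `]a, b]%classic h.
  rewrite -cst; apply: le_Rintegral => // u /=; rewrite in_itv/= => /andP[u1 u2].
  have := he u; rewrite (ltW u1) u2 => /(_ isT); rewrite ler_norml => /andP[? ?]; lra.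
have hi : Rintegral mu `]a, b]%classic h <= (h a + e) * (b - a).
  rewrite -cst; apply: le_Rintegral => // u /=; rewrite in_itv/= => /andP[u1 u2].
  have := he u; rewrite (ltW u1) u2 => /(_ isT); rewrite ler_norml => /andP[? ?]; lra.
move: lo hi; rewrite mulrBl mulrDl (mulrC (b - a)).
move: (h a * (b - a)) (e * (b - a)) (Rintegral _ _ _) => p q J.
clear; move=> lo hi; rewrite ler_norml; apply/andP; split; lra.
Qed.

Lemma riem_close (e : R) n k : 0 <= e -> (k <= 2 ^ n)%N ->
  (forall s t, 0 <= s <= T -> 0 <= t <= T -> `|s - t| <= T / 2 ^+ n -> `|h s - h t| <= e) ->
  `|I (gridt T n k) - \sum_(j < k) T / 2 ^+ n * h (gridt T n j)| <= e * gridt T n k.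
Proof.
move=> e0; elim: k => [|k ih] kn hm.
  have -> : gridt T n 0 = 0 by rewrite /gridt mul0r mulr0.
  rewrite big_ord0 subr0 mulr0 /I.
  rewrite (_ : `[0, 0]%classic = [set 0 : R]) ?Rintegral_set1 ?normr0//.
  by rewrite set_itv1.
have k1 := ltnW kn; have {ih} := ih k1 hm.
have /andP[a0 aT] := gridt_in T0 k1; have /andP[b0 bT] := gridt_in T0 kn.
have ba : gridt T n k.+1 - gridt T n k = T / 2 ^+ n.
  by rewrite /gridt -mulrBr -mulrBl -natr1 addrAC subrr add0r mul1r.
have t0 : 0 < T / 2 ^+ n by rewrite divr_gt0// exprn_gt0.
have hab : gridt T n k <= gridt T n k.+1 by rewrite -subr_ge0 ba ltW.
have := @itv_increment _ _ e a0 hab.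
rewrite big_ord_recr/= ba => /(_ _) inc ih.
have {}inc : `|I (gridt T n k.+1) - I (gridt T n k) - T / 2 ^+ n * h (gridt T n k)| <= e * (T / 2 ^+ n).
  apply: inc => u /andP[u1 u2]; apply: hm; rewrite ?a0//.
    by rewrite (le_trans a0 u1) (le_trans u2).
  rewrite ger0_norm ?subr_ge0//; lra.
have -> : gridt T n k.+1 = gridt T n k + T / 2 ^+ n by lra.
rewrite mulrDr; set S := \sum_(_ < _) _ in ih *.
have <- : gridt T n k.+1 = gridt T n k + T / 2 ^+ n by lra.
have -> : I (gridt T n k.+1) - (S + T / 2 ^+ n * h (gridt T n k)) =
  (I (gridt T n k) - S) + (I (gridt T n k.+1) - I (gridt T n k) - T / 2 ^+ n * h (gridt T n k)) by ring.
exact: le_trans (ler_normD _ _) (lerD ih inc).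
Qed.

Lemma riem_cvg_cont t : UCT h -> 0 <= t <= T -> riem n t h @[n --> \oo] --> I t.
Proof.
move=> uh tT.
have [M hM] : exists M : R, forall u, 0 <= u <= T -> `|h u| <= M.
  have := @continuous_compact _ _ h _ (continuous_subspaceT ch) (@segment_compact R 0 T).
  move/compact_bounded => [M [_ hM]]; exists (`|M| + 1) => u uT.
  apply: (hM (`|M| + 1)); first by apply: le_lt_trans (ler_norm M) _; lra.
  by exists u => //=; rewrite in_itv.
have M0 : 0 <= M by apply: le_trans (hM _ tT).
apply/cvgrPdist_le => e e0.
(* The complete cells cost [c * T]; the incomplete one costs at most [c] for the oscillation and
   [c * M] for the dropped term. The sum is below [e]. *)
pose c := e / (2 * T + M + 2).
have d0 : 0 < 2 * T + M + 2 by lra.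
have c0 : 0 < c by rewrite divr_gt0.
pose c1 := Num.min c 1.
have c10 : 0 < c1 by rewrite lt_min c0 ltr01.
have [dl dl0 hd] := uh c1 c10.
have dl1 : 0 < Num.min dl c1 by rewrite lt_min dl0.
have [n0 hn0] : exists n0 : nat, forall n, (n0 <= n)%N -> T / 2 ^+ n < Num.min dl c1.
  have dT : 0 < Num.min dl c1 / T / 2 by rewrite !divr_gt0.
  have [K hK] := pow2N_small dT; exists K => n Kn.
  rewrite mulrC -ltr_pdivlMr//; apply: (@le_lt_trans _ _ (2 ^- K)).
    by rewrite lef_pV2 ?posrE ?exprn_gt0// ler_eXn2l// ltr1n.
  by apply: le_lt_trans hK _; rewrite ltr_pdivrMr// ltr_pMr ?divr_gt0// ltr1n.
exists n0 => // n /= /hn0; rewrite lt_min => /andP[t1 t2].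
have hm s u : 0 <= s <= T -> 0 <= u <= T -> `|s - u| <= T / 2 ^+ n -> `|h s - h u| <= c1.
  by move=> sT uT su; apply/ltW/hd => //; exact: le_lt_trans su t1.
have h1 := riem_close (ltW c10) (idx_le T0 n tT) hm.
rewrite -/(flr T n t) -/(riem n t h) in h1.
have fT := flr_in T0 n tT; have /andP[f1 f2] := flr_bounds T0 n tT; have /andP[f0 f3] := fT.
have h2 : `|I t - I (flr T n t) - (t - flr T n t) * h (flr T n t)| <= c1 * (t - flr T n t).
  apply: itv_increment => // u /andP[u1 u2]; apply: hm => //.
    by rewrite (le_trans f0 u1) (le_trans u2)//; case/andP: tT.
  by rewrite ger0_norm ?subr_ge0//; lra.
have h3 := hM _ fT.
have cc : c1 <= c by rewrite ge_min lexx.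
have cl1 : c1 <= 1 by rewrite ge_min lexx orbT.
have -> : I t - riem n t h = (I (flr T n t) - riem n t h) +
   ((I t - I (flr T n t) - (t - flr T n t) * h (flr T n t)) + (t - flr T n t) * h (flr T n t)) by ring.
apply: le_trans (ler_normD _ _) _.
have h4 : `|(t - flr T n t) * h (flr T n t)| <= c * M.
  by rewrite normrM ler_pM// ger0_norm ?subr_ge0//; lra.
have h5 : `|I (flr T n t) - riem n t h| <= c * T.
  by apply: le_trans h1 _; rewrite ler_pM// ltW.
have h6 : c1 * (t - flr T n t) <= c * 1 by rewrite ler_pM ?subr_ge0 ?(ltW c10)//; lra.
have h7 := ler_normD (I t - I (flr T n t) - (t - flr T n t) * h (flr T n t)) ((t - flr T n t) * h (flr T n t)).
have e1 : c * (2 * T + M + 2) = e by rewrite /c divfK// gt_eqF.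
have cT : 0 <= c * T by rewrite mulr_ge0 ?ltW.
by rewrite -e1; lra.
Qed.

End continuous_integrand.

Lemma riem_cvg (h : R -> R) t : UCT h -> 0 <= t <= T ->
  riem n t h @[n --> \oo] --> Rintegral mu [set u | 0 <= u <= t] h.
Proof.
move=> uh tT; pose H u := h (clamp u).
have uH : UCT H.
  move=> e e0; have [dl d0 hd] := uh e e0; exists dl => // s u sT uT su.
  by rewrite /H !clamp_id//; exact: hd.
have cH : continuous H.
  move=> s; apply/cvgrPdist_lt => e e0; have [dl d0 hd] := uh e e0.
  near=> u; apply: hd; [exact: clamp_in|exact: clamp_in|].
  by apply: le_lt_trans (clamp_dist s u) _; near: u; exact: cvgr_dist_lt.
have := riem_cvg_cont cH uH tT.
have -> : (fun n => riem n t H) = (fun n => riem n t h).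
  apply: funext => n; apply: eq_bigr => k _; congr (_ * _).
  rewrite /H clamp_id//; apply: gridt_in => //.
  by apply: leq_trans (idx_le T0 n tT); exact: ltnW.
suff -> : Rintegral mu [set u | 0 <= u <= t] h = Rintegral mu `[0, t]%classic H by [].
rewrite (_ : [set u | 0 <= u <= t] = `[0, t]%classic); last first.
  by apply/seteqP; split => u; rewrite /= in_itv.
apply: eq_Rintegral => u; rewrite inE/= in_itv/= => /andP[u0 ut].
by rewrite /H clamp_id// u0 (le_trans ut)//; case/andP: tT.
Unshelve. all: by end_near. Qed.

End riemann_sums.

Section row_functionals.
Variables (R : realType) (T : R).
Hypothesis T0 : 0 < T.

(** Common frame for the two maps through which martingale problems are read: the first coordinates,
    and the lumped coordinates, whose last entry is a tail mass. *)
Definition lip_row n (V : (nat -> R) -> 'rV[R]_n) : Prop :=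
  (forall a, in_Delta a -> rcube (V a)) /\
  (forall a b, in_Delta a -> in_Delta b -> forall j, `|V a 0 j - V b 0 j| <= ld a b).

Lemma lip_row_firstm n : lip_row (@firstm R n).
Proof.
split=> [a [a01 _] j|a b ha hb j]; first by rewrite mxE.
by rewrite !mxE; exact: ld_coord.
Qed.

Lemma lip_row_lump m : lip_row (fun a : nat -> R => firstm m.+1 (xn a m.+1)).
Proof.
have e a (j : 'I_m.+1) : firstm m.+1 (xn a m.+1) 0 j = if (j < m)%N then a j else tl a m.
  rewrite mxE /xn ltnS; case: ifP => // jm.
  by have -> : (nat_of_ord j == m.+1.-1) by rewrite /= eqn_leq -ltnS ltn_ord leqNgt jm.
split=> [a ha j|a b ha hb j]; rewrite !e; case: ifP => jm.
- by case: ha => /(_ j).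
- exact: tl_le1.
- exact: ld_coord.
- exact: tl_dist.
Qed.

Variables (n : nat) (V : (nat -> R) -> 'rV[R]_n).
Hypothesis lV : lip_row V.

Lemma row_fun_bound (rho : 'rV[R]_n -> R) : continuous rho ->
  exists2 M : R, 0 <= M & forall (w : Omega T) t, 0 <= t <= T -> `|rho (V (opath w t))| <= M.
Proof.
move=> cr; have [M M0 hM] := row_bounded cr; exists M => // w t tT.
by apply: hM; apply: lV.1; exact: path_Delta.
Qed.

Lemma row_fun_bmf (rho : 'rV[R]_n -> R) t : continuous rho -> 0 <= t <= T ->
  bmf (fun w : OmegaB T => rho (V (opath w t))).
Proof.
move=> cr tT; split; last by have [M _ hM] := row_fun_bound cr; exists M => w; exact: hM.
apply: continuous_measurable => w e e0; have [dl d0 hd] := row_unif_cont cr e0.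
exists dl => // v hv; rewrite distrC; apply: hd; first by apply: lV.1; exact: path_Delta.
move=> j; apply: le_lt_trans hv; apply: le_trans (dist_ge w v tT).
by apply: lV.2; exact: path_Delta.
Qed.

Lemma row_fun_UCT (rho : 'rV[R]_n -> R) (w : Omega T) : continuous rho ->
  UCT T (fun u => rho (V (opath w u))).
Proof.
move=> cr e e0; have [dl d0 hd] := row_unif_cont cr e0.
have [dl' d0' hd'] := path_unif_cont w d0; exists dl' => // s t sT tT st.
apply: hd; first by apply: lV.1; exact: path_Delta.
by move=> j; apply: le_lt_trans (hd' _ _ sT tT st); apply: lV.2; exact: path_Delta.
Qed.

Lemma riem_bmf (rho : 'rV[R]_n -> R) k t : continuous rho -> 0 <= t <= T ->
  bmf (fun w : OmegaB T => riem T k t (fun u => rho (V (opath w u)))).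
Proof.
move=> cr tT; rewrite /riem.
have -> : (fun w : OmegaB T => \sum_(i < idx T k t) T / 2 ^+ k * rho (V (opath w (gridt T k i)))) =
   (fun w => \sum_(i < idx T k t) T / 2 ^+ k * (if (i <= 2 ^ k)%N then rho (V (opath w (gridt T k i))) else 0)).
  apply: funext => w; apply: eq_bigr => i _; case: ifP => // /negbT/negP[].
  by apply: leq_trans (idx_le T0 k tT); exact: ltnW.
apply: bmf_sum => i; apply: bmfZ; have [ik|ik] := boolP (i <= 2 ^ k)%N; last exact: bmf_cst.
by apply: row_fun_bmf => //; exact: gridt_in.
Qed.

Lemma riem_bound (h : R -> R) (M : R) k t : 0 <= M -> (forall u, 0 <= u <= T -> `|h u| <= M) -> 0 <= t <= T ->
  `|riem T k t h| <= T * M.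
Proof.
move=> M0 hM tT; apply: le_trans (ler_norm_sum _ _ _) _.
have p : 0 < (2 : R) ^+ k by rewrite exprn_gt0.
have il := idx_le T0 k tT.
apply: (@le_trans _ _ (\sum_(i < idx T k t) T / 2 ^+ k * M)).
  apply: ler_sum => i _; rewrite normrM ger0_norm; last by apply: divr_ge0; exact: ltW.
  apply: ler_wpM2l; first by apply: divr_ge0; exact: ltW.
  by apply: hM; apply: gridt_in => //; apply: leq_trans il; exact: ltnW.
rewrite sumr_const card_ord -[leLHS]mulr_natl mulrA ler_wpM2r// mulrCA ler_piMr ?(ltW T0)//.
by rewrite ler_pdivrMr// mul1r -natrX ler_nat.
Qed.

Variables (g rho : 'rV[R]_n -> R).
Hypotheses (cg : continuous g) (cr : continuous rho).

Definition Mf (t : R) (w : OmegaB T) : R := g (V (opath w t)) -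
  Rintegral lebesgue_measure [set u | 0 <= u <= t] (fun u => rho (V (opath w u))).

Definition Mr (k : nat) (t : R) (w : OmegaB T) : R := g (V (opath w t)) -
  riem T k t (fun u => rho (V (opath w u))).

Lemma Mr_cvg t w : 0 <= t <= T -> Mr k t w @[k --> \oo] --> Mf t w.
Proof.
move=> tT; apply: cvgB; first exact: cvg_cst.
by apply: riem_cvg => //; exact: row_fun_UCT.
Qed.

Lemma Mr_bound : exists M : R, forall k t w, 0 <= t <= T -> `|Mr k t w| <= M.
Proof.
have [M M0 hM] := row_fun_bound cg; have [N N0 hN] := row_fun_bound cr.
exists (M + T * N) => k t w tT; apply: le_trans (ler_normB _ _) _; apply: lerD; first exact: hM.
by apply: riem_bound => // u uT; exact: hN.
Qed.

Lemma Mr_bmf k t : 0 <= t <= T -> bmf (Mr k t).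
Proof. by move=> tT; apply: bmfB; [exact: row_fun_bmf|exact: riem_bmf]. Qed.

Lemma Mf_bmf t : 0 <= t <= T -> bmf (Mf t).
Proof.
move=> tT; have [M hM] := Mr_bound.
apply: (bmf_lim (h := fun k => Mr k t) (M := M)) => [k|k w|w]; first exact: Mr_bmf.
  exact: hM.
exact: Mr_cvg.
Qed.

End row_functionals.

(** * Stopped paths and adapted functionals *)

Section stopping.
Variables (R : realType) (T : R).
Hypothesis T0 : 0 < T.

Definition stopped (t : R) (w : R -> nat -> R) (s : R) : nat -> R :=
  if 0 <= s <= T then w (Num.min s t) else fun=> 0.

Lemma stop_in t s : 0 <= t <= T -> 0 <= s <= T -> 0 <= Num.min s t <= T.
Proof.
by move=> /andP[t0 tT] /andP[s0 sT]; rewrite le_min s0 t0/= ge_min sT.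
Qed.

Lemma stopped_path t (w : Omega T) : 0 <= t <= T -> is_path T (stopped t (opath w)).
Proof.
move=> tT; split.
- by move=> s sT; rewrite /stopped sT; apply: path_Delta; exact: stop_in.
- by move=> s sT; rewrite /stopped; case: ifP.
- move=> s sT e e0; have [dl d0 hd] := path_cont w (stop_in tT sT) e0.
  exists dl => // u uT us; rewrite /stopped sT uT; apply: hd; first exact: stop_in.
  apply: le_lt_trans us; rewrite /Num.min; do 2 case: ltP => ?; rewrite !ler_norml;
    have := ler_norm (u - s); have := ler_norm (s - u); rewrite (distrC s); lra.
Qed.

Definition stop (t : R) (tT : 0 <= t <= T) (w : OmegaB T) : OmegaB T := MkOmega (stopped_path w tT).

Lemma stop_eval t (tT : 0 <= t <= T) w s : 0 <= s <= t -> opath (stop tT w) s = opath w s.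
Proof.
move=> /andP[s0 st]; rewrite /= /stopped; have -> : 0 <= s <= T by rewrite s0 (le_trans st)//; case/andP: tT.
by rewrite (min_idPl st).
Qed.

Lemma stop_measurable t (tT : 0 <= t <= T) : measurable_fun setT (stop tT : FT T t -> OmegaB T).
Proof.
apply: measurable_to_Omega => // s i sT; rewrite /= /stopped sT.
apply: eval_FT; case/andP: (sT) => s0 _; case/andP: (tT) => t0 _.
by rewrite le_min s0 t0/= ge_min lexx orbT.
Qed.

(** A functional of the path up to [t] factors through [stop], which is measurable from the
    sigma-algebra at time [t] to the Borel sets. Borel measurability thus implies adaptedness. *)
Lemma adapted_filt t (F : OmegaB T -> R) : 0 <= t <= T -> measurable_fun setT F ->
  (forall w v, (forall s, 0 <= s <= t -> opath w s = opath v s) -> F w = F v) ->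
  forall B : set R, measurable B -> filt t (F @^-1` B).
Proof.
move=> tT mF hF B mB.
have e : F = F \o stop tT by apply: funext => w; apply: hF => s st; rewrite stop_eval.
rewrite e comp_preimage.
have := mF measurableT B mB; rewrite setTI => mFB.
by have := stop_measurable tT measurableT mFB; rewrite setTI.
Qed.

End stopping.

Section martingale_tests.
Variables (R : realType) (T : R).
Hypothesis T0 : 0 < T.
Variables (n : nat) (V : (nat -> R) -> 'rV[R]_n) (g rho : 'rV[R]_n -> R).
Hypotheses (lV : lip_row V) (cg : continuous g) (cr : continuous rho).

Lemma Mf_filt t : 0 <= t <= T -> forall B : set R, measurable B -> filt t (Mf (T := T) V g rho t @^-1` B).
Proof.
move=> tT; apply: adapted_filt => //; first exact: (Mf_bmf T0 lV cg cr tT).1.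
move=> w v wv; rewrite /Mf wv ?lexx ?andbT//; last by case/andP: tT.
congr (_ - _); apply: eq_Rintegral => u; rewrite inE/= => /wv -> //.
Qed.

Lemma martingale_of_tests (P : probability (OmegaB T) R) :
  (forall s t l, 0 <= s -> s <= t -> t <= T -> all (fun x => 0 <= x.1.1 <= s) l ->
     Ex P (fun w => Mf V g rho t w * tprod l w) = Ex P (fun w => Mf V g rho s w * tprod l w)) ->
  is_martingale P (Mf V g rho).
Proof.
move=> h; split=> [t tT|s t s0 st tT A fA].
  by split; [exact: Mf_filt|apply: bmf_integrable; exact: Mf_bmf].
have sT : 0 <= s <= T by rewrite s0 (le_trans st).
have tT' : 0 <= t <= T by rewrite (le_trans s0 st).
rewrite !Rintegral_Ex.
have := @filt_determined _ _ T0 P P (Mf V g rho t) (Mf V g rho s) s (Mf_bmf T0 lV cg cr tT') (Mf_bmf T0 lV cg cr sT).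
move=> /(_ _ A fA) hA; under eq_fun do rewrite mulrC; rewrite hA.
  by apply: eq_Ex => w; rewrite mulrC.
by move=> l; exact: h.
Qed.

(** The definition of martingale tests against indicators. Here [a] is rounded down to multiples of
    [1 / (k + 1)] and the result is written as an average of indicators of its superlevel sets. *)
Lemma martingale_test (P : probability (OmegaB T) R) (a : OmegaB T -> R) s t :
  is_martingale P (Mf V g rho) -> 0 <= s -> s <= t -> t <= T ->
  (forall w, 0 <= a w <= 1) -> (forall B : set R, measurable B -> filt s (a @^-1` B)) ->
  Ex P (fun w => a w * Mf V g rho t w) = Ex P (fun w => a w * Mf V g rho s w).
Proof.
move=> [_ hM] s0 st tT a01 fa.
have sT : 0 <= s <= T by rewrite s0 (le_trans st).
have tT' : 0 <= t <= T by rewrite (le_trans s0 st).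
have bs := Mf_bmf T0 lV cg cr sT; have bt := Mf_bmf T0 lV cg cr tT'.
pose S k j : set (OmegaB T) := a @^-1` `[(j.+1%:R / k.+1%:R), +oo[%classic.
have fS k j : filt s (S k j) by apply: fa; exact: measurable_itv.
have mS k j : measurable (S k j) by exact: filt_measurable (fS k j).
pose h (k : nat) (w : OmegaB T) : R := \sum_(j < k.+1) k.+1%:R^-1 * \1_(S k j) w.
have bh k : bmf (h k) by apply: bmf_sum => j; apply: bmfZ; exact: bmf_indic.
have hE k w : h k w = k.+1%:R^-1 * (Num.truncn (k.+1%:R * a w))%:R.
  rewrite /h -mulr_sumr; congr (_ * _).
  have /andP[a0 a1] := a01 w; have k0 : (0 : R) < k.+1%:R by [].
  set N := Num.truncn _; have Nk : (N <= k.+1)%N.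
    rewrite -(ler_nat R); apply: (@le_trans _ _ (k.+1%:R * a w)); last by rewrite ler_piMr// ltW.
    by rewrite truncn_le mulr_ge0// ltW.
  transitivity (\sum_(j < k.+1) (if (j < N)%N then 1 else 0 : R)).
    apply: eq_bigr => j _; rewrite indicE.
    have -> : (w \in S k j) = (j < N)%N; last by case: (_ < _)%N.
    rewrite /N truncn_gt_nat; apply/idP/idP.
      by rewrite inE /S /= in_itv/= andbT ler_pdivrMr// mulrC.
    by move=> hj; rewrite inE /S /= in_itv/= andbT ler_pdivrMr// mulrC.
  rewrite -big_mkcond/= (eq_bigl (fun j : 'I_k.+1 => (j < N)%N))//.
  by rewrite -(big_ord_widen _ (fun=> 1 : R) Nk) sumr_const card_ord.
have hd k w : `|h k w - a w| <= k.+1%:R^-1.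
  have /andP[a0 a1] := a01 w; have k0 : (0 : R) < k.+1%:R by [].
  have /truncn_itv/andP[t1 t2] : 0 <= k.+1%:R * a w by rewrite mulr_ge0// ltW.
  rewrite hE; set y := k.+1%:R * a w in t1 t2 *; set m := Num.truncn y in t1 t2 *.
  rewrite -[m.+1%:R]natr1 in t2.
  have -> : k.+1%:R^-1 * m%:R - a w = k.+1%:R^-1 * (m%:R - y).
    by rewrite mulrBr [_ * y]mulrA mulVf ?mul1r.
  rewrite normrM gtr0_norm ?invr_gt0// ler_piMr ?invr_ge0// ler_norml.
  by apply/andP; split; lra.
have hc w : h k w @[k --> \oo] --> a w.
  apply/cvgrPdist_le => e e0; exists (Num.bound e^-1) => // k /= hk.
  rewrite distrC; apply: le_trans (hd k w) _.
  rewrite -[leRHS]invrK lef_pV2 ?posrE ?invr_gt0//.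
  apply: ltW; apply: lt_le_trans (archi_boundP _) _; first by rewrite invr_ge0 ltW.
  by rewrite ler_nat (leq_trans hk).
have h1 k w : `|h k w| <= 2.
  rewrite -[h k w](subrK (a w)); apply: le_trans (ler_normD _ _) _.
  have := hd k w; have /andP[a0 a1] := a01 w; rewrite (ger0_norm a0).
  have : k.+1%:R^-1 <= 1 :> R by rewrite invf_le1// ler1n.
  by move=> h2 h3; have := le_trans h3 h2; lra.
have lim (X : OmegaB T -> R) : bmf X ->
   Ex P (fun w => h k w * X w) @[k --> \oo] --> Ex P (fun w => a w * X w).
  move=> bX; have [_ [M hX]] := bX; apply: (Ex_cvg (M := 2 * M)) => [k|k w|w].
  - exact: bmfM.
  - by rewrite normrM ler_pM.
  - by apply: cvgM => //; exact: cvg_cst.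
apply: lim_eq (lim _ bt) (lim _ bs) => k.
have e (X : OmegaB T -> R) : bmf X -> Ex P (fun w => h k w * X w) =
   \sum_(j < k.+1) k.+1%:R^-1 * Rintegral P (S k j) X.
  move=> bX; rewrite (eq_bigr (fun j : 'I_k.+1 => Ex P (fun w => k.+1%:R^-1 * \1_(S k j) w * X w))).
    rewrite -Ex_sum; last by move=> j; apply: bmfM => //; apply: bmfZ; exact: bmf_indic.
    by apply: eq_Ex => w; rewrite /h mulr_suml.
  move=> j _; rewrite Rintegral_Ex -ExZ; last by apply: bmfM => //; exact: bmf_indic.
  by apply: eq_Ex => w; rewrite mulrA.
apply: etrans (e _ bt) (etrans _ (esym (e _ bs))).
apply: eq_bigr => j _.
apply: (congr1 ( *%R _)).
exact: (hM s t s0 st tT _ (fS k j)).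
Qed.

End martingale_tests.

(** * The limit law *)

Section approximating_chains.
Variables (R : realType) (alpha : nat -> R) (ainf : R) (x : nat -> R) (T : R).
Hypothesis alpha0 : summable alpha.
Hypothesis ainf0 : 0 <= ainf.
Hypothesis sx : summable x.
Hypothesis x1 : tl x 0 <= 1.
Hypothesis T0 : 0 < T.

Local Notation A := (tl alpha 0).

(** Solves [tstep = T / 2^N] in dimension [N.+1], so that the times of the chain are the dyadic
    times of level [N]. *)
Definition dlt (N : nat) : R := Num.sqrt (2 * N.+1%:R * T / 2 ^+ N).

Definition alN (N : nat) : nat -> R := alphan alpha N.+1.

Definition xN (N : nat) : nat -> R := xn x N.+1.

Definition tau (n : nat) : R := T / 2 ^+ n.

Lemma tau_gt0 n : 0 < tau n. Proof. by rewrite divr_gt0// exprn_gt0. Qed.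

Lemma eta_dlt N : eta (dlt N) = N.+1%:R * T / 2 ^+ N.
Proof.
rewrite etaE /dlt sqr_sqrtr; last by rewrite !mulr_ge0// ?invr_ge0 ?exprn_ge0// ltW.
by have : (2 : R) ^+ N != 0 by []; move=> ?; field.
Qed.

Lemma tstep_dlt N : tstep N (dlt N) = tau N.
Proof.
by rewrite /tstep eta_dlt /tau mulrAC (mulrC N.+1%:R) mulfK.
Qed.

Lemma dlt_ge0 N : 0 <= dlt N. Proof. exact: sqrtr_ge0. Qed.

(** Ensures [eta (dlt N) -> 0] although the dimension grows with [N]. *)
Lemma expn2_sqr N : (N.+1 ^ 2 <= 4 * 2 ^ N)%N.
Proof.
suff h k : (k.+3 ^ 2 <= 4 * 2 ^ k.+2)%N by case: N => [|[|k]].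
elim: k => // k ih; rewrite [(2 ^ k.+3)%N]expnS mulnCA.
by apply: leq_trans (_ : (2 * k.+3 ^ 2 <= _)%N); [rewrite -!mulnn; nia|rewrite leq_mul2l].
Qed.

Lemma eta_dlt_le N : eta (dlt N) <= 4 * T / N.+1%:R.
Proof.
rewrite eta_dlt ler_pdivrMr ?exprn_gt0// mulrAC ler_pdivlMr// mulrAC.
rewrite [4 * T]mulrC -[T * 4 * _]mulrA [leRHS]mulrC ler_wpM2r ?(ltW T0)//.
have := expn2_sqr N; rewrite -(ler_nat R) natrM !natrX expr2.
by [].
Qed.

Lemma dlt_small (e : R) : 0 < e -> exists N0 : nat, forall N, (N0 <= N)%N ->
  dlt N < e /\ eta (dlt N) < e.
Proof.
move=> e0; pose c := Num.min e (e ^+ 2 / 2).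
have c0 : 0 < c by rewrite lt_min e0 divr_gt0// exprn_gt0.
exists (Num.bound (c^-1 * (4 * T))) => N hN.
have h : eta (dlt N) < c.
  apply: le_lt_trans (eta_dlt_le N) _; rewrite ltr_pdivrMr// -ltr_pdivrMl//.
  apply: lt_le_trans (archi_boundP _) _.
    by apply: mulr_ge0; [rewrite invr_ge0 ltW|apply: mulr_ge0 => //; exact: ltW].
  by rewrite ler_nat (leq_trans hN).
move: h; rewrite lt_min => /andP[h1 h2]; split => //.
have : dlt N ^+ 2 < e ^+ 2 by move: h2; rewrite etaE ltr_pM2r ?invr_gt0.
by rewrite ltr_pXn2r ?nnegrE ?dlt_ge0 ?(ltW e0).
Qed.

Lemma alN_ge0 N i : 0 <= alN N i. Proof. exact: alphan_ge0. Qed.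

Lemma alN_sum N : \sum_(i < N.+1) alN N i <= A.
Proof. by rewrite -(big_mkord xpredT) -[\sum_(_ <= _ < _) _]/(ysum N 0 (alN N)) ysum_alphan. Qed.

Lemma xN_state N : is_state N (xN N).
Proof. by split => [i|]; [exact: xn_ge0|rewrite ysum_xn]. Qed.

Lemma A0 : 0 <= A. Proof. exact: tl_ge0. Qed.

Lemma kappa_small (e : R) : 0 < e -> exists N0 : nat, forall N, (N0 <= N)%N ->
  kappa ainf A (dlt N) < e /\ eta (dlt N) < e.
Proof.
move=> e0; set B := driftB ainf A.
have B0 : 0 <= B by rewrite addr_ge0// A0.
have e1 : 0 < Num.min (e / 2) (e / 2 / (B + 1)).
  by rewrite lt_min !divr_gt0// ltr_wpDl.
have [N0 hN] := dlt_small e1; exists N0 => N /hN; rewrite !lt_min.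
move=> [/andP[h1 _] /andP[h2 h3]]; split; last by lra.
rewrite /kappa -/B [e]splitr ltrD//.
apply: le_lt_trans (_ : eta (dlt N) * (B + 1) < _).
  by rewrite ler_wpM2l ?eta_ge0 ?dlt_ge0// lerDl.
by rewrite -ltr_pdivlMr// ltr_wpDl.
Qed.

Definition code (m n k : nat) : nat := pickle (m, (n, k)).

(** The observations of the [N]-th chain as one point of the cube, an index having the same meaning
    for all [N]. Entries finer than the grid of the chain are 0, so each admissible index is
    meaningful from some [N] on. *)
Definition obs (N : nat) (tr : nat -> nat -> R) (c : nat) : R :=
  if @unpickle (nat * (nat * nat))%type c is Some (m, (n, k)) then
    if (n <= N)%N && (k <= 2 ^ n)%N then ysum N m (tr (k * 2 ^ (N - n))%N) else 0
  else 0.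

Lemma obsE N tr m n k : (n <= N)%N -> (k <= 2 ^ n)%N ->
  obs N tr (code m n k) = ysum N m (tr (k * 2 ^ (N - n))%N).
Proof. by move=> nN kn; rewrite /obs pickleK nN kn. Qed.

Lemma obs_cube N tr : (forall j, is_state N (tr j)) -> cube (obs N tr).
Proof.
move=> st c; rewrite /obs; case: unpickle => [[m [n k]]|]; last by rewrite lexx ler01.
case: ifP => _; last by rewrite lexx ler01.
by rewrite ysum_le1// andbT ysum_ge0//; case: (st (k * 2 ^ (N - n))%N).
Qed.

Definition EN (N : nat) (F : (nat -> R) -> R) : R :=
  traj N (alN N) ainf (dlt N) (2 ^ N) (fun tr => F (obs N tr)) (xN N).

Definition small_step (N : nat) : Prop := dlt N + eta (dlt N) * driftB ainf A <= 1.

Lemma EN_mean N : small_step N -> is_mean (EN N).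
Proof.
move=> hN; split.
- by move=> f g; rewrite /EN trajD.
- by move=> c f; rewrite /EN trajZ.
- move=> f g fg; rewrite /EN; apply: (traj_le (@alN_ge0 N) (@alN_sum N) ainf0 (dlt_ge0 N) hN _ (xN_state N)).
  by move=> tr st; apply/fg/obs_cube.
- exact: traj_cst.
Qed.

Lemma EN_le N F (M : R) : small_step N ->
  (forall tr, (forall j, is_state N (tr j)) -> F (obs N tr) <= M) -> EN N F <= M.
Proof.
move=> hN h; rewrite /EN -(traj_cst N (alN N) ainf (dlt N) (2 ^ N) M (xN N)).
exact: (traj_le (@alN_ge0 N) (@alN_sum N) ainf0 (dlt_ge0 N) hN _ (xN_state N)).
Qed.

(** Equals coordinate [i] on observations of a chain. [Num.max 0] keeps it in [[0, 1]] on the whole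
    cube, where tail masses need not be ordered. *)
Definition dif (y : nat -> R) i n k : R :=
  Num.max 0 (y (code i n k) - y (code i.+1 n k)).

Definition rowY m n k (y : nat -> R) : 'rV[R]_m.+1 :=
  \row_(j < m.+1) if (j < m)%N then dif y j n k else y (code m n k).

Definition test (n : nat) (s : seq (nat * nat * (nat * nat))) (y : nat -> R) : R :=
  \prod_(l <- s) psi l.2.1 l.2.2 (dif y l.1.1 n l.1.2).

Lemma dif01 y i n k : cube y -> 0 <= dif y i n k <= 1.
Proof.
move=> cy; rewrite /dif le_max lexx/= ge_max ler01/=.
by case/andP: (cy (code i n k)) => ? ?; case/andP: (cy (code i.+1 n k)) => ? ?; lra.
Qed.

Lemma test01 n s y : cube y -> 0 <= test n s y <= 1.
Proof.
move=> cy; rewrite /test; elim: s => [|l s ih]; first by rewrite big_nil ler01 lexx.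
rewrite big_cons; have /andP[p0 p1] := psi01 l.2.1 l.2.2 (dif01 l.1.1 n l.1.2 cy).
by case/andP: ih => i0 i1; rewrite mulr_ge0//= mulr_ile1.
Qed.

Lemma UCb_dif i n k : UCb (fun y => dif y i n k).
Proof. by apply: UCb_max0; apply: UCbB; exact: UCb_coord. Qed.

Lemma UCb_test n s : UCb (test n s).
Proof.
by apply: UCb_prod => l; apply: UCbX; apply: UCbB; [exact: UCb_cst|apply: UCbX; exact: UCb_dif].
Qed.

Lemma rcube_rowY m n k y : cube y -> rcube (rowY m n k y).
Proof. by move=> cy j; rewrite mxE; case: ifP => _; [exact: dif01|exact: cy]. Qed.

Lemma UCb_rowY m n k (g : 'rV[R]_m.+1 -> R) : continuous g -> UCb (fun y => g (rowY m n k y)).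
Proof.
move=> cg; apply: UCb_row => // [j|y]; last exact: rcube_rowY.
under eq_fun do rewrite mxE.
by case: (j < m)%N; [exact: UCb_dif|exact: UCb_coord].
Qed.

Lemma dif_obs N tr i n k : (forall j, is_state N (tr j)) -> (n <= N)%N -> (k <= 2 ^ n)%N -> (i < N.+1)%N ->
  dif (obs N tr) i n k = tr (k * 2 ^ (N - n))%N i.
Proof.
move=> st nN kn iN; rewrite /dif !obsE// !ysumE (big_ltn iN) addrK.
by apply/max_idPr; case: (st (k * 2 ^ (N - n))%N).
Qed.

Lemma rowY_obs N tr m n k : (forall j, is_state N (tr j)) -> (n <= N)%N -> (k <= 2 ^ n)%N -> (m <= N)%N ->
  rowY m n k (obs N tr) = lump N m (tr (k * 2 ^ (N - n))%N).
Proof.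
move=> st nN kn mN; apply/rowP => j; rewrite !mxE; case: ifP => jm.
  by rewrite dif_obs// ltnS (leq_trans (ltnW jm)).
by rewrite obsE.
Qed.

Lemma small_eventually : exists N0 : nat, forall N, (N0 <= N)%N -> small_step N.
Proof.
have [N0 h] := kappa_small (@ltr01 R); exists N0 => N /h[h1 _].
by rewrite /small_step ltW.
Qed.

Lemma step_mul n N : (n <= N)%N -> (2 ^ (N - n))%:R * tstep N (dlt N) = tau n.
Proof.
move=> nN; rewrite tstep_dlt /tau natrX mulrCA; congr (_ * _).
have -> : (2 : R) ^+ N = 2 ^+ (N - n) * 2 ^+ n by rewrite -exprD subnK.
by rewrite invfM mulrA mulfV ?mul1r.
Qed.

Lemma step_index n N k : (n <= N)%N -> (k < 2 ^ n)%N ->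
  (k.+1 * 2 ^ (N - n) = k * 2 ^ (N - n) + 2 ^ (N - n))%N /\
  (k * 2 ^ (N - n) + 2 ^ (N - n) <= 2 ^ N)%N.
Proof.
move=> nN kn; rewrite mulSn addnC; split => //.
rewrite addnC -mulSn; have -> : (2 ^ N = 2 ^ n * 2 ^ (N - n))%N by rewrite -expnD subnKC.
by rewrite leq_mul2r kn orbT.
Qed.

Definition quartC m : R := Cpow4 ainf A * (Csqr ainf * (tl x m + (1 + 2 * T) * tl alpha m)).

Lemma EN_increment4 m n k (e : R) : (k < 2 ^ n)%N -> 0 < e ->
  exists N0 : nat, forall N, (N0 <= N)%N -> small_step N /\
   EN N (fun y => (y (code m n k.+1) - y (code m n k)) ^+ 4) <= quartC m * tau n ^+ 2 + e.
Proof.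
move=> kn e0; have [N1 h1] := small_eventually.
have C40 : 0 <= Cpow4 ainf A by rewrite /Cpow4 addr_ge0// mulr_ge0// addr_ge0// A0.
have t0 := tau_gt0 n.
(* With [kappa] below 1 and below this quotient, the [kappa ^+ 2] term of the fourth moment bound is
   at most [e]. *)
pose e' := Num.min 1 (e / (tau n * Cpow4 ainf A + 1)).
have d0 : 0 < tau n * Cpow4 ainf A + 1 by rewrite ltr_wpDl// mulr_ge0// ltW.
have e'0 : 0 < e' by rewrite lt_min ltr01 divr_gt0.
have [N2 h2] := kappa_small e'0.
exists (maxn (maxn N1 N2) (maxn n m)) => N; rewrite !geq_max => /andP[/andP[n1 n2] /andP[nN mN]].
have sN := h1 _ n1; split=> //; have [k2 _] := h2 _ n2.
have kap0 : 0 <= kappa ainf A (dlt N).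
  by rewrite addr_ge0 ?dlt_ge0// mulr_ge0 ?eta_ge0 ?dlt_ge0// addr_ge0// A0.
have [ik iK] := step_index nN kn.
have -> : EN N (fun y => (y (code m n k.+1) - y (code m n k)) ^+ 4) =
   traj N (alN N) ainf (dlt N) (2 ^ N) (fun tr => (ysum N m (tr (k * 2 ^ (N - n) + 2 ^ (N - n))%N)
     - ysum N m (tr (k * 2 ^ (N - n))%N)) ^+ 4) (xN N).
  congr (traj _ _ _ _ _ _ _); apply: funext => tr.
  by rewrite !obsE// ?(ltnW kn)// ik.
have tT : tau n <= T by rewrite /tau ler_pdivrMr ?exprn_gt0// ler_peMr ?(ltW T0)// exprn_ege1// ler1n.
apply: le_trans (traj_increment4 (@alN_ge0 N) (@alN_sum N) ainf0 (dlt_ge0 N) sN m iK (xN_state N) (S := T) _ _) _.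
- by rewrite step_mul.
- apply: le_trans (_ : (2 ^ N)%:R * tstep N (dlt N) <= _).
    by rewrite ler_wpM2r ?tstep_ge0 ?dlt_ge0// ler_nat (leq_trans _ iK)// leq_addr.
  by have := step_mul (leq0n N); rewrite subn0 => ->; rewrite /tau expr0 divr1.
rewrite step_mul// ysum_xn// ysum_alphan//.
apply: (@le_trans _ _ (quartC m * tau n ^+ 2 + tau n * Cpow4 ainf A * kappa ainf A (dlt N) ^+ 2)).
  by rewrite /quartC le_eqVlt; apply/orP; left; apply/eqP; ring.
rewrite lerD2l; move: k2; rewrite lt_min => /andP[k1 k2].
apply: (@le_trans _ _ (tau n * Cpow4 ainf A * kappa ainf A (dlt N))).
  apply: ler_wpM2l; first by apply: mulr_ge0 => //; exact: ltW.
  by rewrite expr2 ler_piMl// ltW.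
apply: (@le_trans _ _ ((tau n * Cpow4 ainf A + 1) * kappa ainf A (dlt N))).
  by rewrite ler_wpM2r// lerDl.
by rewrite mulrC -ler_pdivlMr// ltW.
Qed.

(** [n0] depends on [g] and [e] only, and the bound is uniform in the cell [k] and in the test, so
    the errors of all [2 ^ n] cells add up to at most [T * e]. The dimension [N] goes to infinity
    with [n] fixed. *)
Lemma EN_generator m (g : 'rV[R]_m.+1 -> R) (e : R) : C2 g -> 0 < e ->
  exists n0 : nat, forall n, (n0 <= n)%N -> exists N0 : nat, forall N, (N0 <= N)%N ->
   small_step N /\ forall k s, (k < 2 ^ n)%N -> all (fun l => l.1.2 <= k)%N s ->
   `|EN N (fun y => test n s y * (g (rowY m n k.+1 y) - g (rowY m n k y) -
      tau n * genL (alphan alpha m.+1) ainf g (rowY m n k y)))| <= tau n * e.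
Proof.
move=> cg e0; have [dl dl0 hd] := chain_generator (alphan alpha m.+1) ainf0 A0 cg e0.
have [n0 hn0] : exists n0 : nat, forall n, (n0 <= n)%N -> tau n < dl.
  have dT : 0 < dl / T / 2 by rewrite !divr_gt0.
  have [K hK] := pow2N_small dT; exists K => n Kn.
  rewrite /tau mulrC -ltr_pdivlMr//; apply: le_lt_trans (_ : 2 ^- K < _).
    by rewrite lef_pV2 ?posrE ?exprn_gt0// ler_eXn2l// ltr1n.
  by apply: le_lt_trans hK _; rewrite ltr_pdivrMr// ltr_pMr ?divr_gt0// ltr1n.
exists n0 => n /hn0 tn; have [N1 h1] := small_eventually.
have [N2 h2] := kappa_small dl0.
exists (maxn (maxn N1 N2) (maxn n m)) => N; rewrite !geq_max => /andP[/andP[n1 n2] /andP[nN mN]].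
have sN := h1 _ n1; split=> // k s kn sk; have [k2 et] := h2 _ n2.
have [ik iK] := step_index nN kn.
have hl j : (j <= m)%N -> lump_al N (alN N) m j = alphan alpha m.+1 j.
  move=> jm; rewrite /lump_al /alphan ltnS; case: ifP => jm'.
    by rewrite /alN /alphan ltnS (leq_trans jm').
  exact: ysum_alphan.
have gen y : is_state N y ->
    `|iterQ N (alN N) ainf (dlt N) (2 ^ (N - n)) (fun y => g (lump N m y)) y - g (lump N m y) -
      tau n * genL (alphan alpha m.+1) ainf g (lump N m y)| <= tau n * e.
  move=> sy; have tn' : (2 ^ (N - n))%:R * tstep N (dlt N) < dl by rewrite step_mul.
  have := hd N (alN N) (dlt N) (@alN_ge0 N) (@alN_sum N) (dlt_ge0 N) sN mN hl k2 et _ _ sy tn'.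
  by rewrite step_mul.
pose a (tr : nat -> nat -> R) := \prod_(l <- s) psi l.2.1 l.2.2
  (Num.max 0 (ysum N l.1.1 (tr (l.1.2 * 2 ^ (N - n))%N) - ysum N l.1.1.+1 (tr (l.1.2 * 2 ^ (N - n))%N))).
have aE tr : a tr = test n s (obs N tr).
  apply: eq_big_seq => l ls; have lk := allP sk _ ls.
  by rewrite /dif !obsE// (leq_trans lk)// ltnW.
have -> : EN N (fun y => test n s y * (g (rowY m n k.+1 y) - g (rowY m n k y) -
      tau n * genL (alphan alpha m.+1) ainf g (rowY m n k y))) =
  traj N (alN N) ainf (dlt N) (2 ^ N) (fun tr => a tr * (g (lump N m (tr (k * 2 ^ (N - n) + 2 ^ (N - n))%N)) -
    g (lump N m (tr (k * 2 ^ (N - n))%N)) - tau n * genL (alphan alpha m.+1) ainf g (lump N m (tr (k * 2 ^ (N - n))%N)))) (xN N).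
  apply/eqP; rewrite eq_le; apply/andP; split; apply: (traj_le (@alN_ge0 N) (@alN_sum N) ainf0 (dlt_ge0 N) sN _ (xN_state N)) => tr st;
    by rewrite aE !rowY_obs ?(ltnW kn)// ik.
apply: (@traj_test _ _ _ _ _ _ (@alN_ge0 N) (@alN_sum N) ainf0 (dlt_ge0 N) sN _ _ _ a
   (fun y => g (lump N m y)) (fun y => tau n * genL (alphan alpha m.+1) ainf g (lump N m y)) _ _ iK (xN_state N)).
- move=> tr tr' h; apply: eq_big_seq => l ls.
  by rewrite h// leq_mul2r (allP sk _ ls) orbT.
- move=> tr st; rewrite aE; have /andP[t0 t1] := test01 n s (obs_cube st).
  by rewrite ger0_norm.
- exact: gen.
Qed.

Lemma EN_zero F : (exists N0 : nat, forall N tr, (N0 <= N)%N -> (forall j, is_state N (tr j)) -> F (obs N tr) <= 0) ->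
  exists N0 : nat, forall N, (N0 <= N)%N -> EN N F <= 0.
Proof.
move=> [N1 h1]; have [N2 h2] := small_eventually.
exists (maxn N1 N2) => N; rewrite geq_max => /andP[n1 n2].
by apply: EN_le => [|tr st]; [exact: h2|exact: h1].
Qed.

Lemma EN_start m : exists N0 : nat, forall N, (N0 <= N)%N ->
  EN N (fun y => `|y (code m 0 0) - tl x m|) <= 0.
Proof.
exists m => N mN; rewrite /EN (@traj_start _ _ _ _ _ _ _ (fun=> 0)) ?traj_cst// => tr e.
by rewrite obsE// mul0n e ysum_xn// subrr normr0.
Qed.

(* Limit of the chains at all dyadic times: [Y m n k] is the mass of the coordinates [>= m] at time [T k / 2^n]. *)
Theorem limit_array : exists (d : measure_display) (S : measurableType d) (P : probability S R)
    (Y : S -> nat -> R),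
  [/\ forall u, cube (Y u),
      forall f, UCb f -> bmf (fun u => f (Y u)),
      forall m n k, (k <= 2 ^ n)%N ->
        [/\ P [set u | Num.max 0 (Y u (code m.+1 n k) - Y u (code m n k)) = 0] = 1%E,
            P [set u | Y u (code m n.+1 k.*2) - Y u (code m n k) = 0] = 1%E &
            P [set u | Y u (code m 0 0) - tl x m = 0] = 1%E],
      forall m n k, (k < 2 ^ n)%N ->
        Ex P (fun u => (Y u (code m n k.+1) - Y u (code m n k)) ^+ 4) <= quartC m * tau n ^+ 2 &
      forall m (g : 'rV[R]_m.+1 -> R) (e : R), C2 g -> 0 < e ->
        exists n0 : nat, forall n k s, (n0 <= n)%N -> (k < 2 ^ n)%N -> all (fun l => l.1.2 <= k)%N s ->
        `|Ex P (fun u => test n s (Y u) * (g (rowY m n k.+1 (Y u)) - g (rowY m n k (Y u)) -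
          tau n * genL (alphan alpha m.+1) ainf g (rowY m n k (Y u))))| <= tau n * e].
Proof.
have [N1 hN1] := small_eventually.
(* [EN] is known to be monotone only once the step is small enough for the chain to stay in the
   simplex; hence the shift. *)
have hm N : is_mean (EN (N1 + N)) by apply/EN_mean/hN1; exact: leq_addr.
have [d [S [P [X [cX mX hX]]]]] := mean_limit_exists hm.
pose Y u i := X i u.
have hle f (c : R) : UCb f -> (exists N0, forall N, (N0 <= N)%N -> EN N f <= c) ->
    Ex P (fun u => f (Y u)) <= c.
  move=> uf [N0 h]; apply: hX; first exact: uf.1.
  by exists N0 => N NN; apply: h; rewrite (leq_trans NN)// leq_addl.
have mY f : UCb f -> bmf (fun u => f (Y u)) by move=> uf; exact/mX/uf.1.
exists d, S, P, Y; split => //.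
- move=> m n k kn.
  have z f : UCb f -> (exists N0, forall N, (N0 <= N)%N -> EN N (fun y => `|f y|) <= 0) ->
      P [set u | f (Y u) = 0] = 1%E.
    by move=> uf h; apply: prob1_norm_eq0; [exact: mY|apply: (hle (fun y => `|f y|)) => //; exact: UCb_norm].
  split.
  + apply: (z (fun y => Num.max 0 (y (code m.+1 n k) - y (code m n k)))).
      by apply: UCb_max0; apply: UCbB; exact: UCb_coord.
    apply: EN_zero; exists n => N tr nN st; rewrite !obsE//.
    have st' : forall i, 0 <= tr (k * 2 ^ (N - n))%N i by case: (st (k * 2 ^ (N - n))%N).
    rewrite (max_idPl _) ?normr0// subr_le0; exact: ysum_nonincr.
  + apply: (z (fun y => y (code m n.+1 k.*2) - y (code m n k))).
      by apply: UCbB; exact: UCb_coord.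
    apply: EN_zero; exists n.+1 => N tr nN st.
    rewrite !obsE// ?(ltnW nN)//; last by rewrite -mul2n expnS leq_mul2l.
    have -> : (k.*2 * 2 ^ (N - n.+1) = k * 2 ^ (N - n))%N.
      have e2 : (N - n = (N - n.+1).+1)%N by move: nN; clear; lia.
      by rewrite e2 expnS -mul2n mulnCA mulnA.
    by rewrite subrr normr0.
  + apply: (z (fun y => y (code m 0 0) - tl x m)); last exact: EN_start.
    by apply: UCbB; [exact: UCb_coord|exact: UCb_cst].
- move=> m n k kn; apply/ler_addgt0Pr => e e0.
  apply: (hle (fun y => (y (code m n k.+1) - y (code m n k)) ^+ 4)).
    by apply: UCbX; apply: UCbB; exact: UCb_coord.
  by have [N0 h] := EN_increment4 m kn e0; exists N0 => N /h[].
- move=> m g e cg e0; have [n0 h] := EN_generator cg e0.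
  exists n0 => n k s nn kn sk; have [N0 hN] := h n nn.
  have [cg1 _ _ _ _] := cg.
  have uF : UCb (fun y => test n s y * (g (rowY m n k.+1 y) - g (rowY m n k y) -
      tau n * genL (alphan alpha m.+1) ainf g (rowY m n k y))).
    apply: UCbM; first exact: UCb_test.
    apply: UCbB; first by apply: UCbB; exact: UCb_rowY.
    by apply: UCbZ; apply: UCb_rowY; exact: continuous_genL.
  rewrite ler_norml; apply/andP; split; last first.
    apply: (hle _ _ uF); exists N0 => N /hN[_ /(_ k s kn sk)].
    by rewrite ler_norml => /andP[].
  (* Only upper bounds pass to the limit; the lower bound is the upper bound for the opposite
     function. *)
  have e1 := ExZ P (-1) (mY _ uF); rewrite mulN1r in e1; rewrite lerNl -e1.
  apply: (hle _ _ (UCbZ (-1) uF)); exists N0 => N /hN[sN /(_ k s kn sk)].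
  have [_ EZ _ _] := EN_mean sN.
  by rewrite EZ mulN1r ler_norml lerNl => /andP[].
Qed.

End approximating_chains.

Section probability_tools.
Context d (S : measurableType d) (R : realType) (P : probability S R).

Lemma pushforward_prob d' (S' : measurableType d') (W : S -> S') : measurable_fun setT W ->
  exists Q : probability S' R, (forall A, measurable A -> Q A = P (W @^-1` A)) /\
    forall f : S' -> R, bmf f -> Ex Q f = Ex P (fun u => f (W u)).
Proof.
move=> mW.
pose mixin := isMeasurableFun.Build _ _ _ _ W mW.
pose X : {mfun S >-> S'} := MeasurableFun.Pack (MeasurableFun.Class mixin).
exists (distribution P X); split => [A mA|f bf]; first by [].
rewrite /Ex /Rintegral /distribution; congr fine.
rewrite (@integral_pushforward _ _ _ _ _ X mW P setT (EFin \o f))//.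
  by apply/measurable_EFinP; exact: bf.1.
apply: bmf_integrable; split; last by case: bf => _ [M hM]; exists M => x; exact: hM.
exact: (measurableT_comp bf.1 mW).
Qed.

Lemma prob1_cap (U : countType) (F : U -> set S) : (forall i, measurable (F i)) ->
  (forall i, P (F i) = 1%E) -> P (\bigcap_i F i) = 1%E.
Proof.
move=> mF PF.
pose G n := if @unpickle U n is Some i then F i else setT.
have -> : \bigcap_i F i = \bigcap_n G n.
  apply/seteqP; split => [u hu n _|u hu i _].
    by rewrite /G; case: (unpickle n) => // i; exact: hu.
  by have := hu (pickle i) I; rewrite /G pickleK.
apply: prob1_capn => n; rewrite /G; case: (unpickle n) => [i|]//; exact: probability_setT.
Qed.

Lemma prob1_Ex (Z : set S) : measurable Z -> Ex P \1_Z <= 0 -> P (~` Z) = 1%E.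
Proof.
move=> mZ; rewrite Ex_indic// => h.
apply: prob0_setC; first exact: measurableC.
rewrite setCK; apply/eqP; rewrite eq_le measure_ge0 andbT.
have fP : P Z \is a fin_num by exact: fin_num_measure.
by rewrite -(fineK fP) lee_fin.
Qed.

(** The Markov inequality for each [F n], passed to the union because the events increase. *)
Lemma Ex_indic_incr (F : nat -> S -> R) (c : R) : (forall n, measurable_fun setT (F n)) ->
  (forall u, nondecreasing_seq (F ^~ u)) -> (forall n u, 0 <= F n u) -> (forall n, bmf (F n)) ->
  (forall n, Ex P (F n) <= c) ->
  measurable [set u | exists n, 1 <= F n u] /\ Ex P \1_[set u | exists n, 1 <= F n u] <= c.
Proof.
move=> mF ndF F0 bF hc.
pose A n : set S := [set u | 1 <= F n u].
have AE : [set u | exists n, 1 <= F n u] = \bigcup_n A n.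
  by apply/seteqP; split => u [n]; [exists n|move=> _; exists n].
have mA n : measurable (A n).
  rewrite -[X in measurable X]setTI (_ : _ `&` A n = setT `&` F n @^-1` `[1, +oo[%classic).
    by apply: mF => //; exact: measurable_itv.
  by apply/seteqP; split => u /=; rewrite /A/= in_itv/= andbT.
have mU : measurable [set u | exists n, 1 <= F n u] by rewrite AE; exact: bigcupT_measurable.
split=> //.
have hcv : Ex P \1_(A n) @[n --> \oo] --> Ex P \1_[set u | exists n, 1 <= F n u].
  apply: (Ex_cvg (M := 1)) => [n|n u|u].
  - exact: bmf_indic.
  - by rewrite indicE; case: (_ \in _); rewrite ?normr1 ?normr0.
  - have [[n hn]|nF] := pselect (exists n, 1 <= F n u).
      apply: cvg_near_cst; exists n => // k /= nk; rewrite !indicE !mem_set//; first by exists n.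
      by rewrite /A/=; apply: le_trans hn (ndF u _ _ nk).
    apply: cvg_near_cst; apply: nearW => n; rewrite !indicE !memNset//.
    by move=> hn; apply: nF; exists n.
move/cvgr_to_le: hcv; apply; apply: nearW => n; apply: le_trans (hc n).
apply: le_Ex => // [|u]; first exact: bmf_indic.
rewrite indicE; have [|_] := boolP (u \in A n); last exact: F0.
by rewrite inE.
Qed.

End probability_tools.

(** * The almost sure event on which the random array comes from a path *)

Section good_event.
Variables (R : realType) (T : R) (alpha : nat -> R) (x : nat -> R).
Hypothesis T0 : 0 < T.
Context d (S : measurableType d) (P : probability S R) (Y : nat -> nat -> nat -> S -> R).
Hypothesis bY : forall m n k, bmf (Y m n k).
Hypothesis Y01 : forall m n k u, 0 <= Y m n k u <= 1.
Hypothesis Ym : forall m n k, (k <= 2 ^ n)%N -> P [set u | Num.max 0 (Y m.+1 n k u - Y m n k u) = 0] = 1%E.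
Hypothesis Yl : forall m n k, (k <= 2 ^ n)%N -> P [set u | Y m n.+1 k.*2 u - Y m n k u = 0] = 1%E.
Hypothesis Ys : forall m, P [set u | Y m 0 0 u - tl x m = 0] = 1%E.
Hypothesis sx : summable x.
Variables (q : nat -> R).
Hypothesis q0 : forall m, 0 <= q m.
Hypothesis qlim : q m @[m --> \oo] --> (0 : R).
Hypothesis Yq : forall m n k, (k < 2 ^ n)%N ->
  Ex P (fun u => (Y m n k.+1 u - Y m n k u) ^+ 4) <= q m * (T / 2 ^+ n) ^+ 2.

Local Notation r := (9 / 10 : R).

(* [r < 1 < 2 r^4], so both [r^n] and [(2 r^4)^(-n)] are summable. *)
Let rho : R := 1 / (2 * r ^+ 4).

Lemma rho_lt1 : 0 < rho < 1.
Proof. by rewrite /rho; apply/andP; split; lra. Qed.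

(** While it stays below 1, no increment of the levels summed exceeds its threshold [th * r^n].
    Level [n] has [2^n] cells with fourth moment of order [4^-n], so its expected contribution is of
    order [(2 r^4)^-n]. *)
Definition excess (m n0 : nat) (th : R) (N : nat) (u : S) : R :=
  \sum_(i < N) \sum_(k < 2 ^ (n0 + i))
    ((Y m (n0 + i) k.+1 u - Y m (n0 + i) k u) ^+ 4 / (th * r ^+ (n0 + i)) ^+ 4).

Lemma excess_bmf m n0 th N : bmf (excess m n0 th N).
Proof.
apply: bmf_sum => i; apply: bmf_sum => k; apply: bmfM; last exact: bmf_cst.
by apply: bmfX; exact: bmfB.
Qed.

Lemma pow4_ge0 (a : R) : 0 <= a ^+ 4.
Proof. by rewrite -[4%N]/(2 * 2)%N exprM sqr_ge0. Qed.

Lemma excess_Ex m n0 th N : 0 < th ->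
  Ex P (excess m n0 th N) <= q m * (T ^+ 2 / th ^+ 4 * (rho ^+ n0 / (1 - rho))).
Proof.
move=> th0; have /andP[rh0 rh1] := rho_lt1.
have c0 : 0 <= q m * (T ^+ 2 / th ^+ 4).
  by rewrite mulr_ge0// divr_ge0// exprn_ge0// ltW.
rewrite Ex_sum; last first.
  move=> i; apply: bmf_sum => k; apply: bmfM; last exact: bmf_cst.
  by apply: bmfX; exact: bmfB.
apply: (@le_trans _ _ (\sum_(i < N) q m * (T ^+ 2 / th ^+ 4) * rho ^+ (n0 + i))).
  apply: ler_sum => i _; set n := (n0 + i)%N.
  have p0 : 0 < (th * r ^+ n) ^+ 4 by rewrite exprn_gt0// mulr_gt0// exprn_gt0//; lra.
  have bt k : bmf (fun u => (Y m n k.+1 u - Y m n k u) ^+ 4) by apply: bmfX; exact: bmfB.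
  rewrite Ex_sum; last by move=> k; apply: bmfM; [exact: bt|exact: bmf_cst].
  apply: (@le_trans _ _ (\sum_(k < 2 ^ n) q m * (T / 2 ^+ n) ^+ 2 / (th * r ^+ n) ^+ 4)).
    apply: ler_sum => k _.
    under [X in Ex P X]eq_fun do rewrite mulrC.
    by rewrite ExZ// mulrC ler_wpM2r ?invr_ge0 ?(ltW p0)// Yq.
  rewrite sumr_const card_ord -[leLHS]mulr_natl le_eqVlt; apply/orP; left; apply/eqP.
  have h2 : (2 : R) ^+ n != 0 by [].
  have hr : r ^+ n != 0 by rewrite expf_neq0//; apply/eqP; lra.
  have hth : th != 0 by rewrite gt_eqF.
  have -> : rho ^+ n = 1 / (2 ^+ n * (r ^+ n) ^+ 4).
    by rewrite /rho expr_div_n expr1n exprMn exprAC.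
  rewrite natrX; move: (2 ^+ n) (r ^+ n) h2 hr => a b h2 hr.
  by field; rewrite h2 hr hth.
rewrite -mulr_sumr [leRHS]mulrA ler_wpM2l//.
have -> : \sum_(i < N) rho ^+ (n0 + i) = rho ^+ n0 * \sum_(i < N) rho ^+ i.
  by rewrite mulr_sumr; apply: eq_bigr => i _; rewrite exprD.
rewrite ler_wpM2l ?exprn_ge0 ?(ltW rh0)//.
have h1 : 1 - rho != 0 by rewrite gt_eqF// subr_gt0.
have -> : \sum_(i < N) rho ^+ i = (1 - rho ^+ N) / (1 - rho).
  by rewrite -[X in X - _](expr1n R N) subrXX; under [in RHS]eq_bigr do rewrite expr1n mul1r; rewrite mulrAC mulfV ?mul1r.
rewrite ler_pdivrMr ?subr_gt0// mulVf// gerBl exprn_ge0// ltW//.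
Qed.

Definition badset m n0 th : set S := [set u | exists N, 1 <= excess m n0 th N u].

Lemma badset_prob m n0 th : 0 < th -> measurable (badset m n0 th) /\
  Ex P \1_(badset m n0 th) <= q m * (T ^+ 2 / th ^+ 4 * (rho ^+ n0 / (1 - rho))).
Proof.
move=> th0; apply: Ex_indic_incr.
- by move=> n; exact: (excess_bmf m n0 th n).1.
- move=> u i j ij; rewrite /excess -(subnKC ij) big_split_ord/= lerDl.
  by apply: sumr_ge0 => a _; apply: sumr_ge0 => k _; rewrite divr_ge0 ?pow4_ge0.
- move=> n u; apply: sumr_ge0 => a _; apply: sumr_ge0 => k _; by rewrite divr_ge0 ?pow4_ge0.
- by move=> n; exact: excess_bmf.
- by move=> n; exact: excess_Ex.
Qed.

Lemma badsetN m n0 th u : 0 < th -> ~ badset m n0 th u -> forall n k, (n0 <= n)%N -> (k < 2 ^ n)%N ->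
  `|Y m n k.+1 u - Y m n k u| <= th * r ^+ n.
Proof.
move=> th0 nb n k nn kn; rewrite leNgt; apply/negP => h; apply: nb.
exists (n - n0).+1; rewrite /excess big_ord_recr/=.
have e : (n0 + (n - n0) = n)%N by rewrite subnKC.
rewrite e; have p0 : 0 < th * r ^+ n by rewrite mulr_gt0// exprn_gt0//; lra.
have pos i (j : nat) : 0 <= (Y m i j.+1 u - Y m i j u) ^+ 4 / (th * r ^+ i) ^+ 4.
  by rewrite divr_ge0 ?pow4_ge0.
rewrite (bigD1 (Ordinal kn))//=.
have h1 : 0 <= \sum_(i < n - n0) \sum_(k0 < 2 ^ (n0 + i)) ((Y m (n0 + i) k0.+1 u - Y m (n0 + i) k0 u) ^+ 4 / (th * r ^+ (n0 + i)) ^+ 4).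
  by apply: sumr_ge0 => i _; apply: sumr_ge0.
have h2 : 0 <= \sum_(i < 2 ^ n | i != Ordinal kn) ((Y m n i.+1 u - Y m n i u) ^+ 4 / (th * r ^+ n) ^+ 4).
  exact: sumr_ge0.
suff h3 : 1 <= (Y m n k.+1 u - Y m n k u) ^+ 4 / (th * r ^+ n) ^+ 4 by apply: le_trans h3 _; rewrite addrCA lerDl addr_ge0.
rewrite ler_pdivlMr ?exprn_gt0// mul1r.
have -> : (Y m n k.+1 u - Y m n k u) ^+ 4 = `|Y m n k.+1 u - Y m n k u| ^+ 4.
  by rewrite -normrX ger0_norm// pow4_ge0.
by apply: lerXn2r; rewrite ?nnegrE ?normr_ge0 ?(ltW p0) ?(ltW h).
Qed.

(** Borel-Cantelli at fixed [m]: the probability of an excess beyond level [n0] tends to 0 as [n0]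
    grows. *)
Lemma inc_event m : exists A : set S, [/\ measurable A, P A = 1%E & forall u, A u ->
  exists n0 : nat, forall n k, (n0 <= n)%N -> (k < 2 ^ n)%N -> `|Y m n k.+1 u - Y m n k u| <= r ^+ n].
Proof.
pose Z := \bigcap_n0 badset m n0 1.
have mb n0 : measurable (badset m n0 1) by exact: (badset_prob m n0 (@ltr01 R)).1.
have mZ : measurable Z by exact: bigcapT_measurable.
exists (~` Z); split; first exact: measurableC.
- apply: prob1_Ex => //.
  have hl : q m * (T ^+ 2 / 1 ^+ 4 * (rho ^+ n / (1 - rho))) @[n --> \oo] --> (0 : R).
    have /andP[rh0 rh1] := rho_lt1.
    have e0 : rho ^+ n @[n --> \oo] --> (0 : R) by apply: cvg_expr; rewrite gtr0_norm.
    rewrite -[X in _ --> X](mulr0 (q m)); apply: cvgM; first exact: cvg_cst.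
    rewrite -[X in _ --> X](mulr0 (T ^+ 2 / 1 ^+ 4)); apply: cvgM; first exact: cvg_cst.
    by rewrite -[X in _ --> X](mul0r (1 - rho)^-1); apply: cvgM => //; exact: cvg_cst.
  move/cvgr_to_ge: hl; apply; apply: nearW => n.
  apply: le_trans (badset_prob m n (@ltr01 R)).2.
  apply: le_Ex; [exact: bmf_indic|exact: bmf_indic|].
  move=> u; rewrite !indicE; have [|_] := boolP (u \in Z); last by case: (_ \in _).
  by rewrite inE => zu; rewrite mem_set//; exact: zu.
- move=> u nz; have [n0 hn] : exists n0, ~ badset m n0 1 u.
    by apply/existsNP => h; apply: nz => n _; exact: h.
  exists n0 => n k nn kn; have := badsetN (@ltr01 R) hn nn kn.
  by rewrite mul1r.
Qed.

(** The same estimate from level 0 on, with [m] going to infinity: [q m -> 0] makes some tail mass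
    almost constant in time at all levels. *)
Lemma tail_event (th : R) (m0 : nat) : 0 < th -> exists A : set S, [/\ measurable A, P A = 1%E & forall u, A u ->
  exists2 m : nat, (m0 <= m)%N & forall n k, (k < 2 ^ n)%N -> `|Y m n k.+1 u - Y m n k u| <= th * r ^+ n].
Proof.
move=> th0; pose Z := \bigcap_j badset (m0 + j) 0 th.
have mb j : measurable (badset (m0 + j) 0 th) by exact: (badset_prob _ 0 th0).1.
have mZ : measurable Z by exact: bigcapT_measurable.
exists (~` Z); split; first exact: measurableC.
- apply: prob1_Ex => //.
  have hl : q (m0 + j) * (T ^+ 2 / th ^+ 4 * (rho ^+ 0 / (1 - rho))) @[j --> \oo] --> (0 : R).
    rewrite -[X in _ --> X](mul0r (T ^+ 2 / th ^+ 4 * (rho ^+ 0 / (1 - rho)))).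
    apply: cvgM; last exact: cvg_cst.
    rewrite (_ : (fun j => q (m0 + j)%N) = [sequence q (j + m0)%N]_j); first by rewrite cvg_shiftn.
    by apply/funext => j; rewrite addnC.
  move/cvgr_to_ge: hl; apply; apply: nearW => n.
  apply: le_trans (badset_prob _ 0 th0).2.
  apply: le_Ex; [exact: bmf_indic|exact: bmf_indic|].
  move=> u; rewrite !indicE; have [|_] := boolP (u \in Z); last by case: (_ \in _).
  by rewrite inE => zu; rewrite mem_set//; exact: zu.
- move=> u nz; have [j hj] : exists j, ~ badset (m0 + j) 0 th u.
    by apply/existsNP => h; apply: nz => n _; exact: h.
  exists (m0 + j)%N; first exact: leq_addr.
  by move=> n k; apply: badsetN hj _ _ _.
Qed.

Lemma array_event : exists A : set S, [/\ measurable A, P A = 1%E & forall u, A u ->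
  exists w : Omega T, forall m n k, (k <= 2 ^ n)%N ->
    tl (opath w (gridt T n k)) m = Y m n k u /\
    opath w (gridt T n k) m = Num.max 0 (Y m n k u - Y m.+1 n k u) /\
    Y m 0 0 u = tl x m].
Proof.
have mset (F : S -> R) : bmf F -> measurable [set u | F u = 0].
  move=> bF; rewrite (_ : [set u | F u = 0] = setT `&` F @^-1` [set 0]); last by rewrite setTI.
  exact: bF.1.
have bmax (F : S -> R) : bmf F -> bmf (fun u => Num.max 0 (F u)).
  move=> [mF [M hM]]; split; first by apply: measurable_maxr => //; exact: measurable_cst.
  exists M => u; apply: le_trans (hM u); have := lip_max0 (F u) 0.
  by rewrite maxxx !subr0.
pose A1 (p : nat * nat * nat) : set S := if (p.2 <= 2 ^ p.1.2)%N then
  [set u | Num.max 0 (Y p.1.1.+1 p.1.2 p.2 u - Y p.1.1 p.1.2 p.2 u) = 0] else setT.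
pose A2 (p : nat * nat * nat) : set S := if (p.2 <= 2 ^ p.1.2)%N then
  [set u | Y p.1.1 p.1.2.+1 p.2.*2 u - Y p.1.1 p.1.2 p.2 u = 0] else setT.
pose A3 m := [set u | Y m 0 0 u - tl x m = 0].
have /choice[A4 hA4] := inc_event.
have /choice[A5 hA5] : forall p : nat * nat, exists A : set S, [/\ measurable A, P A = 1%E & forall u, A u ->
  exists2 m : nat, (p.2 <= m)%N & forall n k, (k < 2 ^ n)%N -> `|Y m n k.+1 u - Y m n k u| <= p.1.+1%:R^-1 * r ^+ n].
  by move=> p; apply: tail_event; rewrite invr_gt0.
have m1 p : measurable (A1 p).
  by rewrite /A1; case: ifP => // _; apply: mset; apply: bmax; exact: bmfB.
have m2 p : measurable (A2 p).
  by rewrite /A2; case: ifP => // _; apply: mset; exact: bmfB.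
have m3 m : measurable (A3 m).
  by apply: mset; apply: bmfB => //; exact: bmf_cst.
have m4 m : measurable (A4 m) by case: (hA4 m).
have m5 p : measurable (A5 p) by case: (hA5 p).
have c1 := bigcap_countType_measurable m1; have c2 := bigcap_countType_measurable m2.
have c3 := bigcap_countType_measurable m3; have c4 := bigcap_countType_measurable m4.
have c5 := bigcap_countType_measurable m5.
exists ((\bigcap_p A1 p `&` \bigcap_p A2 p) `&` (\bigcap_p A3 p `&` (\bigcap_p A4 p `&` \bigcap_p A5 p))); split.
- by apply: measurableI; apply: measurableI => //; exact: measurableI.
- apply: prob1I; first exact: measurableI.
  + by apply: measurableI => //; exact: measurableI.
  + apply: prob1I => //; apply: prob1_cap => // p.
      by rewrite /A1; case: ifP => kn; [exact: Ym|exact: probability_setT].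
    by rewrite /A2; case: ifP => kn; [exact: Yl|exact: probability_setT].
  + apply: prob1I => //; first exact: measurableI.
      by apply: prob1_cap => // m; exact: Ys.
    by apply: prob1I => //; apply: prob1_cap => // p; [case: (hA4 p)|case: (hA5 p)].
- move=> u [[h1 h2] [h3 [h4 h5]]].
  have e1 m n k : (k <= 2 ^ n)%N -> Y m.+1 n k u <= Y m n k u.
    move=> kn; have := h1 (m, n, k) I; rewrite /A1/= kn /= => /eqP.
    by rewrite eq_maxl subr_le0.
  have e2 m n k : (k <= 2 ^ n)%N -> Y m n.+1 k.*2 u = Y m n k u.
    by move=> kn; have := h2 (m, n, k) I; rewrite /A2/= kn /= => /eqP; rewrite subr_eq0 => /eqP.
  have e3 m : Y m 0 0 u = tl x m.
    by have /eqP := h3 m I; rewrite subr_eq0 => /eqP.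
  have e4 m := (let: And3 _ _ h := hA4 m in h u) (h4 m I).
  have e5 (e : R) : 0 < e -> exists m, forall n k, (k <= 2 ^ n)%N -> Y m n k u <= e.
    move=> e0; have e2' : 0 < e / 2 by rewrite divr_gt0.
    have /cvgrPdist_le/(_ _ e2')[m0 _ hm0] := tl_to0 sx.
    (* The chaining bound is [th / (1 - r) = 10 / (j + 1)] with [r = 9 / 10], and it must not exceed
       [e / 2]; the initial tail of [x] takes the other half. *)
    pose j := Num.bound (20 / e).
    have [m mm hm] := (let: And3 _ _ h := hA5 (j, m0) in h u) (h5 (j, m0) I).
    exists m => n k kn.
    have j0 : (0 : R) <= j.+1%:R^-1 by rewrite invr_ge0.
    have r0 : 0 < r by lra. have r1 : r < 1 by lra.
    have := @array_sup R (fun n k => Y m n k u) r j.+1%:R^-1 r0 r1 j0 (fun n k => @e2 m n k) hm n k kn.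
    rewrite e3 => /le_trans; apply; rewrite [e]splitr; apply: lerD.
      by have := hm0 m mm; rewrite sub0r normrN; apply: le_trans; exact: ler_norm.
    have -> : j.+1%:R^-1 / (1 - r) = 10 / j.+1%:R :> R.
      by have -> : 1 - r = 10^-1 by [lra]; rewrite invrK mulrC.
    rewrite ler_pdivrMr// mulrC -ler_pdivrMr//.
    have -> : 10 / (e / 2) = 20 / e by have he : e != 0 by [rewrite gt_eqF]; field.
    apply: le_trans (ltW (archi_boundP _)) _; first by rewrite divr_ge0 ?(ltW e0).
    by rewrite ler_nat.
  have r0 : 0 < r by lra. have r1 : r < 1 by lra.
  have [w hw] := @path_of_array R T (fun m n k => Y m n k u) r T0 r0 r1 (fun m n k => Y01 m n k u) e1 e2 e4 e5.
  exists w => m n k kn; have [w1 w2] := hw m n k kn; split => //; split => //.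
  by rewrite w2 (max_idPr _)// subr_ge0 e1.
Qed.

End good_event.

(** * Realisation of the limit law and its lumped martingale problems *)

Section limit_law.
Variables (R : realType) (alpha : nat -> R) (ainf : R) (x : nat -> R) (T : R).
Hypothesis sa : summable alpha.
Hypothesis ainf0 : 0 <= ainf.
Hypothesis sx : summable x.
Hypothesis x1 : tl x 0 <= 1.
Hypothesis T0 : 0 < T.

Lemma quartC_ge0 m : 0 <= quartC alpha ainf x T m.
Proof.
have A0 : 0 <= tl alpha 0 by exact: tl_ge0.
rewrite /quartC mulr_ge0//; first by rewrite /Cpow4 addr_ge0// mulr_ge0// addr_ge0.
rewrite mulr_ge0//; first by rewrite /Csqr addr_ge0// mulr_ge0.
rewrite addr_ge0 ?tl_ge0// mulr_ge0 ?tl_ge0//.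
by rewrite addr_ge0// mulr_ge0// ltW.
Qed.

Lemma quartC_to0 : quartC alpha ainf x T m @[m --> \oo] --> (0 : R).
Proof.
have -> : 0 = Cpow4 ainf (tl alpha 0) * (Csqr ainf * (0 + (1 + 2 * T) * 0)) :> R.
  by rewrite mulr0 addr0 !mulr0.
apply: cvgM; first exact: cvg_cst.
apply: cvgM; first exact: cvg_cst.
apply: cvgD; first exact: tl_to0.
by apply: cvgM; [exact: cvg_cst|exact: tl_to0].
Qed.

Lemma row_lump_E m a (j : 'I_m.+1) :
  firstm m.+1 (xn a m.+1) 0 j = if (j < m)%N then a j else tl a m :> R.
Proof.
rewrite mxE /xn ltnS; case: ifP => // jm.
by have -> : (nat_of_ord j == m.+1.-1) by rewrite /= eqn_leq -ltnS ltn_ord leqNgt jm.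
Qed.

Lemma idx_mono n s t : s <= t -> (idx T n s <= idx T n t)%N.
Proof.
move=> st; apply: le_truncn; rewrite ler_wpM2l//.
by rewrite ler_wpM2r// invr_ge0 ltW.
Qed.

Lemma flr_cvg_row n (V : (nat -> R) -> 'rV[R]_n) (g : 'rV[R]_n -> R) (w : Omega T) t :
  lip_row V -> continuous g -> 0 <= t <= T ->
  g (V (opath w (flr T k t))) @[k --> \oo] --> g (V (opath w t)).
Proof.
move=> lV cg tT; apply/cvgrPdist_lt => e e0.
have [dl d0 hd] := row_fun_UCT lV w cg e0.
have [n0 h] := flr_near T0 d0; exists n0 => // k /= nk.
rewrite distrC; apply: hd => //; first exact: flr_in.
exact: h.
Qed.

Section discretized_martingale.
Variables (m : nat) (g : 'rV[R]_m.+1 -> R).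
Hypothesis Cg : C2 g.
Let V := fun a : nat -> R => firstm m.+1 (xn a m.+1).
Let rho := genL (alphan alpha m.+1) ainf g.
Let lV : lip_row V := @lip_row_lump R m.

Let cg : continuous g. Proof. by case: Cg. Qed.
Let cr : continuous rho. Proof. exact: continuous_genL. Qed.

(** Unlike [Mr], it evaluates the first term on the grid too, which makes it a function of the
    array. *)
Definition gridM (k : nat) (t : R) (w : OmegaB T) : R :=
  g (V (opath w (flr T k t))) - riem T k t (fun u => rho (V (opath w u))).

(** Observation times are rounded down to the grid; rounding is monotone, so a test of the past of
    [s] only uses indices up to [idx T k s]. *)
Definition gridtest (k : nat) (l : seq ((R * nat) * (nat * nat))) : OmegaB T -> R :=
  tprod [seq ((flr T k y.1.1, y.1.2), y.2) | y <- l].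

Lemma gridM_cvg t w : 0 <= t <= T -> gridM k t w @[k --> \oo] --> Mf V g rho t w.
Proof.
move=> tT; apply: cvgB; first exact: flr_cvg_row.
by apply: riem_cvg => //; exact: row_fun_UCT.
Qed.

Lemma gridM_bmf k t : 0 <= t <= T -> bmf (gridM k t).
Proof.
move=> tT; apply: bmfB; last exact: riem_bmf.
by apply: row_fun_bmf => //; exact: flr_in.
Qed.

Lemma gridM_bound : exists2 M : R, 0 <= M & forall k t w, 0 <= t <= T -> `|gridM k t w| <= M.
Proof.
have [M M0 hM] := row_fun_bound T lV cg; have [N N0 hN] := row_fun_bound T lV cr.
exists (M + T * N); first by rewrite addr_ge0// mulr_ge0// ltW.
move=> k t w tT; apply: le_trans (ler_normB _ _) _; apply: lerD; first by apply: hM; exact: flr_in.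
by apply: riem_bound => // u uT; exact: hN.
Qed.

Lemma gridtest_cvg l w : all (fun y => 0 <= y.1.1 <= T) l ->
  gridtest k l w @[k --> \oo] --> tprod l w.
Proof.
move=> hl; rewrite /gridtest /tprod.
pose f (y : (R * nat) * (nat * nat)) k := psi y.2.1 y.2.2
  (if 0 <= y.1.1 <= T then opath w (flr T k y.1.1) y.1.2 else opath w y.1.1 y.1.2).
have -> : (fun k => \prod_(y <- [seq ((flr T k y.1.1, y.1.2), y.2) | y <- l]) psi y.2.1 y.2.2 (opath w y.1.1 y.1.2)) =
   (fun k => \prod_(y <- l) f y k).
  by apply/funext => k; rewrite big_map; apply: eq_big_seq => y yl; rewrite /f (allP hl).
apply: cvg_prodr => y; rewrite /f; have [yT|_] := boolP (0 <= y.1.1 <= T); last exact: cvg_cst.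
apply: (cvg_comp (fun k => opath w (flr T k y.1.1) y.1.2) (psi y.2.1 y.2.2)).
  exact: flr_coord.
apply: (@continuous_comp R R R (fun z => 1 - z ^+ y.2.1) (fun z => z ^+ y.2.2)); last exact: exprn_continuous.
by apply: continuousB; [exact: cst_continuous|exact: exprn_continuous].
Qed.

Variables (d : measure_display) (S : measurableType d) (P : probability S R) (Y : S -> nat -> R).
Hypothesis bY : forall f, UCb f -> bmf (fun u => f (Y u)).
Variables (A : set S) (W : S -> OmegaB T) (Q : probability (OmegaB T) R).
Hypotheses (mA : measurable A) (PA : P A = 1%E).
Hypothesis mW : measurable_fun setT W.
Hypothesis WE : forall u, A u -> forall i n k, (k <= 2 ^ n)%N ->
  tl (opath (W u) (gridt T n k)) i = Y u (code i n k) /\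
  opath (W u) (gridt T n k) i = dif (Y u) i n k.
Hypothesis QE : forall f, bmf f -> Ex Q f = Ex P (fun u => f (W u)).
Hypothesis PY : forall e : R, 0 < e ->
  exists n0 : nat, forall n k s, (n0 <= n)%N -> (k < 2 ^ n)%N -> all (fun l => l.1.2 <= k)%N s ->
    `|Ex P (fun u => test n s (Y u) * (g (rowY m n k.+1 (Y u)) - g (rowY m n k (Y u)) -
          tau T n * rho (rowY m n k (Y u))))| <= tau T n * e.

Lemma V_rowY u n k : A u -> (k <= 2 ^ n)%N -> V (opath (W u) (gridt T n k)) = rowY m n k (Y u).
Proof.
move=> Au kn; apply/rowP => j; rewrite /V row_lump_E mxE.
by have [-> _] := WE Au m kn; have [_ ->] := WE Au j kn.
Qed.

Lemma gridM_incr u n s t : A u -> 0 <= s -> s <= t -> t <= T ->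
  gridM n t (W u) - gridM n s (W u) = \sum_(idx T n s <= k < idx T n t)
    (g (rowY m n k.+1 (Y u)) - g (rowY m n k (Y u)) - tau T n * rho (rowY m n k (Y u))).
Proof.
move=> Au s0 st tT.
have sT : 0 <= s <= T by rewrite s0 (le_trans st).
have tT' : 0 <= t <= T by rewrite tT (le_trans s0).
pose Z k := g (rowY m n k (Y u)) - \sum_(0 <= j < k) tau T n * rho (rowY m n j (Y u)).
have gZ r : 0 <= r <= T -> gridM n r (W u) = Z (idx T n r).
  move=> rT; have ir := idx_le T0 n rT; rewrite /gridM /flr V_rowY// /Z /riem; congr (_ - _).
  rewrite big_mkord; apply: eq_bigr => k _; rewrite V_rowY//.
  by apply: leq_trans ir; exact: ltnW.
rewrite !gZ// -telescope_sumr; last exact: idx_mono.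
apply: eq_bigr => k _; rewrite /Z big_nat_recr//=; ring.
Qed.

Lemma gridtest_E u n t l : A u -> t <= T -> all (fun y => 0 <= y.1.1 <= t) l ->
  gridtest n l (W u) = test n [seq ((y.1.2, idx T n y.1.1), y.2) | y <- l] (Y u).
Proof.
move=> Au tT hl; rewrite /gridtest /tprod /test !big_map.
apply: eq_big_seq => y /(allP hl)/andP[y0 yt] /=.
by have [_ <-] := WE Au y.1.2 (idx_le T0 n (introT andP (conj y0 (le_trans yt tT)))).
Qed.

(** The increment telescopes into at most [2 ^ n] cells, each with an error of at most
    [tau T n * e], and every cell lies after all observation times of the test. *)
Lemma grid_orthogonal s t l (e : R) : 0 <= s -> s <= t -> t <= T -> all (fun y => 0 <= y.1.1 <= s) l -> 0 < e ->
  exists n0 : nat, forall n, (n0 <= n)%N ->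
    `|Ex Q (fun w => (gridM n t w - gridM n s w) * gridtest n l w)| <= T * e.
Proof.
move=> s0 st tT hl e0; have [n0 h] := PY e0; exists n0 => n nn.
have sT : 0 <= s <= T by rewrite s0 (le_trans st).
have tT' : 0 <= t <= T by rewrite tT (le_trans s0).
have bD : bmf (fun w => (gridM n t w - gridM n s w) * gridtest n l w).
  by apply: bmfM; [apply: bmfB; exact: gridM_bmf|exact: bmf_tprod].
set l' := [seq ((y.1.2, idx T n y.1.1), y.2) | y <- l].
pose inc k u := test n l' (Y u) * (g (rowY m n k.+1 (Y u)) - g (rowY m n k (Y u)) -
   tau T n * rho (rowY m n k (Y u))).
have binc k : bmf (inc k).
  apply: (bY (f := fun y => test n l' y * (g (rowY m n k.+1 y) - g (rowY m n k y) - tau T n * rho (rowY m n k y)))).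
  apply: UCbM; first exact: UCb_test.
  apply: UCbB; first by apply: UCbB; exact: UCb_rowY.
  by apply: UCbZ; exact: UCb_rowY.
have -> : Ex Q (fun w => (gridM n t w - gridM n s w) * gridtest n l w) =
    Ex P (fun u => \sum_(idx T n s <= k < idx T n t) inc k u).
  rewrite QE//; apply: (@Ex_as _ _ _ P _ _ A) => //.
  - by split; [exact: (measurableT_comp bD.1 mW)|case: bD => _ [M hM]; exists M => u; exact: hM].
  - exact: bmf_sum.
  - move=> u Au; rewrite gridM_incr// (gridtest_E _ Au (le_trans st tT) hl) mulr_suml.
    by apply: eq_bigr => k _; rewrite mulrC.
rewrite Ex_sum//; apply: le_trans (ler_norm_sum _ _ _) _.
have tn0 : 0 <= tau T n by apply: divr_ge0; [exact: ltW|exact: exprn_ge0].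
apply: (@le_trans _ _ (\sum_(idx T n s <= k < idx T n t) tau T n * e)).
  apply: ler_sum_nat => k /andP[sk kt]; apply: h => //.
    by apply: leq_trans kt _; exact: idx_le.
  rewrite all_map; apply/allP => y /(allP hl)/andP[y0 ys] /=.
  by apply: leq_trans sk; exact: idx_mono.
rewrite sumr_const_nat -[leLHS]mulr_natl mulrA; apply: ler_wpM2r; first exact: ltW.
rewrite /tau mulrCA; apply: ler_piMr; first exact: ltW.
rewrite ler_pdivrMr ?exprn_gt0// mul1r -natrX ler_nat.
by apply: leq_trans (leq_subr _ _) _; exact: idx_le.
Qed.

Lemma limit_martingale : is_martingale Q (Mf V g rho).
Proof.
apply: (martingale_of_tests T0 lV cg cr) => s t l s0 st tT hl.
have sT : 0 <= s <= T by rewrite s0 (le_trans st).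
have tT' : 0 <= t <= T by rewrite tT (le_trans s0).
have bt := @bmf_tprod R T T0 l.
have bM r : 0 <= r <= T -> bmf (Mf (T := T) V g rho r) by move=> rT; exact: Mf_bmf.
apply/eqP; rewrite -subr_eq0 -ExB; [|by apply: bmfM => //; exact: bM..].
under [X in Ex Q X]eq_fun do rewrite -mulrBl.
have hl' : all (fun y => 0 <= y.1.1 <= T) l.
  by apply/allP => y /(allP hl)/andP[-> h] /=; apply: le_trans h _; exact: le_trans tT.
have hc : Ex Q (fun w => (gridM n t w - gridM n s w) * gridtest n l w) @[n --> \oo] -->
    Ex Q (fun w => (Mf V g rho t w - Mf V g rho s w) * tprod l w).
  have [M M0 hM] := gridM_bound.
  apply: (Ex_cvg (M := (M + M) * 1)).
  - by move=> n; apply: bmfM; [apply: bmfB; exact: gridM_bmf|exact: bmf_tprod].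
  - move=> n w; rewrite normrM; apply: ler_pM => //.
      by apply: le_trans (ler_normB _ _) _; apply: lerD; exact: hM.
    by have /andP[a0 a1] := tprod01 [seq ((flr T n y.1.1, y.1.2), y.2) | y <- l] w; rewrite ger0_norm.
  - move=> w; apply: cvgM; last exact: gridtest_cvg.
    by apply: cvgB; exact: gridM_cvg.
rewrite -normr_le0; apply/ler_addgt0Pr => e e0; rewrite add0r.
have e1 : 0 < e / T by rewrite divr_gt0.
have [n0 h] := grid_orthogonal s0 st tT hl e1.
move/cvg_norm/cvgr_to_le: hc; apply; exists n0 => // n /= nn.
by have := h n nn; rewrite mulrCA mulfV ?mulr1 ?gt_eqF.
Qed.

End discretized_martingale.

Theorem limit_law : exists Q : probability (OmegaB T) R,
  Q [set w : OmegaB T | forall i, opath w 0 i = x i] = 1%E /\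
  forall m (g : 'rV[R]_m.+1 -> R), C2 g ->
    is_martingale Q (Mf (fun a => firstm m.+1 (xn a m.+1)) g (genL (alphan alpha m.+1) ainf g)).
Proof.
have [d [S [P [Y [cY bY hY1 hY4 hYg]]]]] := limit_array sa ainf0 sx x1 T0.
have bYc i n k : bmf (fun u => Y u (code i n k)).
  by apply: (bY (fun y => y (code i n k))); exact: UCb_coord.
have [A [mA PA hA]] : exists A : set S, [/\ measurable A, P A = 1%E & forall u, A u ->
  exists w : Omega T, forall m n k, (k <= 2 ^ n)%N ->
    tl (opath w (gridt T n k)) m = Y u (code m n k) /\
    opath w (gridt T n k) m = Num.max 0 (Y u (code m n k) - Y u (code m.+1 n k)) /\
    Y u (code m 0 0) = tl x m].
  apply: (@array_event R T x T0 d S P (fun m n k u => Y u (code m n k)) bYc _ _ _ _ sx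
    (quartC alpha ainf x T) quartC_ge0 quartC_to0) => [m n k u|m n k kn|m n k kn|m|m n k kn].
  - exact: cY.
  - by case: (hY1 m n k kn).
  - by case: (hY1 m n k kn).
  - by case: (hY1 m 0 0).
  - exact: hY4.
(* [W] comes from choice, yet it is measurable: at dyadic times it is dictated by the array on [A],
   and it is the zero path [point] off [A]. *)
have /choice[W hW] : forall u, exists w : Omega T, (A u -> forall m n k, (k <= 2 ^ n)%N ->
    tl (opath w (gridt T n k)) m = Y u (code m n k) /\
    opath w (gridt T n k) m = Num.max 0 (Y u (code m n k) - Y u (code m.+1 n k)) /\
    Y u (code m 0 0) = tl x m) /\ (~ A u -> w = point).
  move=> u; have [Au|nA] := pselect (A u); last by exists point; split.
  by have [w hw] := hA u Au; exists w; split.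
have evg i n k : (k <= 2 ^ n)%N -> bmf (fun u => opath (W u) (gridt T n k) i).
  move=> kn; rewrite (_ : (fun u => _) = fun u => \1_A u * dif (Y u) i n k); last first.
    apply/funext => u; rewrite indicE; have [Au|nA] := pselect (A u).
      by rewrite mem_set// mul1r; have [_ [-> _]] := (hW u).1 Au i n k kn.
    by rewrite memNset// mul0r (hW u).2.
  by apply: bmfM; [exact: bmf_indic|apply: (bY (fun y => dif y i n k)); exact: UCb_dif].
have mW : measurable_fun setT (W : S -> OmegaB T).
  apply: measurable_to_Omega => // t i tT.
  suff : bmf (fun u => opath (W u) t i) by case.
  apply: (bmf_lim (h := fun n u => opath (W u) (flr T n t) i) (M := 1)) => [n|n u|u].
  - by apply: evg; exact: idx_le.
  - by have /andP[a0 a1] := path01 (W u) (flr T n t) i; rewrite ger0_norm.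
  - exact: flr_coord.
have [Q [QP QE]] := pushforward_prob P mW.
exists Q; split.
- have mI := measurable_start T0 x.
  rewrite QP//; apply: (prob1S mA) => //; first by rewrite -[X in measurable X]setTI; exact: mW.
  move=> u Au i; have [_ [h1 _]] := (hW u).1 Au i 0 0 isT.
  rewrite (_ : 0 = gridt T 0 0) ?h1; last by rewrite /gridt mul0r mulr0.
  have [_ [_ ->]] := (hW u).1 Au i 0 0 isT; have [_ [_ ->]] := (hW u).1 Au i.+1 0 0 isT.
  by rewrite (tlS i sx) addrK (max_idPr _)//; case: sx.
- move=> m g Cg; apply: (@limit_martingale m g Cg d S P Y bY A W Q mA PA mW).
  + by move=> u Au i n k kn; have [h1 [h2 _]] := (hW u).1 Au i n k kn.
  + exact: QE.
  + by move=> e e0; exact: hYg.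
Qed.

End limit_law.

(** * Uniqueness of the diffusions by moments *)

Section monomials.
Variables (R : realType) (n : nat).
Implicit Types (e : 'I_n -> nat) (v : 'rV[R]_n).

Definition mon e v : R := \prod_j v 0 j ^+ e j.

Definition shrink e (i : 'I_n) (j : 'I_n) : nat := (e j - (j == i))%N.

Definition grow e (i : 'I_n) p (j : 'I_n) : nat := (e j + (j == i) * p)%N.

Lemma mon_grow e i p v : mon (grow e i p) v = v 0 i ^+ p * mon e v.
Proof.
rewrite /mon (bigD1 i)//= [in RHS](bigD1 i)//= mulrA /grow eqxx mul1n exprD.
rewrite [v 0 i ^+ p * _]mulrC; congr (_ * _); apply: eq_bigr => j /negbTE->.
by rewrite mul0n addn0.
Qed.

Lemma deg_grow e i p : (\sum_j grow e i p j = \sum_j e j + p)%N.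
Proof.
rewrite big_split/=; congr (_ + _)%N.
by rewrite (bigD1 i)//= eqxx mul1n big1 ?addn0// => j /negbTE->.
Qed.

Lemma deg_shrink e i : (0 < e i)%N -> ((\sum_j shrink e i j).+1 = \sum_j e j)%N.
Proof.
move=> ei; rewrite (bigD1 i)//= [in RHS](bigD1 i)//= /shrink eqxx -addSn.
rewrite subn1 prednK//; congr (_ + _)%N; apply: eq_bigr => j /negbTE->.
by rewrite subn0.
Qed.

Lemma deg_coord e i : (e i <= \sum_j e j)%N.
Proof. by rewrite (bigD1 i)//= leq_addr. Qed.

Lemma mon_is_derive e i v :
  is_derive v (delta_mx 0 i : 'rV[R]_n) (mon e) ((e i)%:R * mon (shrink e i) v).
Proof.
pose c := \prod_(j | j != i) v 0 j ^+ e j.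
have monE s : mon e (s *: delta_mx 0 i + v) = c * (s + v 0 i) ^+ e i.
  rewrite /mon (bigD1 i)//= mulrC !mxE !eqxx mulr1; congr (_ * _).
  by apply: eq_bigr => j /negbTE ji; rewrite !mxE eqxx/= ji mulr0 add0r.
have mon0 : mon e v = c * (v 0 i) ^+ e i.
  by have := monE 0; rewrite scale0r !add0r.
pose phi (z : R) := c * z ^+ e i.
have dphi : is_derive (v 0 i) 1 phi ((e i)%:R * mon (shrink e i) v).
  have hX : is_derive (v 0 i) 1 (fun z : R => z ^+ e i) ((e i)%:R * (v 0 i) ^+ (e i).-1).
    have h := derivableP (@exprn_derivable R (e i) (v 0 i) 1).
    by apply: (is_derive_eq h); rewrite exp_derive /GRing.scale/= mulr1.
  have h := is_deriveZ c hX.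
  apply: (is_derive_eq h); rewrite /GRing.scale/=.
  rewrite /mon (bigD1 i)//= /shrink eqxx subn1.
  have -> : \prod_(j | j != i) v 0 j ^+ (e j - (j == i)) = c.
    by apply: eq_bigr => j /negbTE->; rewrite subn0.
  ring.
have E : (fun h : R => h^-1 *: ((mon e \o shift v) (h *: (delta_mx 0 i : 'rV[R]_n)) - mon e v)) =
   (fun h : R => h^-1 *: ((phi \o shift (v 0 i)) (h *: 1) - phi (v 0 i))).
  by apply: funext => h /=; rewrite monE mon0 /phi /GRing.scale/= mulr1.
case: dphi => d1 d2; split; first by rewrite /derivable E; exact: d1.
by rewrite /derive E; exact: d2.
Qed.

Lemma partial_mon e i : partial (mon e) i = fun v => (e i)%:R * mon (shrink e i) v.
Proof. by apply: funext => v; have := mon_is_derive e i v => -[_]. Qed.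

Lemma partial2_mon e i j : partial (partial (mon e) i) j =
  fun v => (e i)%:R * ((shrink e i j)%:R * mon (shrink (shrink e i) j) v).
Proof.
apply: funext => v; rewrite /partial.
have d1 : is_derive v (delta_mx 0 j : 'rV[R]_n) (mon (shrink e i)) _ := mon_is_derive (shrink e i) j v.
have := partial_mon e i; rewrite /partial => ->.
have [h1 h2] := d1.
by rewrite deriveZ//= h2.
Qed.

Lemma continuous_mon e : continuous (mon e).
Proof.
move=> v; have FF : Filter (nbhs v) := nbhs_filter v.
apply: cvg_prodr => j; apply: (cvg_comp (fun v : 'rV[R]_n => v 0 j) (fun z : R => z ^+ e j)).
  exact: continuous_entry.
exact: exprn_continuous.
Qed.

Lemma C2_mon e : C2 (mon e).
Proof.
have cc (c : R) (f : 'rV[R]_n -> R) : continuous f -> continuous (fun v => c * f v).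
  by move=> cf v; have FF : Filter (nbhs v) := nbhs_filter v; apply: cvgM; [exact: cvg_cst|exact: cf].
split.
- exact: continuous_mon.
- by move=> i v; case: (mon_is_derive e i v).
- by move=> i; rewrite partial_mon; apply: cc; exact: continuous_mon.
- move=> i j v; rewrite partial_mon; apply: derivableZ.
  by case: (mon_is_derive (shrink e i) j v).
- by move=> i j; rewrite partial2_mon; apply: (cc); apply: (cc); exact: continuous_mon.
Qed.

Lemma mon01 e v : rcube v -> 0 <= mon e v <= 1.
Proof.
move=> cv; apply: prod01 => j; have /andP[h0 h1] := cv j.
by rewrite exprn_ge0//= exprn_ile1.
Qed.

(* The generator does not raise the degree: [v_i d_i^2] lowers it by one and the factor [1 - |v|] raises it by at most one. *)
Lemma genL_mon (a : nat -> R) (ainf : R) (D : nat) : exists2 C : R, 0 <= C &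
  forall e, (\sum_j e j <= D)%N -> exists r : seq (R * ('I_n -> nat)),
    [/\ all (fun y => (\sum_j y.2 j <= D)%N) r, \sum_(y <- r) `|y.1| <= C &
        forall v, genL a ainf (mon e) v = \sum_(y <- r) y.1 * mon y.2 v].
Proof.
pose C := \sum_(i < n) ((`|a i| + `|ainf|) * D%:R + D%:R ^+ 2) * (n%:R + 1).
exists C.
  apply: sumr_ge0 => i _; apply: mulr_ge0; last by rewrite addr_ge0.
  by apply: addr_ge0; [apply: mulr_ge0 => //; exact: addr_ge0|exact: exprn_ge0].
move=> e eD.
pose b (i : 'I_n) : R := a i * (e i)%:R + (e i)%:R * (e i).-1%:R.
(* [- ainf v_i d_i] reproduces the monomial. Both [a_i d_i] and [v_i d_i^2] give a multiple of the
   shrunk monomial, together [b i], and the factor [1 - |v|] then adds one grown term per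
   coordinate. *)
pose ri (i : 'I_n) : seq (R * ('I_n -> nat)) :=
  if e i == 0%N then [::] else
  (- ainf * (e i)%:R, e) :: (b i, shrink e i) ::
    [seq (- b i, grow (shrink e i) j 1) | j <- index_enum 'I_n].
exists (flatten [seq ri i | i <- index_enum 'I_n]); split.
- suff h (s : seq 'I_n) : all (fun y : R * ('I_n -> nat) => (\sum_j y.2 j <= D)%N)
    (flatten [seq ri i | i <- s]) by exact: h.
  elim: s => //= i s ih; rewrite all_cat ih andbT /ri.
  case: ifP => //= /negbT; rewrite -lt0n => ei; rewrite eD/= all_map.
  have ds := deg_shrink ei; rewrite -ds in eD; rewrite (ltnW eD)/=.
  by apply/allP => j _; rewrite /= deg_grow addn1.
- rewrite big_flatten big_map; apply: ler_sum => i _; rewrite /ri.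
  have pn : 0 <= (n%:R + 1 : R) by rewrite addr_ge0.
  have q0 : 0 <= ((`|a i| + `|ainf|) * D%:R + D%:R ^+ 2) * (n%:R + 1).
    apply: mulr_ge0 pn; apply: addr_ge0; first by apply: mulr_ge0 => //; exact: addr_ge0.
    exact: exprn_ge0.
  case: ifP => [_|_]; first by rewrite big_nil; exact: q0.
  rewrite !big_cons big_map/= sumr_const -[X in _ + (_ + X)]mulr_natl.
  rewrite (_ : #|_| = n) ?card_ord// normrN.
  have eiD : (e i)%:R <= D%:R :> R by rewrite ler_nat (leq_trans (deg_coord e i)).
  have eiD1 : (e i).-1%:R <= D%:R :> R by rewrite ler_nat (leq_trans (leq_pred _))// (leq_trans (deg_coord e i)).
  have hb : `|b i| <= `|a i| * D%:R + D%:R ^+ 2.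
    apply: le_trans (ler_normD _ _) _; rewrite !normrM !normr_nat expr2.
    by apply: lerD; apply: ler_pM.
  have ha : `|- ainf * (e i)%:R| <= `|ainf| * D%:R by rewrite normrM normrN normr_nat ler_wpM2l.
  have aux (x1 x2 x3 x4 u : R) : 0 <= x3 -> x1 <= x4 -> x2 <= x3 -> 0 <= u ->
      x2 + (x1 + u * x1) <= (x3 + x4) * (u + 1) by clear; nra.
  have -> : (`|a i| + `|ainf|) * D%:R + D%:R ^+ 2 = `|ainf| * D%:R + (`|a i| * D%:R + D%:R ^+ 2) by ring.
  by apply: aux => //; rewrite mulr_ge0.
- move=> v; rewrite /genL big_flatten big_map; apply: eq_bigr => i _; rewrite /ri.
  rewrite partial2_mon partial_mon; case: ifP => [/eqP ei|/negbT ei].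
    by rewrite big_nil ei !mul0r !mulr0 addr0.
  rewrite !big_cons big_map/=.
  have h1 : mon e v = v 0 i * mon (shrink e i) v.
    rewrite -[v 0 i]expr1 -mon_grow; congr mon; apply: funext => j; rewrite /grow /shrink.
    by have [->|_] := eqVneq j i; rewrite ?mul0n ?subn0 ?addn0// muln1 subnK// lt0n.
  have -> : \sum_(j <- index_enum 'I_n) - b i * mon (grow (shrink e i) j 1) v =
     - b i * (\sum_k v 0 k) * mon (shrink e i) v.
    rewrite -mulrA mulr_suml mulr_sumr; apply: eq_bigr => j _.
    by rewrite mon_grow expr1.
  have -> : (shrink e i i)%:R = (e i).-1%:R :> R by rewrite /shrink eqxx subn1.
  (* For [e i = 1] the truncated subtraction in the second [shrink] gives the wrong monomial, but
     then the factor is 0. *)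
  have h2 : (e i).-1%:R * (v 0 i * mon (shrink (shrink e i) i) v) = (e i).-1%:R * mon (shrink e i) v.
    case: (posnP (e i).-1) => [->|e1]; first by rewrite !mul0r.
    congr (_ * _); rewrite -[v 0 i]expr1 -mon_grow; congr mon; apply: funext => j; rewrite /grow /shrink.
    have [->|_] := eqVneq j i; rewrite ?mul0n ?subn0 ?addn0// muln1 subnK//.
    by rewrite subn1.
  set S := \sum_k v 0 k; rewrite h1 /b.
  have -> : (1 - S) * v 0 i * ((e i)%:R * ((e i).-1%:R * mon (shrink (shrink e i) i) v)) =
     (1 - S) * (e i)%:R * ((e i).-1%:R * (v 0 i * mon (shrink (shrink e i) i) v)) by ring.
  rewrite h2; ring.
Qed.

End monomials.

Section uniqueness.
Variables (R : realType) (T : R).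
Hypothesis T0 : 0 < T.
Variables (n : nat) (a : nat -> R) (ainf : R) (P Q : probability (OmegaB T) R).

Definition pm (e : 'I_n -> nat) (t : R) (w : OmegaB T) : R := mon e (firstm n (opath w t)).

Local Notation M e := (Mf (T := T) (@firstm R n) (mon e) (genL a ainf (mon e))).

Lemma pm_bmf e t : 0 <= t <= T -> bmf (pm e t).
Proof.
by move=> tT; apply: (row_fun_bmf (@lip_row_firstm R n)) => //; exact: continuous_mon.
Qed.

Lemma pm01 e t w : 0 <= t <= T -> 0 <= pm e t w <= 1.
Proof.
by move=> tT; apply: mon01; apply: (@lip_row_firstm R n).1; exact: path_Delta.
Qed.

Lemma tprod_filt s l : 0 <= s <= T -> all (fun y => 0 <= y.1.1 <= s) l ->
  forall B : set R, measurable B -> filt s (tprod (T := T) l @^-1` B).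
Proof.
move=> sT hl; apply: adapted_filt => //; first exact: (bmf_tprod T0 l).1.
by move=> w v h; apply: eq_big_seq => y /(allP hl) yl; rewrite h.
Qed.

Lemma Ex_Mr (P0 : probability (OmegaB T) R) (b : OmegaB T -> R) e k t (r : seq (R * ('I_n -> nat))) :
  bmf b -> 0 <= t <= T -> (forall v, genL a ainf (mon e) v = \sum_(y <- r) y.1 * mon y.2 v) ->
  Ex P0 (fun w => b w * Mr (@firstm R n) (mon e) (genL a ainf (mon e)) k t w) =
  Ex P0 (fun w => b w * pm e t w) -
  \sum_(0 <= j < idx T k t) T / 2 ^+ k * \sum_(y <- r) y.1 * Ex P0 (fun w => b w * pm y.2 (gridt T k j) w).
Proof.
move=> bb tT hr; have it := idx_le T0 k tT.
have bp e' (j : 'I_(idx T k t)) : bmf (fun w => b w * pm e' (gridt T k j) w).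
  apply: bmfM => //; apply: pm_bmf; apply: gridt_in => //; apply: leq_trans it; exact: ltnW.
have bs (j : 'I_(idx T k t)) : bmf (fun w => \sum_(y <- r) y.1 * (b w * pm y.2 (gridt T k j) w)).
  by apply: bmf_sum => y; apply: bmfZ; exact: bp.
have -> : (fun w => b w * Mr (@firstm R n) (mon e) (genL a ainf (mon e)) k t w) =
   (fun w => b w * pm e t w - \sum_(j < idx T k t) T / 2 ^+ k * \sum_(y <- r) y.1 * (b w * pm y.2 (gridt T k j) w)).
  apply: funext => w; rewrite /Mr /riem mulrBr; congr (_ - _).
  rewrite mulr_sumr; apply: eq_bigr => j _; rewrite hr mulrCA; congr (_ * _).
  by rewrite mulr_sumr; apply: eq_bigr => y _; rewrite mulrCA.
rewrite ExB; first last.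
- by apply: bmf_sum => j; apply: bmfZ; exact: bs.
- by apply: bmfM => //; exact: pm_bmf.
congr (_ - _); rewrite Ex_sum; last by move=> j; apply: bmfZ; exact: bs.
rewrite big_mkord; apply: eq_bigr => j _; rewrite ExZ//; congr (_ * _).
rewrite Ex_sum; last by move=> y; apply: bmfZ; exact: bp.
by apply: eq_bigr => y _; rewrite ExZ.
Qed.

Definition gap (b : OmegaB T -> R) e t : R :=
  Ex P (fun w => b w * pm e t w) - Ex Q (fun w => b w * pm e t w).

Lemma gap_le2 b e t : bmf b -> (forall w, 0 <= b w <= 1) -> 0 <= t <= T -> `|gap b e t| <= 2.
Proof.
move=> bb b01 tT; apply: le_trans (ler_normB _ _) _.
have h (P0 : probability (OmegaB T) R) : `|Ex P0 (fun w => b w * pm e t w)| <= 1.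
  apply: Ex_abs_le => [|w]; first by apply: bmfM => //; exact: pm_bmf.
  have /andP[b0 b1] := b01 w; have /andP[p0 p1] := pm01 e w tT.
  by rewrite ger0_norm ?mulr_ge0// mulr_ile1.
by have := lerD (h P) (h Q).
Qed.

Hypothesis martP : forall e, is_martingale P (M e).
Hypothesis martQ : forall e, is_martingale Q (M e).

Section growth.
Variables (l : seq ((R * nat) * (nat * nat))) (D : nat) (C : R).
Hypothesis C0 : 0 <= C.
Hypothesis hC : forall e : 'I_n -> nat, (\sum_j e j <= D)%N -> exists r : seq (R * ('I_n -> nat)),
    [/\ all (fun y => (\sum_j y.2 j <= D)%N) r, \sum_(y <- r) `|y.1| <= C &
        forall v, genL a ainf (mon e) v = \sum_(y <- r) y.1 * mon y.2 v].

Local Notation b := (tprod (T := T) l).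

(** With Riemann sums the expectation is exchanged with finite sums in place of a Fubini theorem
    over time and paths. *)
Lemma Mr_gap (P0 : probability (OmegaB T) R) e s t : (forall e, is_martingale P0 (M e)) ->
  0 <= s -> s <= t -> t <= T -> all (fun y => 0 <= y.1.1 <= s) l ->
  Ex P0 (fun w => b w * Mr (@firstm R n) (mon e) (genL a ainf (mon e)) k t w) -
  Ex P0 (fun w => b w * Mr (@firstm R n) (mon e) (genL a ainf (mon e)) k s w) @[k --> \oo] --> (0 : R).
Proof.
move=> mart s0 st tT hl.
have sT : 0 <= s <= T by rewrite s0 (le_trans st).
have tT' : 0 <= t <= T by rewrite tT (le_trans s0).
have lV := @lip_row_firstm R n.
have cm := @continuous_mon R n e.
have cg : continuous (genL a ainf (mon e)) by apply: continuous_genL; exact: C2_mon.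
have bb := bmf_tprod T0 l.
have lim r : 0 <= r <= T -> Ex P0 (fun w => b w * Mr (@firstm R n) (mon e) (genL a ainf (mon e)) k r w) @[k --> \oo] -->
   Ex P0 (fun w => b w * M e r w).
  move=> rT; have [K hK] := Mr_bound T0 lV cm cg.
  apply: (Ex_cvg (M := 1 * K)) => [k|k w|w].
  - by apply: bmfM => //; exact: Mr_bmf.
  - rewrite normrM; apply: ler_pM => //; last exact: hK.
    by have /andP[h0 h1] := tprod01 l w; rewrite ger0_norm.
  - by apply: cvgM; [exact: cvg_cst|exact: Mr_cvg].
rewrite -(subrr (Ex P0 (fun w => b w * M e s w))).
apply: cvgB; last exact: lim.
rewrite -(martingale_test T0 lV cm cg (mart e) s0 st tT (tprod01 l) (tprod_filt sT hl)).
exact: lim.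
Qed.

(** Integrated form of the moment equations: the derivative of a gap is a combination of gaps of
    degree at most [D], with coefficients of total size at most [C]. *)
Lemma gap_growth s t (B : R) : 0 <= s -> s <= t -> t <= T -> all (fun y => 0 <= y.1.1 <= s) l -> 0 <= B ->
  (forall e : 'I_n -> nat, (\sum_j e j <= D)%N -> gap b e s = 0) ->
  (forall (e : 'I_n -> nat) u, (\sum_j e j <= D)%N -> s <= u <= t -> `|gap b e u| <= B) ->
  forall e : 'I_n -> nat, (\sum_j e j <= D)%N -> `|gap b e t| <= C * (t - s) * B.
Proof.
move=> s0 st tT hl B0 gs hB e eD; have [r [rD rC hr]] := hC eD.
have sT : 0 <= s <= T by rewrite s0 (le_trans st).
have tT' : 0 <= t <= T by rewrite tT (le_trans s0).
have bb := bmf_tprod T0 l.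
pose F k j := T / 2 ^+ k * \sum_(y <- r) y.1 * gap b y.2 (gridt T k j).
pose G k := \sum_(idx T k s <= j < idx T k t) F k j.
have hG : G k @[k --> \oo] --> gap b e t.
  pose X (P0 : probability (OmegaB T) R) k r0 :=
    Ex P0 (fun w => b w * Mr (@firstm R n) (mon e) (genL a ainf (mon e)) k r0 w).
  have h0 : (X P k t - X P k s) - (X Q k t - X Q k s) @[k --> \oo] --> (0 - 0 : R).
    by apply: cvgB; exact: Mr_gap.
  have h1 : gap b e t - ((X P k t - X P k s) - (X Q k t - X Q k s)) @[k --> \oo] --> gap b e t - (0 - 0).
    by apply: cvgB => //; exact: cvg_cst.
  rewrite subrr subr0 in h1.
  have -> : G = fun k => gap b e t - ((X P k t - X P k s) - (X Q k t - X Q k s)); last exact: h1.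
    apply: funext => k; rewrite /X.
    rewrite !(Ex_Mr _ _ bb _ hr)//.
    have e0 := gs e eD; rewrite /gap in e0; move/eqP: e0; rewrite subr_eq0 => /eqP e0.
    rewrite e0 /gap.
    have i1 := idx_mono T0 k st.
    have sp (f : nat -> R) : \sum_(0 <= j < idx T k t) f j =
      \sum_(0 <= j < idx T k s) f j + \sum_(idx T k s <= j < idx T k t) f j.
      by rewrite -big_cat_nat.
    rewrite !sp.
    rewrite (_ : G k = \sum_(idx T k s <= j < idx T k t) T / 2 ^+ k * (\sum_(y <- r) y.1 * Ex P (fun w => b w * pm y.2 (gridt T k j) w)) -
      \sum_(idx T k s <= j < idx T k t) T / 2 ^+ k * (\sum_(y <- r) y.1 * Ex Q (fun w => b w * pm y.2 (gridt T k j) w))); last first.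
      rewrite -sumrB; apply: eq_bigr => j _; rewrite -mulrBr /F; congr (_ * _).
      by rewrite -sumrB; apply: eq_bigr => y _; rewrite -mulrBr.
    ring.
have Fb k j (K : R) : 0 <= K -> (forall e' : 'I_n -> nat, (\sum_j e' j <= D)%N -> `|gap b e' (gridt T k j)| <= K) ->
    `|F k j| <= T / 2 ^+ k * (C * K).
  move=> K0 hK; rewrite normrM ger0_norm; last by rewrite divr_ge0 ?exprn_ge0 ?(ltW T0).
  apply: ler_wpM2l; first by rewrite divr_ge0 ?exprn_ge0 ?(ltW T0).
  apply: le_trans (ler_norm_sum _ _ _) _.
  apply: (@le_trans _ _ ((\sum_(y <- r) `|y.1|) * K)); last exact: ler_wpM2r.
  elim: (r) rD => [_|y r' ih /= /andP[yD /ih h]]; first by rewrite !big_nil mul0r.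
  by rewrite !big_cons mulrDl lerD// normrM ler_wpM2l// hK.
have Gb k : `|G k| <= C * (t - s) * B + T / 2 ^+ k * (C * 2).
  have p0 : (0 : R) < 2 ^+ k by rewrite exprn_gt0.
  have tk : 0 <= T / 2 ^+ k * (C * 2).
    by apply: mulr_ge0; [apply: divr_ge0; exact: ltW|exact: mulr_ge0].
  have CB : 0 <= C * (t - s) * B by rewrite !mulr_ge0// subr_ge0.
  have it := idx_le T0 k tT'.
  rewrite /G; have [h|h] := ltnP (idx T k s) (idx T k t); last by rewrite big_geq// normr0 addr_ge0.
  rewrite big_ltn// addrC; apply: le_trans (ler_normD _ _) _; apply: lerD; last first.
    apply: Fb => // e' _; apply: gap_le2 => //; first exact: tprod01.
    by apply: gridt_in => //; apply: leq_trans it; exact: ltnW.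
  apply: le_trans (ler_norm_sum _ _ _) _.
  have /andP[t1 _] := idx_itv T0 k tT'; have /andP[_ s1] := idx_itv T0 k sT.
  apply: (@le_trans _ _ (\sum_((idx T k s).+1 <= j < idx T k t) T / 2 ^+ k * (C * B))).
    apply: ler_sum_nat => j /andP[sj jt]; apply: Fb => // e' e'D; apply: hB => //.
    rewrite /gridt; apply/andP; split.
      rewrite mulrA ler_pdivlMr// mulrC.
      have -> : 2 ^+ k * s = T * (2 ^+ k * (s / T)).
        by have : T != 0 by [rewrite gt_eqF]; move=> ?; field.
      apply: ler_wpM2l; first exact: ltW.
      by apply: le_trans (ltW s1) _; rewrite ler_nat.
    rewrite mulrA ler_pdivrMr// [t * _]mulrC.
    have -> : 2 ^+ k * t = T * (2 ^+ k * (t / T)).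
      by have : T != 0 by [rewrite gt_eqF]; move=> ?; field.
    apply: ler_wpM2l; first exact: ltW.
    by apply: le_trans t1; rewrite ler_nat ltnW.
  rewrite sumr_const_nat -[leLHS]mulr_natl.
  rewrite [leLHS](_ : _ = C * ((idx T k t - (idx T k s).+1)%:R * (T / 2 ^+ k)) * B); last by ring.
  apply: ler_wpM2r => //; apply: ler_wpM2l => //.
  rewrite natrB// mulrA ler_pdivrMr//.
  have -> : (t - s) * 2 ^+ k = (2 ^+ k * (t / T) - 2 ^+ k * (s / T)) * T.
    by have : T != 0 by [rewrite gt_eqF]; move=> ?; field.
  by apply: ler_wpM2r; [exact: ltW|apply: lerB => //; exact: ltW].
apply/ler_addgt0Pr => d d0.
have h2 : T / 2 ^+ k * (C * 2) @[k --> \oo] --> (0 : R).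
  rewrite -[X in _ --> X](mul0r (C * 2)); apply: cvgM; last exact: cvg_cst.
  rewrite -[X in _ --> X](mulr0 T); apply: cvgM; first exact: cvg_cst.
  by under eq_fun do rewrite -exprVn; apply: cvg_expr; rewrite ger0_norm//; lra.
have /cvgrPdist_le/(_ d d0)[k0 _ hk] := h2.
move/cvg_norm/cvgr_to_le: hG; apply; exists k0 => // k /= kk.
apply: le_trans (Gb k) _; rewrite lerD2l; have := hk k kk.
by rewrite sub0r normrN; apply: le_trans; exact: ler_norm.
Qed.

(* Over a time span [h] with [C h <= 1/2], every bound on the gaps can be halved. *)
Lemma gap_short s t : 0 <= s -> s <= t -> t <= T -> all (fun y => 0 <= y.1.1 <= s) l ->
  C * (t - s) <= 2^-1 ->
  (forall e : 'I_n -> nat, (\sum_j e j <= D)%N -> gap b e s = 0) ->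
  forall e : 'I_n -> nat, (\sum_j e j <= D)%N -> gap b e t = 0.
Proof.
move=> s0 st tT hl Ch gs.
have H (k : nat) : forall (e : 'I_n -> nat) u, (\sum_j e j <= D)%N -> s <= u <= t -> `|gap b e u| <= 2 * 2^-1 ^+ k.
  elim: k => [|k ih] e u eD /andP[su ut].
    rewrite expr0 mulr1; apply: gap_le2; [exact: bmf_tprod|exact: tprod01|].
    by rewrite (le_trans s0 su) (le_trans ut tT).
  have B0 : 0 <= 2 * 2^-1 ^+ k :> R by rewrite mulr_ge0// exprn_ge0// invr_ge0.
  apply: le_trans (gap_growth s0 su (le_trans ut tT) hl B0 gs _ eD) _ => [e' v e'D /andP[sv vu]|].
    by apply: ih => //; rewrite sv (le_trans vu).
  rewrite exprS [leRHS]mulrCA; apply: ler_wpM2r => //.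
  by apply: le_trans Ch; apply: ler_wpM2l => //; rewrite lerB.
move=> e eD; apply/eqP; rewrite -normr_le0; apply/ler_addgt0Pr => d d0; rewrite add0r.
have h2 : 2 * 2^-1 ^+ k @[k --> \oo] --> (0 : R).
  rewrite -[X in _ --> X](mulr0 2); apply: cvgM; first exact: cvg_cst.
  by apply: cvg_expr; rewrite ger0_norm//; lra.
have /cvgrPdist_le/(_ d d0)[k0 _ /(_ k0 (leqnn k0))] := h2.
rewrite sub0r normrN => h; have := H k0 e t eD; rewrite st lexx => /(_ isT) /le_trans; apply.
by apply: le_trans h; exact: ler_norm.
Qed.

Lemma gap_propagation s t : 0 <= s -> s <= t -> t <= T -> all (fun y => 0 <= y.1.1 <= s) l ->
  (forall e : 'I_n -> nat, (\sum_j e j <= D)%N -> gap b e s = 0) ->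
  forall e : 'I_n -> nat, (\sum_j e j <= D)%N -> gap b e t = 0.
Proof.
move=> s0 st tT hl gs.
(* Length of the short spans, with [C * h <= 1/2]; finitely many of them lead from [s] to [t]. *)
pose h : R := (2 * (C + 1))^-1.
have C1 : 0 < C + 1 by rewrite ltr_wpDl.
have h0 : 0 < h by rewrite invr_gt0 mulr_gt0.
have Ch : C * h <= 2^-1.
  rewrite /h invfM mulrCA ler_piMr// ler_pdivrMr// mul1r; lra.
have H (N : nat) : forall u, s <= u -> u <= t -> u <= s + N%:R * h ->
    forall e : 'I_n -> nat, (\sum_j e j <= D)%N -> gap b e u = 0.
  elim: N => [|N ih] u su ut uN.
    have -> : u = s by apply/eqP; rewrite eq_le su andbT; move: uN; rewrite mul0r addr0.
    exact: gs.
  have [uN'|Nu] := leP u (s + N%:R * h); first exact: ih.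
  have Nh : 0 <= N%:R * h by rewrite mulr_ge0// ltW.
  have sN : s <= s + N%:R * h by rewrite lerDl.
  apply: (@gap_short (s + N%:R * h) u) => //.
  - by rewrite addr_ge0.
  - exact: ltW.
  - exact: le_trans ut tT.
  - apply/allP => y /(allP hl)/andP[-> ys] /=; exact: le_trans sN.
  - apply: le_trans Ch; apply: ler_wpM2l => //.
    by move: uN; rewrite -natr1 mulrDl mul1r; lra.
  - by apply: ih => //; apply: le_trans (ltW Nu) ut.
apply: (H (Num.bound ((t - s) / h))) => //.
rewrite -lerBlDl -ler_pdivrMr//; apply: ltW; apply: archi_boundP.
by rewrite divr_ge0 ?subr_ge0// ltW.
Qed.

End growth.

Definition agree b t := forall e, Ex P (fun w => b w * pm e t w) = Ex Q (fun w => b w * pm e t w).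

(** [C] depends on the degree bound, so each monomial is treated with [D] equal to its own
    degree. *)
Lemma agree_later l s t : 0 <= s -> s <= t -> t <= T -> all (fun y => 0 <= y.1.1 <= s) l ->
  agree (tprod l) s -> agree (tprod l) t.
Proof.
move=> s0 st tT hl h e; have [C C0 hC] := @genL_mon R n a ainf (\sum_j e j)%N.
apply/eqP; rewrite -subr_eq0; apply/eqP.
by apply: (gap_propagation C0 hC s0 st tT hl) => // e' _; rewrite /gap h subrr.
Qed.

(** [psi p q.+1 z = psi p q z - z^p * psi p q z], and [z^p] is absorbed into the monomial. This is
    why agreement is asked for all exponents at once. *)
Lemma agree_psi b t (i : 'I_n) p q : bmf b -> 0 <= t <= T -> agree b t ->
  agree (fun w => psi p q (opath w t i) * b w) t.
Proof.
move=> bb tT h; have bi := @eval_bmf R T T0 t i.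
elim: q => [|q ih] e.
  by under [X in Ex P X]eq_fun do rewrite /psi expr0 mul1r; under [X in Ex Q X]eq_fun do rewrite /psi expr0 mul1r.
have bpsi : bmf (fun w : OmegaB T => psi p q (opath w t i)).
  apply: bmfX; apply: bmfB; first exact: bmf_cst.
  exact: bmfX.
have E (P0 : probability (OmegaB T) R) : Ex P0 (fun w => psi p q.+1 (opath w t i) * b w * pm e t w) =
   Ex P0 (fun w => psi p q (opath w t i) * b w * pm e t w) -
   Ex P0 (fun w => psi p q (opath w t i) * b w * pm (grow e i p) t w).
  rewrite -ExB; [|by apply: bmfM; [exact: bmfM|exact: pm_bmf]..].
  by apply: eq_Ex => w; rewrite /pm mon_grow !mxE /psi exprS; ring.
by rewrite !E ih ih.
Qed.

Variable y : nat -> R.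
Hypothesis startP : P [set w : OmegaB T | forall i, opath w 0 i = y i] = 1%E.
Hypothesis startQ : Q [set w : OmegaB T | forall i, opath w 0 i = y i] = 1%E.
Hypothesis zeroP : forall t i, 0 <= t <= T -> (n <= i)%N -> P [set w : OmegaB T | opath w t i = 0] = 1%E.
Hypothesis zeroQ : forall t i, 0 <= t <= T -> (n <= i)%N -> Q [set w : OmegaB T | opath w t i = 0] = 1%E.

(** A coordinate that vanishes almost surely contributes the constant factor [psi p q 0] under both
    laws. *)
Lemma agree_psi_zero b t i p q : bmf b -> 0 <= t <= T -> (n <= i)%N -> agree b t ->
  agree (fun w => psi p q (opath w t i) * b w) t.
Proof.
move=> bb tT ni h e.
have bi := @eval_bmf R T T0 t i.
have bpm := pm_bmf e tT.
have bpsi : bmf (fun w : OmegaB T => psi p q (opath w t i)).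
  apply: bmfX; apply: bmfB; first exact: bmf_cst.
  exact: bmfX.
have E (P0 : probability (OmegaB T) R) : P0 [set w : OmegaB T | opath w t i = 0] = 1%E ->
   Ex P0 (fun w => psi p q (opath w t i) * b w * pm e t w) = psi p q 0 * Ex P0 (fun w => b w * pm e t w).
  move=> hz; rewrite -ExZ; last exact: bmfM.
  apply: (@Ex_as _ _ _ P0 _ _ [set w : OmegaB T | opath w t i = 0]) => //.
  - exact: measurable_eval.
  - by apply: bmfM => //; exact: bmfM.
  - by apply: bmfZ; exact: bmfM.
  - by move=> w /= ->; rewrite mulrA.
by rewrite (E P (zeroP tT ni)) (E Q (zeroQ tT ni)) h.
Qed.

Lemma agree_start : agree (tprod [::]) 0.
Proof.
move=> e; have t0 : 0 <= (0 : R) <= T by rewrite lexx ltW.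
have E (P0 : probability (OmegaB T) R) : P0 [set w : OmegaB T | forall i, opath w 0 i = y i] = 1%E ->
   Ex P0 (fun w => tprod [::] w * pm e 0 w) = mon e (firstm n y).
  move=> hz; rewrite -[RHS](Ex_cst P0).
  apply: (@Ex_as _ _ _ P0 _ _ _ (measurable_start T0 y) hz) => //.
  - by apply: bmfM; [exact: bmf_tprod|exact: pm_bmf].
  - exact: bmf_cst.
  - move=> w hw; rewrite /tprod big_nil mul1r /pm; congr mon.
    by apply/rowP => j; rewrite !mxE hw.
by rewrite (E P startP) (E Q startQ).
Qed.

(** The latest time stands at the head. Agreement is carried up to that time, multiplied there by
    the head factor, and carried on to [t]. *)
Lemma agree_sorted l t : sorted (fun u v : (R * nat) * (nat * nat) => v.1.1 <= u.1.1) l ->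
  all (fun u => 0 <= u.1.1 <= t) l -> 0 <= t <= T -> agree (tprod l) t.
Proof.
elim: l t => [|u l ih] t sl hl /andP[t0 tT].
  by apply: (@agree_later [::] 0 t) => //; exact: agree_start.
move: hl => /= /andP[/andP[u0 ut] hl].
have tr : transitive (fun u v : (R * nat) * (nat * nat) => v.1.1 <= u.1.1).
  by move=> a1 a2 a3 h1 h2; exact: le_trans h2 h1.
have hu : all (fun v => 0 <= v.1.1 <= u.1.1) l.
  apply/allP => v vl; have /andP[-> _] := allP hl v vl.
  by have /allP/(_ v vl) := order_path_min tr sl.
have uT : 0 <= u.1.1 <= T by rewrite u0 (le_trans ut).
have hl' : agree (tprod l) u.1.1 by apply: ih => //; exact: path_sorted sl.
have E : tprod (T := T) (u :: l) = (fun w => psi u.2.1 u.2.2 (opath w u.1.1 u.1.2) * tprod l w).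
  by apply: funext => w; rewrite /tprod big_cons.
apply: (@agree_later (u :: l) u.1.1 t) => //=; first by rewrite u0 lexx.
rewrite E; have [iu|iu] := ltnP u.1.2 n.
  by apply: (@agree_psi (tprod l) u.1.1 (Ordinal iu)) => //; exact: bmf_tprod.
by apply: agree_psi_zero => //; exact: bmf_tprod.
Qed.

Lemma tprod_unique l : all (fun u => 0 <= u.1.1 <= T) l -> Ex P (tprod l) = Ex Q (tprod l).
Proof.
(* A product does not depend on the order of its factors, so they may be sorted by decreasing
   time. *)
move=> hl; pose le (u v : (R * nat) * (nat * nat)) := v.1.1 <= u.1.1.
have tot : total le by move=> u v; exact: le_total.
have E : tprod (T := T) l = tprod (sort le l).
  by apply: funext => w; apply: perm_big; rewrite perm_sym perm_sort.
have hs : all (fun u => 0 <= u.1.1 <= T) (sort le l) by rewrite all_sort.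
have TT : 0 <= T <= T by rewrite lexx ltW.
have := agree_sorted (sort_sorted tot l) hs TT (fun=> 0%N).
rewrite -E; have m1 w : pm (fun=> 0%N) T w = 1 by rewrite /pm /mon big1// => j _; rewrite expr0.
by under [X in Ex P X]eq_fun do rewrite m1 mulr1; under [X in Ex Q X]eq_fun do rewrite m1 mulr1.
Qed.

Theorem law_unique (f : OmegaB T -> R) : bmf f -> Ex P f = Ex Q f.
Proof.
move=> bf.
have PQ (A : set (OmegaB T)) : measurable A -> P A = Q A.
  move=> mA; have fA := measurable_filt T0 mA.
  have h : Ex P \1_A = Ex Q \1_A.
    have := filt_determined T0 (P := P) (P' := Q) (X := fun=> 1) (X' := fun=> 1) (bmf_cst _ _) (bmf_cst _ _) _ fA.
    under [X in Ex P X]eq_fun do rewrite mul1r; under [X in Ex Q X]eq_fun do rewrite mul1r.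
    apply=> l hl; under [X in Ex P X]eq_fun do rewrite mul1r; under [X in Ex Q X]eq_fun do rewrite mul1r.
    exact: tprod_unique.
  move: h; rewrite !Ex_indic// => h.
  have fP : P A \is a fin_num by exact: fin_num_measure.
  have fQ : Q A \is a fin_num by exact: fin_num_measure.
  by rewrite -(fineK fP) -(fineK fQ) h.
rewrite /Ex /Rintegral; congr fine; apply: eq_measure_integral => A mA _; exact: PQ.
Qed.

End uniqueness.

(** * Lumping coordinates *)

Section lumping.
Variable R : realType.
Implicit Types a b : nat -> R.

Lemma xnE a m i : xn a m.+1 i = if (i < m)%N then a i else if i == m then tl a m else 0.
Proof. by []. Qed.

Lemma xn_zero m : xn (fun=> 0 : R) m.+1 = fun=> 0.
Proof.
apply: funext => i; rewrite xnE; case: ifP => // _; case: ifP => // _.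
rewrite /tl; under eq_fun do rewrite big1//; exact: lim_cst.
Qed.

Lemma sum_support (m N : nat) (f : nat -> R) : (forall i, 0 <= f i) -> (forall i, (m < i)%N -> f i = 0) ->
  \sum_(i < N) f i <= \sum_(i < m) f i + f m.
Proof.
move=> f0 fz; rewrite -(big_mkord xpredT f); have -> : \sum_(i < m) f i + f m = \sum_(0 <= i < m.+1) f i.
  by rewrite big_nat_recr//= big_mkord.
apply: (@le_trans _ _ (\sum_(0 <= i < m.+1 + N) f i)).
  rewrite [leRHS](big_cat_nat (n := N))//=; last exact: leq_addl.
  by rewrite lerDl sumr_ge0.
rewrite (big_cat_nat (n := m.+1))//=; last exact: leq_addr.
suff -> : \sum_(m.+1 <= i < m.+1 + N) f i = 0 by rewrite addr0.
by rewrite big_nat_cond big1// => i /andP[/andP[mi _] _]; exact: fz.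
Qed.

Lemma xn_Delta a m : in_Delta a -> in_Delta (xn a m.+1).
Proof.
move=> ha; have sa := Delta_summable ha.
apply: in_Delta_intro => [i|N]; first exact: xn_ge0.
apply: le_trans (@sum_support m N (xn a m.+1) _ _) _ => [i|i mi|].
- exact: xn_ge0.
- by rewrite xnE ltnNge (ltnW mi)/= gtn_eqF.
- rewrite !xnE ltnn eqxx; have /andP[_ h] := tl_le1 0 ha.
  apply: le_trans h; rewrite (tl_split sa (leq0n m)) big_mkord.
  by under eq_bigr do rewrite xnE ltn_ord.
Qed.

(** Merging coordinates can only reduce the l^1 distance, so lumped paths stay continuous. *)
Lemma xn_contract a b m : in_Delta a -> in_Delta b -> ld (xn a m.+1) (xn b m.+1) <= ld a b.
Proof.
move=> ha hb; have sa := Delta_summable ha; have sb := Delta_summable hb.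
apply: l1_le => N; apply: le_trans (@sum_support m N (fun i => `|xn a m.+1 i - xn b m.+1 i|) _ _) _ => [//|i mi|].
  by rewrite !xnE ltnNge (ltnW mi)/= gtn_eqF// subrr normr0.
rewrite !xnE ltnn eqxx.
have -> : \sum_(i < m) `|xn a m.+1 i - xn b m.+1 i| = \sum_(i < m) `|a i - b i|.
  by apply: eq_bigr => i _; rewrite !xnE ltn_ord.
have h : \sum_(i < m) `|a i - b i| + `|\sum_(m <= j < K) a j - \sum_(m <= j < K) b j| @[K --> \oo] -->
    \sum_(i < m) `|a i - b i| + `|tl a m - tl b m|.
  by apply: cvgD; [exact: cvg_cst|apply: cvg_norm; apply: cvgB; exact: tl_cvg].
move/cvgr_to_le: h; apply; exists m => // K /= mK.
apply: le_trans (ld_ge K ha hb).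
rewrite -[leRHS](big_mkord xpredT (fun i => `|a i - b i|)) [leRHS](big_cat_nat (n := m))//= big_mkord lerD2l.
by rewrite -sumrB; exact: ler_norm_sum.
Qed.

Lemma tl_xn a m : tl (xn a m.+1) m = tl a m.
Proof.
have h : \sum_(m <= j < N) xn a m.+1 j @[N --> \oo] --> tl a m.
  apply: cvg_near_cst; exists m.+1 => // N /= mN.
  rewrite big_ltn// xnE ltnn eqxx (_ : \sum_(m.+1 <= _ < N) _ = 0) ?addr0//.
  rewrite big_nat_cond big1// => i /andP[/andP[mi _] _].
  by rewrite xnE ltnNge (ltnW mi)/= gtn_eqF.
exact: cvg_lim h.
Qed.

Lemma ld_xn a m : in_Delta a -> ld a (xn a m.+1) <= 2 * tl a m.
Proof.
move=> ha; apply: le_trans (ld_tails m ha (xn_Delta m ha)) _.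
rewrite big1 ?add0r; last by move=> i _; rewrite xnE ltn_ord subrr normr0.
by rewrite tl_xn mulr_natl mulr2n.
Qed.

(** The infinite-dimensional generator on a function of [m] coordinates still involves the total
    mass. Viewed through [keep], such a function lives on [m.+1] lumped coordinates and ignores the
    last one, which carries the remaining mass. *)
Definition keep m (v : 'rV[R]_m.+1) : 'rV[R]_m := \row_j v 0 (widen_ord (leqnSn m) j).

Variables (m : nat) (g : 'rV[R]_m -> R).

Lemma keep_shift (h : R) v (d : 'rV[R]_m.+1) : keep (h *: d + v) = h *: keep d + keep v.
Proof. by apply/rowP => j; rewrite !mxE. Qed.

Lemma keep_delta (i : 'I_m) : keep (delta_mx 0 (widen_ord (leqnSn m) i)) = delta_mx 0 i.
Proof.
by apply/rowP => j; rewrite !mxE !eqxx.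
Qed.

Lemma keep_max : keep (delta_mx 0 ord_max : 'rV[R]_m.+1) = 0.
Proof.
apply/rowP => j; rewrite !mxE eqxx /=.
by have -> : (widen_ord (leqnSn m) j == ord_max) = false by rewrite -(inj_eq val_inj)/= ltn_eqF.
Qed.

Lemma quotient_keep (f : 'rV[R]_m -> R) (v d : 'rV[R]_m.+1) :
  (fun h : R => h^-1 *: (((fun u => f (keep u)) \o shift v) (h *: d) - f (keep v))) =
  (fun h : R => h^-1 *: ((f \o shift (keep v)) (h *: keep d) - f (keep v))).
Proof. by apply: funext => h /=; rewrite keep_shift. Qed.

Lemma derive_keep (f : 'rV[R]_m -> R) v d : derive (fun u => f (keep u)) v d = derive f (keep v) (keep d).
Proof. by rewrite /derive quotient_keep. Qed.

Lemma derivable_keep (f : 'rV[R]_m -> R) v d : derivable f (keep v) (keep d) -> derivable (fun u => f (keep u)) v d.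
Proof. by rewrite /derivable quotient_keep. Qed.

Lemma continuous_keep (f : 'rV[R]_m -> R) : continuous f -> continuous (fun u => f (keep u)).
Proof.
move=> cf v; apply: (@continuous_comp _ _ _ (@keep m) f); last exact: cf.
have FF : Filter (nbhs v) := nbhs_filter v.
apply/cvg_ballP => e e0; have : \forall u \near v, ball v e u by exact: nbhsx_ballx.
by apply: filterS => u [h0 h]; split => // i j; rewrite !mxE.
Qed.

Lemma partial_keep (f : 'rV[R]_m -> R) i :
  partial (fun u => f (keep u)) (widen_ord (leqnSn m) i) = fun v => partial f i (keep v).
Proof. by apply: funext => v; rewrite /partial derive_keep keep_delta. Qed.

Lemma partial_keep_max (f : 'rV[R]_m -> R) : partial (fun u => f (keep u)) ord_max = fun=> 0.
Proof.
apply: funext => v; rewrite /partial derive_keep keep_max.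
by have := is_derive0 f (keep v) => -[_].
Qed.

Lemma C2_keep : C2 g -> C2 (fun u => g (keep u)).
Proof.
have split_ord (i : 'I_m.+1) : (exists j, i = widen_ord (leqnSn m) j) \/ i = ord_max.
  have [im|mi] := ltnP i m; first by left; exists (Ordinal im); apply: val_inj.
  by right; apply: val_inj => /=; apply/eqP; rewrite eqn_leq mi -ltnS ltn_ord.
have der0 (f : 'rV[R]_m -> R) v : derivable f v 0 by have := is_derive0 f v => -[].
move=> [c0 d1 c1 d2 c2]; split.
- exact: continuous_keep.
- move=> i v; apply: derivable_keep; case: (split_ord i) => [[j ->]|->]; first by rewrite keep_delta.
  by rewrite keep_max.
- move=> i; case: (split_ord i) => [[j ->]|->]; first by rewrite partial_keep; exact: (continuous_keep (f := partial g j)).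
  by rewrite partial_keep_max; exact: cst_continuous.
- move=> i j v; case: (split_ord i) => [[k ->]|->]; last by rewrite partial_keep_max; exact: derivable_cst.
  rewrite partial_keep; apply: (derivable_keep (f := partial g k)).
  by case: (split_ord j) => [[l ->]|->]; rewrite ?keep_delta ?keep_max.
- move=> i j; case: (split_ord i) => [[k ->]|->]; last first.
    rewrite partial_keep_max (_ : partial _ _ = fun=> 0); first exact: cst_continuous.
    by apply: funext => v; rewrite /partial; exact: derive_cst.
  rewrite partial_keep; case: (split_ord j) => [[l ->]|->].
    by rewrite (partial_keep (partial g k)); exact: (continuous_keep (f := partial (partial g k) l)).
  by rewrite (partial_keep_max (partial g k)); exact: cst_continuous.
Qed.

Lemma keep_lump a : keep (firstm m.+1 (xn a m.+1)) = firstm m a.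
Proof. by apply/rowP => j; rewrite !mxE xnE /= ltn_ord. Qed.

(** The lumped vector has the total mass of [a], and the derivatives in the last entry vanish; the
    lumped [alpha] of that entry therefore drops out. *)
Lemma LinfE (alpha : nat -> R) (ainf : R) a : in_Delta a ->
  Linf alpha ainf g a = genL (alphan alpha m.+1) ainf (fun u => g (keep u)) (firstm m.+1 (xn a m.+1)).
Proof.
move=> ha; have sa := Delta_summable ha.
have mass : \sum_k firstm m.+1 (xn a m.+1) 0 k = l1 a.
  rewrite l1_tl// (tl_split sa (leq0n m)) big_ord_recr/= row_lump_E/= ltnn big_mkord; congr (_ + _).
  by apply: eq_bigr => k _; rewrite row_lump_E/= ltn_ord.
rewrite /genL mass big_ord_recr/= partial_keep_max.
have -> : partial (fun=> 0) ord_max (firstm m.+1 (xn a m.+1)) = 0 :> R.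
  by rewrite /partial; exact: derive_cst.
rewrite !mulr0 !addr0 /Linf; apply: eq_bigr => i _.
rewrite partial_keep (partial_keep (partial g i)) keep_lump row_lump_E/= ltn_ord.
by rewrite /alphan ltnS ltn_ord addrC [a i * _]mulrC.
Qed.

End lumping.

Section lumped_paths.
Variables (R : realType) (T : R).
Hypothesis T0 : 0 < T.

Lemma path_Delta_all (w : Omega T) t : in_Delta (opath w t).
Proof.
have [tT|nT] := pselect (0 <= t <= T); first exact: path_Delta.
rewrite path_out//; split => [i|N]; first by rewrite lexx ler01.
by rewrite big1 ?ler01.
Qed.

Lemma lump_path m (w : Omega T) : is_path T (fun t => xn (opath w t) m.+1).
Proof.
split=> [t tT|t nT|t tT e e0].
- by apply: xn_Delta; exact: path_Delta.
- by rewrite path_out// xn_zero.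
- have [d d0 hd] := path_cont w tT e0; exists d => // s sT st.
  by apply: le_lt_trans (hd s sT st); apply: xn_contract; exact: path_Delta.
Qed.

Definition lumped m (w : OmegaB T) : OmegaB T := MkOmega (lump_path m w).

Lemma lump_measurable m : measurable_fun setT (lumped m).
Proof.
apply: measurable_to_Omega => // t i tT /=.
have [im|mi] := ltnP i m.+1; last first.
  rewrite (_ : (fun _ => _) = fun=> 0); first exact: measurable_cst.
  by apply: funext => w; rewrite xnE ltnNge (ltnW mi)/= gtn_eqF.
have [+ _] := row_fun_bmf (@lip_row_lump R m) (@continuous_entry R m.+1 (Ordinal im)) tT.
by congr (measurable_fun _ _); apply: funext => w; rewrite mxE.
Qed.

Lemma dist_lump (w : Omega T) (e : R) : 0 < e -> exists m0 : nat, forall m, (m0 <= m)%N ->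
  dist_Omega w (lumped m w) < e.
Proof.
move=> e0; have e4 : 0 < e / 4 by rewrite divr_gt0.
have [m0 hm] := path_unif_tail w e4; exists m0 => m mm.
apply: (@le_lt_trans _ _ (e / 2)); last by lra.
apply: dist_le => // t tT; apply: le_trans (ld_xn m (path_Delta_all w t)) _.
have := hm m t mm tT; lra.
Qed.

Variables (alpha : nat -> R) (ainf : R) (x : nat -> R) (Q : probability (OmegaB T) R).
Hypothesis startQ : Q [set w : OmegaB T | forall i, opath w 0 i = x i] = 1%E.
Hypothesis martQ : forall m (g : 'rV[R]_m.+1 -> R), C2 g ->
  is_martingale Q (Mf (fun a => firstm m.+1 (xn a m.+1)) g (genL (alphan alpha m.+1) ainf g)).

Lemma law_n_martingale n (g : 'rV[R]_n -> R) :
  (fun t (w : OmegaB T) => g (firstm n (opath w t)) -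
    Rintegral lebesgue_measure [set u | 0 <= u <= t] (fun u => Ln alpha ainf g (opath w u))) =
  Mf (@firstm R n) g (genL (alphan alpha n) ainf g).
Proof.
apply: funext => t; apply: funext => w; rewrite /Mf; congr (_ - Rintegral _ _ _).
by apply: funext => u; rewrite LnE.
Qed.

Lemma law_n_monomials n (P : probability (OmegaB T) R) : law_n alpha ainf x n P ->
  forall e, is_martingale P (Mf (@firstm R n) (mon e) (genL (alphan alpha n) ainf (mon e))).
Proof.
by move=> [_ _ h] e; have := h _ (@C2_mon R n e); rewrite law_n_martingale.
Qed.

Lemma lump_law m : exists P : probability (OmegaB T) R, law_n alpha ainf x m.+1 P /\
  forall f, bmf f -> Ex P f = Ex Q (fun w => f (lumped m w)).
Proof.
have ml := lump_measurable m; have [P [PQ EP]] := pushforward_prob Q ml.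
have pre (A : set (OmegaB T)) : measurable A -> measurable (lumped m @^-1` A).
  by move=> mA; rewrite -[X in measurable X]setTI; exact: ml.
exists P; split; last exact: EP.
split.
- have mS := measurable_start T0 (xn x m.+1).
  rewrite PQ//; apply: (prob1S (measurable_start T0 x)) => //; first exact: pre.
  by move=> w /= hw i; rewrite (_ : opath w 0 = x)//; apply: funext.
- move=> t i tT mi; rewrite PQ; last exact: measurable_eval.
  rewrite (_ : _ @^-1` _ = setT) ?probability_setT//; apply/seteqP; split => // w _ /=.
  by rewrite xnE ltnNge (ltnW mi)/= gtn_eqF.
- move=> g Cg; rewrite law_n_martingale.
  have lV := @lip_row_firstm R m.+1; have cg : continuous g by case: Cg.
  have cr : continuous (genL (alphan alpha m.+1) ainf g) by exact: continuous_genL.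
  apply: (martingale_of_tests T0 lV cg cr) => s t l s0 st tT hl.
  have sT : 0 <= s <= T by rewrite s0 (le_trans st).
  have tT' : 0 <= t <= T by rewrite tT (le_trans s0).
  have bt := bmf_tprod T0 l.
  have bM r : 0 <= r <= T -> bmf (Mf (T := T) (@firstm R m.+1) g (genL (alphan alpha m.+1) ainf g) r).
    by move=> rT; exact: Mf_bmf.
  rewrite !EP; [|by apply: bmfM => //; exact: bM..].
  under [LHS]eq_Ex do rewrite mulrC; under [RHS]eq_Ex do rewrite mulrC.
  (* A test product of the lumped path is not one of the original path, since its last coordinate is
     a tail mass; it is only adapted with values in [[0, 1]], whence the general form of the
     test. *)
  apply: (martingale_test T0 (@lip_row_lump R m) cg cr (martQ Cg) s0 st tT).
  + by move=> w; exact: tprod01.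
  + apply: adapted_filt => //; first exact: (measurableT_comp bt.1 ml).
    by move=> w v h; apply: eq_big_seq => y /(allP hl) yl /=; rewrite h.
Qed.

End lumped_paths.

Theorem theorem2p3 (R : realType) (alpha : nat -> R) (ainf : R)
  (x : nat -> R) (T : R) :
  (forall i, 0 < alpha i) ->
  cvgn (fun n => \sum_(i < n) alpha i) ->
  0 < ainf ->
  in_Delta x ->
  0 < T ->
  (exists P : nat -> probability (OmegaB T) R,
     forall n, law_n alpha ainf x n.+1 (P n)) /\
  (forall P : nat -> probability (OmegaB T) R,
     (forall n, law_n alpha ainf x n.+1 (P n)) ->
     exists Pinf : probability (OmegaB T) R,
       weak_cvg P Pinf /\
       forall (m : nat) (g : 'rV[R]_m -> R), C2 g ->
         is_martingale Pinf (fun t (w : OmegaB T) =>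
           g (firstm m (opath w t)) -
           Rintegral lebesgue_measure [set u | 0 <= u <= t]
             (fun u => Linf alpha ainf g (opath w u)))).
Proof.
move=> alpha0 calpha ainf0 Dx T0.
have sa : summable alpha by split=> // i; exact: ltW.
have [sx x1] := in_Delta_summable Dx.
have [Q [startQ martQ]] := limit_law sa (ltW ainf0) sx x1 T0.
have hlaw m := lump_law T0 startQ martQ m.
split; first by have /choice[P hP] := hlaw; exists P => n; case: (hP n).
move=> P hP; exists Q; split.
- move=> F [K hK] cF.
  have bF : bmf F by split; [exact: continuous_measurable|exists K].
  (* Uniqueness places all the given laws on one probability space, as laws of lumped versions of a
     single path. *)
  have E n : Ex (P n) F = Ex Q (fun w => F (lumped n w)).
    have [P' [h' <-//]] := hlaw n; have M0 := law_n_monomials (hP n); have M1 := law_n_monomials h'.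
    have [s z _] := hP n; have [s' z' _] := h'.
    exact: (law_unique T0 M0 M1 s s' z z' bF).
  rewrite (_ : (fun n => Rintegral (P n) setT F) = fun n => Ex Q (fun w => F (lumped n w))); last first.
    by apply: funext => n; exact: E.
  apply: (Ex_cvg (M := K)) => [n|n w|w]; last 1 first.
  + apply/cvgrPdist_lt => e e0; have [d d0 hd] := cF w e e0.
    have [m0 hm] := dist_lump T0 w d0; exists m0 => // n /= mn.
    by rewrite distrC; apply: hd; exact: hm.
  + split; last by exists K => w; exact: hK.
    exact: (measurableT_comp bF.1 (lump_measurable T0 n)).
  + exact: hK.
- move=> m g Cg; have := martQ m _ (C2_keep Cg); congr is_martingale.
  apply: funext => t; apply: funext => w; rewrite /Mf keep_lump; congr (_ - Rintegral _ _ _).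
  by apply: funext => u; rewrite LinfE//; exact: path_Delta_all.
Qed.
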